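(* Assume the parameters $\varsigma_i$ ($i\in I$) satisfy the following conditions: (a) $\overline{\varsigma_iq_i}=\varsigma_iq_i$, if $\tau i=i$ and $a_{ij}\neq0$ for some $j\in I\setminus\{i\}$; (b) $\overline{\varsigma_i}=\varsigma_i=\varsigma_{\tau i}$, if $\tau i\neq i$ and $a_{i,\tau i}=0$; (c) $\varsigma_{\tau i}=q_i^{-a_{i,\tau i}}\overline{\varsigma_i}$, if $\tau i\neq i$ and $a_{i,\tau i}\neq0$. Then there exists a $\mathbb K$-algebra automorphism $\overline{\phantom{x}}:\mathbf U^\imath\to\mathbf U^\imath$ (called a bar involution) such that $$\overline q=q^{-1},\qquad\overline{K_\mu}=K_\mu^{-1},\qquad\overline{B_i}=B_i,\qquad\forall\mu\in Y^\imath,\ i\in I.$$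
   Context: For $f\in\mathbb K(q)$, $\overline f$ denotes the image of $f$ under the $\mathbb K$-automorphism $q\mapsto q^{-1}$ of $\mathbb K(q)$. Root datum. $(I,\cdot)$ is a Cartan datum: $I$ is a finite set and $\cdot$ is a symmetric bilinear form on $\mathbb Z[I]$ with $i\cdot i\in\{2,4,6,\dots\}$ and $2\frac{i\cdot j}{i\cdot i}\in\{0,-1,-2,\dots\}$ for $i\ne j$. A root datum of type $(I,\cdot)$ is given: finitely generated free abelian groups $Y,X$ with a perfect bilinear pairing $\langle\cdot,\cdot\rangle:Y\times X\to\mathbb Z$, and embeddings $I\to X$, $i\mapsto\alpha_i$, $I\to Y$, $i\mapsto h_i$, with $a_{ij}:=\langle h_i,\alpha_j\rangle=2\frac{i\cdot j}{i\cdot i}$. The families $\{\alpha_i\}$ and $\{h_i\}$ are assumed linearly independent. Put $\epsilon_i=\frac{i\cdot i}{2}$. $\mathbb K$ is a field of characteristic $0$, $q$ an indeterminate, $q_i=q^{\epsilon_i}$. Put $[n]_{q_i}=\frac{q_i^n-q_i^{-n}}{q_i-q_i^{-1}}$, $[m]_{q_i}^!=[1]_{q_i}\cdots[m]_{q_i}$, $\begin{bmatrix}n\\d\end{bmatrix}_{q_i}=\frac{[n]_{q_i}\cdots[n-d+1]_{q_i}}{[d]_{q_i}^!}$ for $d\ge0$. Quantum group. $\mathbf U$ is the associative $\mathbb K(q)$-algebra with generators $E_i,F_i$ ($i\in I$), $K_h$ ($h\in Y$) and relations $K_0=1$, $K_hK_{h'}=K_{h+h'}$, $K_hE_i=q^{\langle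 h,\alpha_i\rangle}E_iK_h$, $K_hF_i=q^{-\langle h,\alpha_i\rangle}F_iK_h$, $[E_i,F_j]=\delta_{ij}\frac{\widetilde K_i-\widetilde K_i^{-1}}{q_i-q_i^{-1}}$ with $\widetilde K_i=K_{h_i}^{\epsilon_i}$, and $S_{ij}(E_i,E_j)=0=S_{ij}(F_i,F_j)$ for $i\ne j$, where $S_{ij}(x,y)=\sum_{n=0}^{1-a_{ij}}(-1)^n\begin{bmatrix}1-a_{ij}\\ n\end{bmatrix}_{q_i}x^nyx^{1-a_{ij}-n}$. Quasi-split $\imath$quantum group. $\tau$ is a permutation of $I$ with $\tau^2=\mathrm{id}$ ($\tau=\mathrm{id}$ allowed) and $\tau i\cdot\tau j=i\cdot j$, which is assumed to extend to involutions (also denoted $\tau$) of $X$ and of $Y$ (with $\tau(\alpha_i)=\alpha_{\tau i}$, $\tau(h_i)=h_{\tau i}$) preserving the pairing. Put $Y^\imath=\{h\in Y\mid\tau(h)=-h\}$. The parameters $\varsigma=(\varsigma_i)_{i\in I}\in(\mathbb K(q)^\times)^I$ and $\kappa=(\kappa_i)_{i\in I}\in\mathbb K(q)^I$ satisfy: $\kappa_i=0$ unless $\tau i=i$ and $\langle h_k,\alpha_i\rangle\in2\mathbb Z$ for all $k\in I$ with $\tau k=k$; and $\varsigma_i=\varsigma_{\tau i}$ if $a_{i,\tau i}=0$. Then $\mathbf U^\imath=\mathbf U^\imath_{\varsigma,\kappa}$ is the $\mathbb K(q)$-subalgebra of $\mathbf U$ generated by $B_i=F_i+\varsigma_iE_{\tau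 i}\widetilde K_i^{-1}+\kappa_i\widetilde K_i^{-1}$ ($i\in I$) and $K_\mu$ ($\mu\in Y^\imath$). *)

(* Defs.v *)
From HB Require Import structures.
From mathcomp Require Import all_boot all_order all_algebra.
From mathcomp Require Import boolp.
From mathcomp Require Import finmap.
From mathcomp Require Import monalg.

Set Implicit Arguments.
Unset Strict Implicit.
Unset Printing Implicit Defensive.

Import GRing.Theory.
Local Open Scope ring_scope.
Local Open Scope quotient_scope.

(* Free associative algebras.  The operations are those of monalg, sealed with
   [HB.lock] to keep unification from computing with them. *)

Definition freealg (R : comNzRingType) (G : choiceType) : Type := {malg R[{fmonom G}]}.

HB.lock Definition freealg_one (R : comNzRingType) (G : choiceType) : freealg R G :=
  (1 : {malg R[{fmonom G}]}).

HB.lock Definition freealg_mul (R : comNzRingType) (G : choiceType)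
  (x y : freealg R G) : freealg R G := (x : {malg R[{fmonom G}]}) * y.

HB.lock Definition freealg_scale (R : comNzRingType) (G : choiceType)
  (c : R) (x : freealg R G) : freealg R G := c *: (x : {malg R[{fmonom G}]}).

HB.lock Definition fgen (R : comNzRingType) (G : choiceType) (g : G) : freealg R G :=
  << fmu g >>.

Section FreeAlgebra.
Variables (R : comNzRingType) (G : choiceType).

Local Notation M := {malg R[{fmonom G}]}.
Local Notation A := (freealg R G).

HB.instance Definition _ := GRing.Zmodule.copy A M.

Let E := (freealg_one.unlock, freealg_mul.unlock, freealg_scale.unlock).

Lemma freealg_mulA : associative (@freealg_mul R G).
Proof. by move=> x y z; rewrite !E; apply: (@mulrA M). Qed.

Lemma freealg_mul1l : left_id (freealg_one R G) (@freealg_mul R G).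
Proof. by move=> x; rewrite !E; apply: (@mul1r M). Qed.

Lemma freealg_mul1r : right_id (freealg_one R G) (@freealg_mul R G).
Proof. by move=> x; rewrite !E; apply: (@mulr1 M). Qed.

Lemma freealg_mulDl : left_distributive (@freealg_mul R G) +%R.
Proof. by move=> x y z; rewrite !E; apply: (@mulrDl M). Qed.

Lemma freealg_mulDr : right_distributive (@freealg_mul R G) +%R.
Proof. by move=> x y z; rewrite !E; apply: (@mulrDr M). Qed.

Lemma freealg_oner_neq0 : freealg_one R G != 0.
Proof. by rewrite !E; apply: (@oner_neq0 M). Qed.

HB.instance Definition _ := GRing.Zmodule_isNzRing.Build A
  freealg_mulA freealg_mul1l freealg_mul1r freealg_mulDl freealg_mulDr
  freealg_oner_neq0.

Lemma freealg_scaleA a b (x : A) :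
  freealg_scale a (freealg_scale b x) = freealg_scale (a * b) x.
Proof. by rewrite !E; apply: (@scalerA R M). Qed.

Lemma freealg_scale1 : left_id 1 (@freealg_scale R G).
Proof. by move=> x; rewrite !E; apply: (@scale1r R M). Qed.

Lemma freealg_scaleDr : right_distributive (@freealg_scale R G) +%R.
Proof. by move=> c x y; rewrite !E; apply: (@scalerDr R M). Qed.

Lemma freealg_scaleDl (x : A) : {morph (@freealg_scale R G)^~ x : a b / a + b}.
Proof. by move=> a b; rewrite !E; apply: (@scalerDl R M). Qed.

HB.instance Definition _ := GRing.Zmodule_isLmodule.Build R A
  freealg_scaleA freealg_scale1 freealg_scaleDr freealg_scaleDl.

Lemma freealg_mulE (x y : A) : x * y = (x : M) * (y : M).
Proof. by rewrite -[LHS]/(freealg_mul x y) freealg_mul.unlock. Qed.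

Lemma freealg_scaleE c (x : A) : c *: x = c *: (x : M).
Proof. by rewrite -[LHS]/(freealg_scale c x) freealg_scale.unlock. Qed.

Lemma freealg_oneE : (1 : A) = (1 : M).
Proof. by rewrite -[LHS]/(freealg_one R G) freealg_one.unlock. Qed.

Lemma freealg_scalerAl (c : R) (x y : A) : c *: (x * y) = c *: x * y.
Proof. by rewrite !(freealg_mulE, freealg_scaleE); apply: (@scalerAl R M). Qed.

HB.instance Definition _ := GRing.Lmodule_isLalgebra.Build R A freealg_scalerAl.

Lemma malgC_central (c : R) (x : M) : c%:MP * x = x * c%:MP.
Proof.
rewrite !malgM_def fgmulUg fgmulgU.
by apply: eq_bigr => k _; rewrite mul1m mulm1 mulrC.
Qed.

Lemma freealg_scalerAr (c : R) (x y : A) : c *: (x * y) = x * (c *: y).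
Proof.
rewrite !(freealg_mulE, freealg_scaleE).
by rewrite -!mul_malgC !mulrA malgC_central.
Qed.

HB.instance Definition _ := GRing.Lalgebra_isAlgebra.Build R A freealg_scalerAr.

End FreeAlgebra.

(* The quotient of an algebra by the two-sided ideal generated by [S].  The
   algebras of the library are nontrivial, so that the ideal has to be proper. *)

Inductive ideal_gen (R : comNzRingType) (A : algType R) (S : A -> Prop) : A -> Prop :=
| ideal_gen_base x : S x -> ideal_gen S x
| ideal_gen0 : ideal_gen S 0
| ideal_genD x y : ideal_gen S x -> ideal_gen S y -> ideal_gen S (x + y)
| ideal_genMl a x : ideal_gen S x -> ideal_gen S (a * x)
| ideal_genMr a x : ideal_gen S x -> ideal_gen S (x * a).

Section IdealPredicate.
Variables (R : comNzRingType) (A : algType R) (S : A -> Prop).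

Definition ideal_pred : {pred A} := fun x => `[< ideal_gen S x >].

Lemma ideal_pred_zmod : zmod_closed ideal_pred.
Proof.
split=> [|x y /asboolP Sx /asboolP Sy]; first by apply/asboolP/ideal_gen0.
by apply/asboolP/ideal_genD => //; rewrite -mulN1r; apply: ideal_genMl.
Qed.

HB.instance Definition _ := GRing.isZmodClosed.Build A ideal_pred ideal_pred_zmod.

Definition quotalg of ~ ideal_gen S 1 : Type := Quotient.quot ideal_pred.

HB.instance Definition _ (properS : ~ ideal_gen S 1) :=
  GRing.Zmodule.on (quotalg properS).
HB.instance Definition _ (properS : ~ ideal_gen S 1) :=
  EqQuotient.on (quotalg properS).

End IdealPredicate.

HB.lock Definition quotalg_pi (R : comNzRingType) (A : algType R) (S : A -> Prop)
  (properS : ~ ideal_gen S 1) (x : A) : quotalg properS :=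
  \pi_(Quotient.quot (ideal_pred S)) x.

HB.lock Definition quotalg_one (R : comNzRingType) (A : algType R) (S : A -> Prop)
  (properS : ~ ideal_gen S 1) : quotalg properS := quotalg_pi properS 1.

HB.lock Definition quotalg_mul (R : comNzRingType) (A : algType R) (S : A -> Prop)
  (properS : ~ ideal_gen S 1) (u v : quotalg properS) : quotalg properS :=
  quotalg_pi properS (repr u * repr v).

HB.lock Definition quotalg_scale (R : comNzRingType) (A : algType R) (S : A -> Prop)
  (properS : ~ ideal_gen S 1) (c : R) (u : quotalg properS) : quotalg properS :=
  quotalg_pi properS (c *: repr u).

Section IdealQuotient.
Variables (R : comNzRingType) (A : algType R) (S : A -> Prop).
Variable properS : ~ ideal_gen S 1.

Local Notation Q := (quotalg properS).
Local Notation quotalg_pi := (quotalg_pi properS).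
Local Notation quotalg_one := (quotalg_one properS).
Local Notation quotalg_mul := (@quotalg_mul R A S properS).
Local Notation quotalg_scale := (@quotalg_scale R A S properS).

Lemma quotalg_piP x y : reflect (ideal_gen S (x - y)) (quotalg_pi x == quotalg_pi y).
Proof. by rewrite quotalg_pi.unlock -Quotient.idealrBE; apply: asboolP. Qed.

Lemma quotalg_pi_repr (x : Q) : quotalg_pi (repr x) = x.
Proof. by rewrite quotalg_pi.unlock; apply: reprK. Qed.

Lemma quotalg_piB : {morph quotalg_pi : x y / x - y}.
Proof. by move=> x y; rewrite quotalg_pi.unlock /= !piE. Qed.

Lemma quotalg_piD : {morph quotalg_pi : x y / x + y}.
Proof. by move=> x y; rewrite quotalg_pi.unlock /= !piE. Qed.

Lemma quotalg_pi_surj (u : Q) : exists x, u = quotalg_pi x.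
Proof. by exists (repr u); rewrite quotalg_pi_repr. Qed.

Lemma ideal_gen_repr x : ideal_gen S (repr (quotalg_pi x) - x).
Proof. by apply/quotalg_piP; rewrite quotalg_pi_repr. Qed.

Lemma quotalg_mulE x y : quotalg_mul (quotalg_pi x) (quotalg_pi y) = quotalg_pi (x * y).
Proof.
rewrite quotalg_mul.unlock; apply/eqP/quotalg_piP.
set x' := repr _; set y' := repr _.
have -> : x' * y' - x * y = (x' - x) * y' + x * (y' - y).
  by rewrite mulrBl mulrBr addrA subrK.
by apply: ideal_genD; [apply: ideal_genMr | apply: ideal_genMl]; apply: ideal_gen_repr.
Qed.

Lemma quotalg_scaleE c x : quotalg_scale c (quotalg_pi x) = quotalg_pi (c *: x).
Proof.
rewrite quotalg_scale.unlock; apply/eqP/quotalg_piP; rewrite -scalerBr -mulr_algl.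
by apply: ideal_genMl; apply: ideal_gen_repr.
Qed.

Lemma quotalg_mulA : associative quotalg_mul.
Proof.
move=> u v w; have [[[x ->] [y ->]] [z ->]] :=
  (quotalg_pi_surj u, quotalg_pi_surj v, quotalg_pi_surj w).
by rewrite !quotalg_mulE mulrA.
Qed.

Lemma quotalg_mul1l : left_id quotalg_one quotalg_mul.
Proof. by move=> u; have [x ->] := quotalg_pi_surj u; rewrite quotalg_one.unlock quotalg_mulE mul1r. Qed.

Lemma quotalg_mul1r : right_id quotalg_one quotalg_mul.
Proof. by move=> u; have [x ->] := quotalg_pi_surj u; rewrite quotalg_one.unlock quotalg_mulE mulr1. Qed.

Lemma quotalg_mulDl : left_distributive quotalg_mul +%R.
Proof.
move=> u v w; have [[[x ->] [y ->]] [z ->]] :=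
  (quotalg_pi_surj u, quotalg_pi_surj v, quotalg_pi_surj w).
by rewrite -quotalg_piD !quotalg_mulE -quotalg_piD mulrDl.
Qed.

Lemma quotalg_mulDr : right_distributive quotalg_mul +%R.
Proof.
move=> u v w; have [[[x ->] [y ->]] [z ->]] :=
  (quotalg_pi_surj u, quotalg_pi_surj v, quotalg_pi_surj w).
by rewrite -quotalg_piD !quotalg_mulE -quotalg_piD mulrDr.
Qed.

Lemma quotalg_pi0 : quotalg_pi 0 = 0.
Proof. by rewrite -[in LHS](subrr 0) quotalg_piB subrr. Qed.

Lemma quotalg_oner_neq0 : quotalg_one != 0.
Proof.
by rewrite quotalg_one.unlock -quotalg_pi0; apply/negP => /quotalg_piP; rewrite subr0.
Qed.

HB.instance Definition _ := GRing.Zmodule_isNzRing.Build Q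
  quotalg_mulA quotalg_mul1l quotalg_mul1r quotalg_mulDl quotalg_mulDr
  quotalg_oner_neq0.

Lemma quotalg_scaleA a b u :
  quotalg_scale a (quotalg_scale b u) = quotalg_scale (a * b) u.
Proof. by have [x ->] := quotalg_pi_surj u; rewrite !quotalg_scaleE scalerA. Qed.

Lemma quotalg_scale1 : left_id 1 quotalg_scale.
Proof. by move=> u; have [x ->] := quotalg_pi_surj u; rewrite !quotalg_scaleE scale1r. Qed.

Lemma quotalg_scaleDr : right_distributive quotalg_scale +%R.
Proof.
move=> c u v; have [[x ->] [y ->]] := (quotalg_pi_surj u, quotalg_pi_surj v).
by rewrite -quotalg_piD !quotalg_scaleE -quotalg_piD scalerDr.
Qed.

Lemma quotalg_scaleDl u : {morph quotalg_scale^~ u : a b / a + b}.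
Proof.
move=> a b; have [x ->] := quotalg_pi_surj u.
by rewrite !quotalg_scaleE -quotalg_piD scalerDl.
Qed.

HB.instance Definition _ := GRing.Zmodule_isLmodule.Build R Q
  quotalg_scaleA quotalg_scale1 quotalg_scaleDr quotalg_scaleDl.

Lemma quotalg_scalerAl (c : R) (u v : Q) : c *: (u * v) = c *: u * v.
Proof.
have [[x ->] [y ->]] := (quotalg_pi_surj u, quotalg_pi_surj v).
rewrite /GRing.scale /GRing.mul /= !(quotalg_mulE, quotalg_scaleE).
by rewrite scalerAl.
Qed.

HB.instance Definition _ := GRing.Lmodule_isLalgebra.Build R Q quotalg_scalerAl.

Lemma quotalg_scalerAr (c : R) (u v : Q) : c *: (u * v) = u * (c *: v).
Proof.
have [[x ->] [y ->]] := (quotalg_pi_surj u, quotalg_pi_surj v).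
rewrite /GRing.scale /GRing.mul /= !(quotalg_mulE, quotalg_scaleE).
by rewrite scalerAr.
Qed.

HB.instance Definition _ := GRing.Lalgebra_isAlgebra.Build R Q quotalg_scalerAr.

Lemma quotalg_pi_zmod_morphism : zmod_morphism quotalg_pi.
Proof. exact: quotalg_piB. Qed.

Lemma quotalg_pi_monoid_morphism : monoid_morphism quotalg_pi.
Proof.
split=> [|x y]; last by rewrite [RHS]quotalg_mulE.
by rewrite -[RHS]/quotalg_one quotalg_one.unlock.
Qed.

Lemma quotalg_pi_scalable : scalable quotalg_pi.
Proof. by move=> c x; rewrite [RHS]quotalg_scaleE. Qed.

HB.instance Definition _ :=
  GRing.isZmodMorphism.Build A Q quotalg_pi quotalg_pi_zmod_morphism.
HB.instance Definition _ :=
  GRing.isMonoidMorphism.Build A Q quotalg_pi quotalg_pi_monoid_morphism.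
HB.instance Definition _ :=
  GRing.isScalable.Build R A Q *:%R quotalg_pi quotalg_pi_scalable.

End IdealQuotient.

Section SubalgebraGenerated.
Variables (R : comNzRingType) (A : algType R).

Inductive subalg_gen (S : A -> Prop) : A -> Prop :=
| subalg_gen_base x : S x -> subalg_gen S x
| subalg_gen1 : subalg_gen S 1
| subalg_genZ c x : subalg_gen S x -> subalg_gen S (c *: x)
| subalg_genD x y : subalg_gen S x -> subalg_gen S y -> subalg_gen S (x + y)
| subalg_genM x y : subalg_gen S x -> subalg_gen S y -> subalg_gen S (x * y).

Variable S : A -> Prop.

Definition subalg_pred : {pred A} := fun x => `[< subalg_gen S x >].

Lemma subalg_pred_closed : subalg_closed subalg_pred.
Proof.
split=> [|c x y /asboolP Sx /asboolP Sy|x y /asboolP Sx /asboolP Sy].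
- exact/asboolP/subalg_gen1.
- by apply/asboolP/subalg_genD => //; apply: subalg_genZ.
- by apply/asboolP/subalg_genM.
Qed.

HB.instance Definition _ :=
  GRing.isSubalgClosed.Build R A subalg_pred subalg_pred_closed.

Definition subalg : Type := {x : A | x \in subalg_pred}.

HB.instance Definition _ := SubChoice.on subalg.
HB.instance Definition _ := [SubChoice_isSubAlgebra of subalg by <:].

Definition subalg_incl x (Sx : S x) : subalg :=
  exist _ x (introT (asboolP _) (subalg_gen_base Sx)).

End SubalgebraGenerated.

Section RationalFunctions.
Variable K : fieldType.

Definition Kq : fieldType := {fraction {poly K}}.

Definition Kq_frac : {poly K} -> Kq := @FracField.tofrac {poly K}.
HB.instance Definition _ := GRing.RMorphism.on Kq_frac.

Definition Kq_const (c : K) : Kq := Kq_frac c%:P.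
HB.instance Definition _ := GRing.RMorphism.copy Kq_const (Kq_frac \o polyC).

Definition q : Kq := Kq_frac 'X.

Definition Kq_num (f : Kq) : {poly K} := (repr (f : {fraction {poly K}})).1.
Definition Kq_den (f : Kq) : {poly K} := (repr (f : {fraction {poly K}})).2.

Definition subst_qV (p : {poly K}) : Kq := (map_poly Kq_const p).[q^-1].
HB.instance Definition _ :=
  GRing.RMorphism.copy subst_qV (horner_eval q^-1 \o map_poly Kq_const).

End RationalFunctions.

Arguments q {K}.

(* The automorphism f(q) |-> f(q^-1); by [barE] below, it does not depend on
   how f is written as a fraction. *)
HB.lock Definition bar (K : fieldType) (f : Kq K) : Kq K :=
  subst_qV (Kq_num f) / subst_qV (Kq_den f).

Section Bar.
Variable K : fieldType.

Local Notation Kq := (Kq K).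
Local Notation Kq_frac := (@Kq_frac K).
Local Notation Kq_const := (@Kq_const K).
Local Notation subst_qV := (@subst_qV K).
Local Notation q := (@q K).
Local Notation bar := (@bar K).

Lemma Kq_den_neq0 (f : Kq) : Kq_den f != 0.
Proof. exact: denom_ratioP. Qed.

Lemma Kq_frac_eq0 p : (Kq_frac p == 0) = (p == 0).
Proof. exact: tofrac_eq0. Qed.

Lemma Kq_numden (f : Kq) : f = Kq_frac (Kq_num f) / Kq_frac (Kq_den f).
Proof.
have d0 := Kq_den_neq0 f.
apply: (canRL (mulfK _)); first by rewrite Kq_frac_eq0.
rewrite /Kq_frac /Kq_num /Kq_den in d0 *.
move: f d0; rewrite /Kq => f; set r := repr f => d0.
rewrite -[f]reprK -/r !piE; apply/eqP; rewrite FracField.equivf_def.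
by rewrite /FracField.mulf !numden_Ratio ?mulr1 ?oner_eq0 // mulrC.
Qed.

Lemma q_neq0 : q != 0.
Proof. by rewrite Kq_frac_eq0 polyX_eq0. Qed.

Lemma subst_qV_neq0 p : p != 0 -> subst_qV p != 0.
Proof.
move=> p0; apply/eqP => sp0.
have: Kq_frac (\poly_(i < size p) p`_(size p - i.+1)) = q ^+ (size p).-1 * subst_qV p.
  rewrite poly_def rmorph_sum /= /subst_qV horner_coef size_map_poly mulr_sumr.
  rewrite (reindex_inj rev_ord_inj) /=; apply: eq_bigr => i _.
  rewrite subnSK // subKn ?(ltnW (ltn_ord i)) // coef_map /= -mul_polyC rmorphM rmorphXn /=.
  rewrite -/(Kq_const _) -/q mulrCA exprVn; congr (_ * _).
  have ->: (size p).-1 = (i + (size p - i.+1))%N.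
    by rewrite -subn1 -[i.+1]add1n subnDA subnKC // -ltnS subn1 prednK ?size_poly_gt0.
  by rewrite addnC exprD mulfK // expf_neq0 ?q_neq0.
rewrite sp0 mulr0 => /eqP; rewrite Kq_frac_eq0 => /eqP /polyP /(_ 0).
rewrite coef_poly size_poly_gt0 p0 coef0 subn1 => /eqP.
by rewrite -/(lead_coef p) lead_coef_eq0 (negPf p0).
Qed.

Lemma barE n d : d != 0 -> bar (Kq_frac n / Kq_frac d) = subst_qV n / subst_qV d.
Proof.
move=> d0; set f := Kq_frac n / Kq_frac d.
have fd0 := Kq_den_neq0 f.
apply/eqP; rewrite bar.unlock eqr_div ?subst_qV_neq0 // -!rmorphM /=.
apply/eqP; congr subst_qV; apply/eqP; rewrite -tofrac_eq !tofracM.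
by rewrite -[_ == _]eqr_div ?tofrac_eq0 // -/(Kq_frac _) eq_sym {1}/f -Kq_numden.
Qed.

Lemma bar_zmod_morphism : zmod_morphism bar.
Proof.
move=> f g; have [fd0 gd0] := (Kq_den_neq0 f, Kq_den_neq0 g).
rewrite {1}(Kq_numden f) {1}(Kq_numden g) -mulNr addf_div ?Kq_frac_eq0 //.
rewrite -(rmorphN Kq_frac) -!(rmorphM Kq_frac) -(rmorphD Kq_frac).
rewrite barE ?mulf_neq0 // bar.unlock -mulNr addf_div ?subst_qV_neq0 //.
by rewrite -(rmorphN subst_qV) -!(rmorphM subst_qV) -(rmorphD subst_qV).
Qed.

Lemma bar_monoid_morphism : monoid_morphism bar.
Proof.
split=> [|f g].
  have := @barE 1 1 (oner_neq0 _); rewrite /Kq_frac tofrac1 divr1 => ->.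
  by rewrite /subst_qV rmorph1 hornerC divr1.
have [fd0 gd0] := (Kq_den_neq0 f, Kq_den_neq0 g).
rewrite {1}(Kq_numden f) {1}(Kq_numden g) mulf_div -!(rmorphM Kq_frac) barE ?mulf_neq0 //.
by rewrite bar.unlock mulf_div !rmorphM.
Qed.

HB.instance Definition _ := GRing.isZmodMorphism.Build Kq Kq bar bar_zmod_morphism.
HB.instance Definition _ := GRing.isMonoidMorphism.Build Kq Kq bar bar_monoid_morphism.

Lemma bar_frac p : bar (Kq_frac p) = subst_qV p.
Proof.
have := @barE p 1 (oner_neq0 _); rewrite -[Kq_frac 1]/(FracField.tofrac 1) tofrac1.
by rewrite divr1 => ->; rewrite rmorph1 divr1.
Qed.

Lemma bar_const c : bar (Kq_const c) = Kq_const c.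
Proof. by rewrite bar_frac /subst_qV map_polyC hornerC. Qed.

Lemma bar_q : bar q = q^-1.
Proof. by rewrite bar_frac /subst_qV map_polyX hornerX. Qed.

Lemma barK : involutive bar.
Proof.
have barD a b : bar (a + b) = bar a + bar b by apply: (rmorphD bar).
have barM a b : bar (a * b) = bar a * bar b by apply: (rmorphM bar).
have barfK p : bar (bar (Kq_frac p)) = Kq_frac p.
  elim/poly_ind: p => [|p c IH]; first by rewrite (rmorph0 Kq_frac) !(rmorph0 bar).
  rewrite (rmorphD Kq_frac) (rmorphM Kq_frac) 2!barD 2!barM IH.
  rewrite -/(Kq_const c) 2!(bar_const c); congr (_ * _ + _).
  have barq : bar (bar q) = q
    by exact: etrans (congr1 bar bar_q)
      (etrans (fmorphV bar q) (etrans (congr1 _ bar_q) (invrK q))).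
  exact: barq.
have barV a : bar a^-1 = (bar a)^-1 by apply: (fmorphV bar).
move=> f; rewrite {1}(Kq_numden f) 2!barM 2!barV 2!barfK.
by rewrite -Kq_numden.
Qed.

End Bar.

(* The symmetric bilinear form on Z[I] is given by its Gram matrix. *)

Record cartan_datum (I : finType) := CartanDatum {
  dot : I -> I -> int;
  dotC : forall i j, dot i j = dot j i;
  dot_diag : forall i, exists2 n : nat, (0 < n)%N & dot i i = (2 * n)%N%:Z;
  dot_offdiag : forall i j, i != j ->
    exists n : nat, 2 * (dot i j)%:~R / (dot i i)%:~R = - n%:R :> rat
}.

Definition fg_free (V : zmodType) : Prop :=
  exists n : nat, exists f : {additive V -> 'rV[int]_n}, bijective f.

Definition Z_linearly_independent (I : finType) (V : zmodType) (v : I -> V) : Prop :=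
  forall c : I -> int, \sum_i v i *~ c i = 0 -> forall i, c i = 0.

Record root_datum (I : finType) (C : cartan_datum I) := RootDatum {
  coweights : zmodType;
  weights : zmodType;
  coweights_fg_free : fg_free coweights;
  weights_fg_free : fg_free weights;
  pairing : coweights -> weights -> int;
  pairingDl : forall h h' x, pairing (h + h') x = pairing h x + pairing h' x;
  pairingDr : forall h x x', pairing h (x + x') = pairing h x + pairing h x';
  pairing_perfectl : forall g : {additive weights -> int},
    exists! h, forall x, pairing h x = g x;
  pairing_perfectr : forall g : {additive coweights -> int},
    exists! x, forall h, pairing h x = g h;
  coroot : I -> coweights;
  root : I -> weights;
  coroot_inj : injective coroot;
  root_inj : injective root;
  pairing_coroot_root : forall i j,
    (pairing (coroot i) (root j))%:~R =
      2 * (dot C i j)%:~R / (dot C i i)%:~R :> rat;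
  coroot_indep : Z_linearly_independent coroot;
  root_indep : Z_linearly_independent root
}.

Section QuantumIntegers.
Variable F : fieldType.
Implicit Type v : F.

Definition qint v (n : int) : F := (v ^ n - v ^ (- n)) / (v - v^-1).

Definition qfact v (m : nat) : F := \prod_(1 <= k < m.+1) qint v k.

Definition qbinom v (n : int) (d : nat) : F :=
  (\prod_(k < d) qint v (n - k%:Z)) / qfact v d.

End QuantumIntegers.

Section QuantumGroup.
Variables (K : fieldType) (I : finType) (C : cartan_datum I) (D : root_datum C).

Local Notation Y := (coweights D).
Local Notation X := (weights D).

Definition cartan_entry (i j : I) : int := pairing (coroot D i) (root D j).

Definition eps (i : I) : nat := (`|dot C i i| %/ 2)%N.

Definition q_ (i : I) : Kq K := q ^+ eps i.

(* S_ij(x, y); meaningful for i <> j, as 1 - a_ij is then positive. *)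
Definition serre (A : algType (Kq K)) (i j : I) (x y : A) : A :=
  let m := `|1 - cartan_entry i j|%N in
  \sum_(n < m.+1) ((-1) ^+ n * qbinom (q_ i) m n) *: (x ^+ n * y * x ^+ (m - n)).

Definition qg_free : algType (Kq K) := freealg (Kq K) (I + I + Y)%type.
Definition fE (i : I) : qg_free := fgen (Kq K) (inl (inl i)).
Definition fF (i : I) : qg_free := fgen (Kq K) (inl (inr i)).
Definition fK (h : Y) : qg_free := fgen (Kq K) (inr h).

(* Each element stands for the relation equating it to 0; the inverse of
   tilde K_i = K_{h_i}^eps_i is K_{- h_i}^eps_i. *)
Inductive qg_relator : qg_free -> Prop :=
| relator_K0 : qg_relator (fK 0 - 1)
| relator_KD h h' : qg_relator (fK h * fK h' - fK (h + h'))
| relator_KE h i :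
    qg_relator (fK h * fE i - q ^ pairing h (root D i) *: (fE i * fK h))
| relator_KF h i :
    qg_relator (fK h * fF i - q ^ (- pairing h (root D i)) *: (fF i * fK h))
| relator_EF i j :
    qg_relator (fE i * fF j - fF j * fE i
      - ((i == j)%:R / (q_ i - (q_ i)^-1)) *:
          (fK (coroot D i) ^+ eps i - fK (- coroot D i) ^+ eps i))
| relator_serreE i j : i != j -> qg_relator (serre i j (fE i) (fE j))
| relator_serreF i j : i != j -> qg_relator (serre i j (fF i) (fF j)).

(* The counit E_i, F_i |-> 0, K_h |-> 1: the relations do not collapse the
   algebra to 0. *)
Definition is_K_gen (g : I + I + Y) : bool := if g is inr _ then true else false.

Definition counit_word (w : {fmonom (I + I + Y)%type}) : Kq K :=
  (all is_K_gen w)%:R.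

Lemma counit_word_mmorphism : mmorphism counit_word.
Proof.
split=> [w w'|]; last by rewrite /counit_word fm1.
by rewrite /counit_word fmM all_cat -mulnb natrM.
Qed.

HB.instance Definition _ :=
  isMultiplicative.Build {fmonom (I + I + Y)%type} (Kq K) counit_word
    counit_word_mmorphism.

Definition counit (x : qg_free) : Kq K := mmap idfun counit_word x.

HB.instance Definition _ := GRing.Additive.copy counit (mmap idfun counit_word).

Lemma counit_monoid_morphism : monoid_morphism counit.
Proof.
split=> [|x y]; rewrite /counit ?freealg_oneE ?freealg_mulE; first exact: mmap1.
exact: (rmorphM (mmap idfun counit_word)).
Qed.

HB.instance Definition _ :=
  GRing.isMonoidMorphism.Build qg_free (Kq K) counit counit_monoid_morphism.

Lemma counitZ c x : counit (c *: x) = c * counit x.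
Proof. by rewrite /counit freealg_scaleE; apply: mmapZ. Qed.

Lemma counit_gen g : counit (fgen (Kq K) g) = (is_K_gen g)%:R.
Proof. by rewrite /counit fgen.unlock mmapU mul1r /counit_word fmuE /= andbT. Qed.

Lemma qg_relator_trivial (f : {rmorphism qg_free -> Kq K}) :
  (forall c x, f (c *: x) = c * f x) ->
  (forall i, f (fE i) = 0) -> (forall i, f (fF i) = 0) -> (forall h, f (fK h) = 1) ->
  forall x, qg_relator x -> f x = 0.
Proof.
move=> fZ f_E f_F f_K.
have f_serre i j x y : f x = 0 -> f y = 0 -> f (serre i j x y) = 0.
  move=> x0 y0; rewrite /serre rmorph_sum big1 //= => n _.
  by rewrite fZ !rmorphM y0 mulr0 mul0r mulr0.
move=> _ [|h h'|h i|h i|i j|i j _|i j _]; last 2 first.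
- exact: f_serre.
- exact: f_serre.
- by rewrite rmorphB rmorph1 f_K subrr.
- by rewrite rmorphB rmorphM !f_K mul1r subrr.
- by rewrite rmorphB fZ !rmorphM f_E mulr0 mul0r mulr0 subrr.
- by rewrite rmorphB fZ !rmorphM f_F mulr0 mul0r mulr0 subrr.
- rewrite !rmorphB fZ !rmorphM rmorphB !rmorphXn f_E f_F !f_K.
  by rewrite !expr1n mul0r !subrr mulr0 subrr.
Qed.

Lemma counit_relator x : qg_relator x -> counit x = 0.
Proof.
apply: qg_relator_trivial => [|i|i|h]; first exact: counitZ.
all: by rewrite [LHS]counit_gen ?mulr1n.
Qed.

Lemma qg_relator_proper : ~ ideal_gen qg_relator 1.
Proof.
suff H x : ideal_gen qg_relator x -> counit x = 0.
  by move/H/eqP; rewrite rmorph1 oner_eq0.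
elim=> {x} [x|||a x _|a x _]; first exact: counit_relator.
- exact: raddf0.
- by move=> x y _ x0 _ y0; rewrite raddfD /= x0 y0 addr0.
- by rewrite rmorphM /= => ->; rewrite mulr0.
- by rewrite rmorphM /= => ->; rewrite mul0r.
Qed.

Definition qg : algType (Kq K) := quotalg qg_relator_proper.

Definition qg_pi : qg_free -> qg := quotalg_pi qg_relator_proper.
HB.instance Definition _ := GRing.LRMorphism.on qg_pi.

Definition qE (i : I) : qg := qg_pi (fE i).
Definition qF (i : I) : qg := qg_pi (fF i).
Definition qK (h : Y) : qg := qg_pi (fK h).

Definition qKtilde (i : I) : qg := qK (coroot D i) ^+ eps i.
Definition qKtildeV (i : I) : qg := qK (- coroot D i) ^+ eps i.

Lemma qg_pi_relator x : qg_relator x -> qg_pi x = 0.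
Proof.
move=> Sx; rewrite -(raddf0 qg_pi); apply/eqP/quotalg_piP; rewrite subr0.
exact: ideal_gen_base.
Qed.

Lemma qK0 : qK 0 = 1.
Proof.
apply/eqP; rewrite -subr_eq0 -(rmorph1 qg_pi) -rmorphB.
by apply/eqP/qg_pi_relator/relator_K0.
Qed.

Lemma qKD h h' : qK h * qK h' = qK (h + h').
Proof.
apply/eqP; rewrite -subr_eq0 -rmorphM -rmorphB.
by apply/eqP/qg_pi_relator/relator_KD.
Qed.

Lemma qKV h : qK h * qK (- h) = 1.
Proof. by rewrite qKD subrr qK0. Qed.

Lemma qKtildeK i : qKtilde i * qKtildeV i = 1.
Proof.
rewrite /qKtilde /qKtildeV -exprMn_comm ?qKV ?expr1n //.
by rewrite /GRing.comm !qKD addrC.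
Qed.

End QuantumGroup.

Record diagram_involution (I : finType) (C : cartan_datum I) (D : root_datum C) :=
  DiagramInvolution {
  tau : I -> I;
  tauK : involutive tau;
  tau_dot : forall i j, dot C (tau i) (tau j) = dot C i j;
  tauX : {additive weights D -> weights D};
  tauY : {additive coweights D -> coweights D};
  tauXK : involutive tauX;
  tauYK : involutive tauY;
  tauX_root : forall i, tauX (root D i) = root D (tau i);
  tauY_coroot : forall i, tauY (coroot D i) = coroot D (tau i);
  tau_pairing : forall h x, pairing (tauY h) (tauX x) = pairing h x
}.

Section IQuantumGroup.
Variables (K : fieldType) (I : finType) (C : cartan_datum I) (D : root_datum C).
Variable t : diagram_involution D.
Variables varsigma kappa : I -> Kq K.

Local Notation Y := (coweights D).
Local Notation U := (qg K D).

Definition Yi_pred : {pred Y} := fun h => tauY t h == - h.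

Lemma Yi_zmod_closed : zmod_closed Yi_pred.
Proof.
split=> [|h h']; rewrite !unfold_in ?raddf0 ?oppr0 //.
by move=> /eqP hE /eqP hE'; rewrite raddfB /= hE hE' opprD.
Qed.

HB.instance Definition _ := GRing.isZmodClosed.Build Y Yi_pred Yi_zmod_closed.

Definition Yi : Type := {h : Y | h \in Yi_pred}.

HB.instance Definition _ := SubChoice.on Yi.
HB.instance Definition _ := [SubChoice_isSubZmodule of Yi by <:].

Definition iqg_parameters : Prop :=
  [/\ forall i, varsigma i != 0,
      forall i,
        ~ (tau t i = i /\
           forall k, tau t k = k -> (2 %| pairing (coroot D k) (root D i))%Z) ->
        kappa i = 0
    & forall i, cartan_entry D i (tau t i) = 0 -> varsigma i = varsigma (tau t i)].

Definition qB (i : I) : U :=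
  qF K D i + varsigma i *: (qE K D (tau t i) * qKtildeV K D i)
    + kappa i *: qKtildeV K D i.

Inductive iqg_generator : U -> Prop :=
| iqg_generator_B i : iqg_generator (qB i)
| iqg_generator_K (mu : Yi) : iqg_generator (qK K (val mu)).

Definition iqg : algType (Kq K) := subalg iqg_generator.

Definition iB (i : I) : iqg := subalg_incl (iqg_generator_B i).
Definition iK (mu : Yi) : iqg := subalg_incl (iqg_generator_K mu).

(* The inverse of K_mu in the subalgebra is K_{- mu}. *)
Lemma iKV (mu : Yi) : iK mu * iK (- mu) = 1.
Proof. by apply: val_inj; apply: qKV. Qed.

End IQuantumGroup.

(* Main.v *)
Require Import Defs.
From HB Require Import structures.
From mathcomp Require Import all_boot all_order all_algebra.
From mathcomp Require Import boolp functions.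
From mathcomp Require Import monalg.
From mathcomp Require Import zify ring.

(* The graph of the bar involution is the subalgebra G of U x U', where U' is U
   with scalars acting through f |-> f(q^-1), generated by the (B_i, B_i) and
   the (K_mu, K_mu^-1).  As G is invariant under exchanging the two factors, it
   suffices that its first projection is injective.

   Define x(m) by x(0) = F_j and x(m+1) = F_i x(m) - s(m) x(m) F_i, where
   s(m) = q_i^(2m + a_ij); then S_ij(F_i, F_j) = (-1)^(1 - a_ij) x(1 - a_ij).  Its analogue in B_i and B_j equals terms of lower
   degree: for tau i = i it is a truncation of the continuant obtained by adding
   a term -d(m) x(m-1) to the recursion, and the continuant vanishes; for
   j = tau i <> i two terms B_i^a K are left; otherwise it vanishes.  A continuant
   is unchanged when its index set is reversed, and on these coefficients this
   reversal is the bar automorphism, by (a)-(c).  So in G the Serre elements of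
   the (B_i, B_i) also have lower degree.

   U acts on the algebra of the F_i and K_h with E_i acting as a skew derivation,
   so that a word in the B_i applied to 1 is the same word in the F_i up to lower
   degree.  If an element of G has first component 0, its leading part is thus a
   relation between the F_i and K_h, hence a consequence of the Serre relations,
   and the element has lower degree than assumed; by induction it is 0. *)

(** No presentation of U^i by generators and relations and no PBW basis of U is used. The relations
    between the B_i are needed only modulo lower degree, and their completeness is replaced by the
    triangular action of words in the B_i on one explicit module.

    For tau i = i, and for j different from tau i, the continuant vanishes on each of the three
    parts of B_j. On F_j the operator B_i can be replaced by F_i, and the Serre relation of the F's
    remains. On E_{tau j} K_j^-1 the summands F_i and E_{tau i} K_i^-1 of B_i exchange roles, which
    inverts q_i; reversal undoes the inversion and the Serre relation of the E's remains. So
    reversal serves twice: to prove a relation, and to compare it with its bar image.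

    On kappa_j K_j^-1 no Serre relation helps. If tau i differs from i, one factor of the product
    kills this term. If tau i = i, the parity condition on kappa makes a_ij even, and what remains
    is a tridiagonal determinant of odd size that equals its own negative, hence is 0 as the
    characteristic is not 2. *)

Set Implicit Arguments.
Unset Strict Implicit.
Unset Printing Implicit Defensive.

Import GRing.Theory Num.Theory.
Local Open Scope ring_scope.

(** * Linear combinations and algebras of endomorphisms *)

Section LinearCombinations.
Variables (R : comPzRingType) (V : lmodType R).

Inductive lin_expr :=
| LVar of nat
| LZero
| LAdd of lin_expr & lin_expr
| LOpp of lin_expr
| LScale of R & lin_expr.

Fixpoint lin_eval (env : seq V) (e : lin_expr) : V :=
  match e with
  | LVar n => nth 0 env n
  | LZero => 0
  | LAdd e1 e2 => lin_eval env e1 + lin_eval env e2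
  | LOpp e1 => - lin_eval env e1
  | LScale c e1 => c *: lin_eval env e1
  end.

Fixpoint lin_coef (e : lin_expr) (n : nat) : R :=
  match e with
  | LVar m => if eqn m n then 1 else 0
  | LZero => 0
  | LAdd e1 e2 => lin_coef e1 n + lin_coef e2 n
  | LOpp e1 => - lin_coef e1 n
  | LScale c e1 => c * lin_coef e1 n
  end.

Fixpoint lin_conds (e1 e2 : lin_expr) (n : nat) : Prop :=
  if n is m.+1 then lin_coef e1 m = lin_coef e2 m /\ lin_conds e1 e2 m else True.

Lemma lin_evalE env e : lin_eval env e = \sum_(n < size env) lin_coef e n *: nth 0 env n.
Proof.
elim: e => [m||e1 IH1 e2 IH2|e IH|c e IH] /=.
- have [lt_m|le_m] := ltnP m (size env).
    rewrite (bigD1 (Ordinal lt_m)) //= (introT eqnP (erefl m)) scale1r big1 ?addr0 //.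
    move=> n ne; case: eqnP => [mn|_]; last by rewrite scale0r.
    by case/eqP: ne; apply: val_inj.
  rewrite nth_default // big1 // => n _; case: eqnP => [mn|_]; last by rewrite scale0r.
  by move: (ltn_ord n); rewrite -mn ltnNge le_m.
- by rewrite big1 // => n _; rewrite scale0r.
- by rewrite IH1 IH2 -big_split; apply: eq_bigr => n _; rewrite scalerDl.
- by rewrite IH -sumrN; apply: eq_bigr => n _; rewrite scaleNr.
- by rewrite IH scaler_sumr; apply: eq_bigr => n _; rewrite scalerA.
Qed.

Lemma lin_eq env e1 e2 :
  lin_conds e1 e2 (size env) -> lin_eval env e1 = lin_eval env e2.
Proof.
move=> conds; rewrite !lin_evalE; apply: eq_bigr => n _; congr (_ *: _).
elim: (size env) conds n => [_ [] //|m IH [/= eq_m eqs] [n /= lt_n]].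
by have [<-//|ne] := eqVneq m n; apply: (IH eqs (Ordinal (_ : (n < m)%N))); lia.
Qed.

End LinearCombinations.

Ltac lin_index x env :=
  lazymatch env with
  | cons ?y ?env' =>
    match tt with
    | _ => let e := constr:(ltac:(unify x y; exact tt)) in constr:(0%N)
    | _ => let n := lin_index x env' in constr:(S n)
    end
  end.

Ltac lin_atoms V t env :=
  lazymatch t with
  | GRing.add ?a ?b => let env' := lin_atoms V a env in lin_atoms V b env'
  | GRing.opp ?a => lin_atoms V a env
  | GRing.scale _ ?a => lin_atoms V a env
  | GRing.zero => env
  | _ => match tt with
         | _ => let n := lin_index t env in env
         | _ => constr:(@cons V t env)
         end
  end.

Ltac lin_reify R t env :=
  lazymatch t with
  | GRing.add ?a ?b =>
    let ea := lin_reify R a env in let eb := lin_reify R b env in constr:(LAdd ea eb)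
  | GRing.opp ?a => let ea := lin_reify R a env in constr:(LOpp ea)
  | GRing.scale ?c ?a => let ea := lin_reify R a env in constr:(LScale (c : R) ea)
  | GRing.zero => constr:(@LZero R)
  | _ => let n := lin_index t env in constr:(@LVar R n)
  end.

(* Reduces an equation between linear combinations over [R] to the equality of
   the coefficients of each atom. *)
Ltac lin_split R :=
  lazymatch goal with
  | |- @eq ?V ?lhs ?rhs =>
    let env0 := lin_atoms V lhs (@nil V) in
    let env := lin_atoms V rhs env0 in
    let e1 := lin_reify R lhs env in
    let e2 := lin_reify R rhs env in
    apply: (@lin_eq R _ env e1 e2);
    cbn [size lin_conds lin_coef eqn];
    repeat split
  end.

Ltac expand_products :=
  rewrite ?(mulrDl, mulrDr, mulrBl, mulrBr, mulNr, mulrN, mulr0, mul0r, scalerDr, scalerBr, scalerN,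
    mulr1, mul1r);
  repeat (rewrite ?(mulrDl, mulrDr, mulrBl, mulrBr, mulNr, mulrN,
    scalerDr, scalerBr, scalerN, scalerA, mulrA) -?scalerAl -?scalerAr).

(** Representations are obtained by lifting to an endomorphism algebra. Rings here satisfy 1 != 0,
    so the module has to be nonzero, and a proof of this is made an index of the type. *)
Record endo (R : comNzRingType) (V : lmodType R) (nzV : exists v : V, v != 0) := Endo {
  endo_fun :> V -> V;
  endo_linear : forall c x y, endo_fun (c *: x + y) = c *: endo_fun x + endo_fun y
}.

Section EndoAlgebra.
Variables (R : comNzRingType) (V : lmodType R) (nzV : exists v : V, v != 0).

Local Notation E := (endo nzV).

Lemma endoP (f g : E) : f =1 g -> f = g.
Proof.
case: f g => [f f_lin] [g g_lin] /= /funext eq_fg.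
by rewrite -eq_fg in g_lin *; congr Endo; apply: Prop_irrelevance.
Qed.

Lemma endoD (f : E) x y : f (x + y) = f x + f y.
Proof. by have := endo_linear f 1 x y; rewrite !scale1r. Qed.

Lemma endo0 (f : E) : f 0 = 0.
Proof. by apply: (addrI (f 0)); rewrite -endoD !addr0. Qed.

Lemma endoZ (f : E) c x : f (c *: x) = c *: f x.
Proof. by have := endo_linear f c x 0; rewrite endo0 !addr0. Qed.

Fact endo_zero_linear c (x y : V) : 0 = c *: 0 + 0 :> V.
Proof. by rewrite scaler0 addr0. Qed.
Definition endo_zero : E := Endo nzV endo_zero_linear.

Fact endo_add_linear (f g : E) c x y :
  f (c *: x + y) + g (c *: x + y) = c *: (f x + g x) + (f y + g y).
Proof. by rewrite !endo_linear scalerDr addrACA. Qed.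
Definition endo_add f g : E := Endo nzV (endo_add_linear f g).

Fact endo_opp_linear (f : E) c x y : - f (c *: x + y) = c *: - f x + - f y.
Proof. by rewrite endo_linear scalerN opprD. Qed.
Definition endo_opp f : E := Endo nzV (endo_opp_linear f).

Definition endo_one : E := @Endo R V nzV id (fun _ _ _ => erefl).

Fact endo_mul_linear (f g : E) c x y : f (g (c *: x + y)) = c *: f (g x) + f (g y).
Proof. by rewrite !endo_linear. Qed.
Definition endo_mul f g : E := Endo nzV (endo_mul_linear f g).

Fact endo_scale_linear a (f : E) c x y : a *: f (c *: x + y) = c *: (a *: f x) + a *: f y.
Proof. by rewrite endo_linear scalerDr !scalerA mulrC. Qed.
Definition endo_scale a f : E := Endo nzV (endo_scale_linear a f).

HB.instance Definition _ := gen_eqMixin E.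
HB.instance Definition _ := gen_choiceMixin E.

Fact endo_addA : associative endo_add.
Proof. by move=> f g h; apply: endoP => x; apply: addrA. Qed.
Fact endo_addC : commutative endo_add.
Proof. by move=> f g; apply: endoP => x; apply: addrC. Qed.
Fact endo_add0 : left_id endo_zero endo_add.
Proof. by move=> f; apply: endoP => x; apply: add0r. Qed.
Fact endo_addN : left_inverse endo_zero endo_opp endo_add.
Proof. by move=> f; apply: endoP => x; apply: addNr. Qed.

HB.instance Definition _ := GRing.isZmodule.Build E endo_addA endo_addC endo_add0 endo_addN.

Fact endo_mulA : associative endo_mul. Proof. by move=> f g h; apply: endoP. Qed.
Fact endo_mul1l : left_id endo_one endo_mul. Proof. by move=> f; apply: endoP. Qed.
Fact endo_mul1r : right_id endo_one endo_mul. Proof. by move=> f; apply: endoP. Qed.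
Fact endo_mulDl : left_distributive endo_mul +%R.
Proof. by move=> f g h; apply: endoP. Qed.
Fact endo_mulDr : right_distributive endo_mul +%R.
Proof. by move=> f g h; apply: endoP => x; apply: endoD. Qed.
Fact endo_oner_neq0 : endo_one != 0.
Proof.
have [v v0] := nzV; apply/eqP => /(congr1 (fun f : E => f v)) /= v0'.
by rewrite v0' eqxx in v0.
Qed.

HB.instance Definition _ := GRing.Zmodule_isNzRing.Build E
  endo_mulA endo_mul1l endo_mul1r endo_mulDl endo_mulDr endo_oner_neq0.

Fact endo_scaleA a b f : endo_scale a (endo_scale b f) = endo_scale (a * b) f.
Proof. by apply: endoP => x; apply: scalerA. Qed.
Fact endo_scale1 : left_id 1 endo_scale.
Proof. by move=> f; apply: endoP => x; apply: scale1r. Qed.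
Fact endo_scaleDr : right_distributive endo_scale +%R.
Proof. by move=> c f g; apply: endoP => x; apply: scalerDr. Qed.
Fact endo_scaleDl f : {morph endo_scale^~ f : a b / a + b}.
Proof. by move=> a b; apply: endoP => x; apply: scalerDl. Qed.

HB.instance Definition _ := GRing.Zmodule_isLmodule.Build R E
  endo_scaleA endo_scale1 endo_scaleDr endo_scaleDl.

Fact endo_scaleAl (c : R) (f g : E) : c *: (f * g) = c *: f * g.
Proof. exact: endoP. Qed.
HB.instance Definition _ := GRing.Lmodule_isLalgebra.Build R E endo_scaleAl.

Fact endo_scaleAr (c : R) (f g : E) : c *: (f * g) = f * (c *: g).
Proof. by apply: endoP => x; rewrite /= endoZ. Qed.
HB.instance Definition _ := GRing.Lalgebra_isAlgebra.Build R E endo_scaleAr.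

Lemma endoME (f g : E) x : (f * g) x = f (g x). Proof. by []. Qed.
Lemma endoBE (f g : E) x : (f - g) x = f x - g x. Proof. by []. Qed.
Lemma endoZE c (f : E) x : (c *: f) x = c *: f x. Proof. by []. Qed.
Lemma endo1E x : (1 : E) x = x. Proof. by []. Qed.
Lemma endo0E x : (0 : E) x = 0. Proof. by []. Qed.

End EndoAlgebra.

(** * Universal properties of free algebras and quotients *)

Section Lifts.
Variables (R : comNzRingType).

Lemma freealg_ind (G : choiceType) (P : freealg R G -> Prop) :
  (forall g, P (fgen R g)) -> P 1 -> (forall c x, P x -> P (c *: x)) ->
  (forall x y, P x -> P y -> P (x + y)) -> (forall x y, P x -> P y -> P (x * y)) ->
  forall x, P x.
Proof.
move=> Pg P1 PZ PD PM x.
have P0 : P 0 by rewrite -(scale0r 1); apply: PZ.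
pose mono (w : seq G) : freealg R G := (<< FMonom w >> : {malg R[{fmonom G}]}).
have Pw w : P (mono w).
  elim: w => [|g w IH].
    have -> : mono [::] = 1; last exact: P1.
    by rewrite freealg_oneE; congr << _ >>; apply: val_inj; rewrite /= fm1.
  have -> : mono (g :: w) = fgen R g * mono w; last exact: PM.
  rewrite freealg_mulE fgen.unlock; apply/esym; rewrite malgM_def fgmulUU mulr1.
  by congr << _ >>; apply: val_inj; rewrite /= fmM fmuE.
rewrite [x](monalgE (x : {malg R[{fmonom G}]})).
apply: (big_ind P) => // -[w] _.
have -> : << (x : {malg R[{fmonom G}]})@_(FMonom w) *g FMonom w >> =
    (x : {malg R[{fmonom G}]})@_(FMonom w) *: mono w; last exact: PZ.
by rewrite freealg_scaleE; apply/malgP => w'; rewrite mcoeffZ !mcoeffU mulrnAr mulr1.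
Qed.

Section FreeAlgebraLift.
Variables (G : choiceType) (B : algType R) (b : G -> B).

Local Notation A := (freealg R G).

Definition word_prod (w : {fmonom G}) : B := \prod_(g <- fmonom_val w) b g.

Fact word_prod_mmorphism : mmorphism word_prod.
Proof.
split=> [w w'|]; last by rewrite /word_prod fm1 big_nil.
by rewrite /word_prod fmM big_cat.
Qed.

HB.instance Definition _ :=
  isMultiplicative.Build {fmonom G} B word_prod word_prod_mmorphism.

Lemma freealg_lift :
  exists phi : {lrmorphism A -> B}, forall g, phi (fgen R g) = b g.
Proof.
pose phi := mmap (in_alg B) word_prod : A -> B.
have phi_mul := @commr_mmap_is_multiplicative _ _ _ (in_alg B) word_prod
  (fun _ _ _ => comm_alg _ _).
have phi_zmod : zmod_morphism phi by apply: raddfB.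
have phi_mon : monoid_morphism phi.
  split=> [|x y]; first by rewrite freealg_oneE; apply: phi_mul.2.
  by rewrite freealg_mulE; apply: phi_mul.1.
have phi_scale : scalable phi.
  by move=> c x; rewrite freealg_scaleE /phi mmapZ /= mulr_algl.
pose m1 := GRing.isZmodMorphism.Build A B phi phi_zmod.
pose m2 := GRing.isMonoidMorphism.Build A B phi phi_mon.
pose m3 := GRing.isScalable.Build R A B *:%R phi phi_scale.
pose F : {lrmorphism A -> B} := HB.pack phi m1 m2 m3.
exists F => g; rewrite /= /phi fgen.unlock mmapU /= scale1r mul1r.
by rewrite /word_prod fmuE big_seq1.
Qed.

End FreeAlgebraLift.

Lemma quotalg_lift (A B : algType R) (S : A -> Prop) (properS : ~ ideal_gen S 1)
    (phi : {lrmorphism A -> B}) :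
  (forall x, S x -> phi x = 0) ->
  exists psi : {lrmorphism quotalg properS -> B},
    forall x, psi (quotalg_pi properS x) = phi x.
Proof.
move=> phiS.
have phi_ideal x : ideal_gen S x -> phi x = 0.
  elim=> {x} [|||a x _ IH|a x _ IH]; [exact: phiS | exact: raddf0 | | |].
  - by move=> x y _ x0 _ y0; rewrite raddfD /= x0 y0 addr0.
  - by rewrite rmorphM /= IH mulr0.
  - by rewrite rmorphM /= IH mul0r.
pose psi (u : quotalg properS) := phi (repr u).
have psiE x : psi (quotalg_pi properS x) = phi x.
  by apply/eqP; rewrite -subr_eq0 -raddfB /=; apply/eqP/phi_ideal/ideal_gen_repr.
have psi_zmod : zmod_morphism psi.
  move=> u v; have [[x ->] [y ->]] := (quotalg_pi_surj u, quotalg_pi_surj v).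
  by rewrite -raddfB !psiE raddfB.
have psi_mon : monoid_morphism psi.
  split=> [|u v]; first by rewrite -(rmorph1 (quotalg_pi properS)) psiE rmorph1.
  have [[x ->] [y ->]] := (quotalg_pi_surj u, quotalg_pi_surj v).
  by rewrite -rmorphM !psiE rmorphM.
have psi_scale : scalable psi.
  move=> c u; have [x ->] := quotalg_pi_surj u.
  by rewrite -linearZ !psiE linearZ.
pose m1 := GRing.isZmodMorphism.Build (quotalg properS) B psi psi_zmod.
pose m2 := GRing.isMonoidMorphism.Build (quotalg properS) B psi psi_mon.
pose m3 := GRing.isScalable.Build R (quotalg properS) B *:%R psi psi_scale.
pose F : {lrmorphism quotalg properS -> B} := HB.pack psi m1 m2 m3.
by exists F.
Qed.

End Lifts.

(** * Continuants *)

HB.lock Definition qcomm (F : fieldType) (A : algType F) (b : A) (r : F) (x : A) : A :=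
  b * x - r *: (x * b).

(* The continuant p_{m+1} = (L_b - s_(l+m) R_b) p_m - d_(l+m) p_{m-1} in the
   operators of left and right multiplication by [b], applied to [x]. *)
Fixpoint cont_rec (F : fieldType) (A : algType F) (b : A) (s d : nat -> F) (l m : nat)
    (x : A) : A :=
  if m is m'.+1 then
    qcomm b (s (l + m')%N) (cont_rec b s d l m' x) -
      (if m' is m''.+1 then d (l + m')%N *: cont_rec b s d l m'' x else 0)
  else x.

HB.lock Definition cont := cont_rec.

(** Without d-terms the continuant is a product of the commuting operators L_b - s_k R_b. With the
    twists [sexp] its value at m = a + 1 is the Serre element up to sign, by [serreE]. *)
Definition cont0 (F : fieldType) (A : algType F) (b : A) (s : nat -> F) (m : nat) (x : A) :=
  cont b s (fun=> 0) 0 m x.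

Section Continuants.
Variables (F : fieldType) (A : algType F).
Implicit Types (b x y : A) (r : F) (s d : nat -> F).

Lemma qcommE b r x : qcomm b r x = b * x - r *: (x * b).
Proof. by rewrite qcomm.unlock. Qed.

Lemma cont_0 b s d l x : cont b s d l 0 x = x. Proof. by rewrite cont.unlock. Qed.

Lemma cont_1 b s d l x : cont b s d l 1 x = qcomm b (s l) x.
Proof. by rewrite cont.unlock /= addn0 subr0. Qed.

Lemma cont_SS b s d l m x : cont b s d l m.+2 x =
  qcomm b (s (l + m.+1)%N) (cont b s d l m.+1 x) - d (l + m.+1)%N *: cont b s d l m x.
Proof. by rewrite cont.unlock. Qed.

Lemma cont0_0 b s x : cont0 b s 0 x = x. Proof. exact: cont_0. Qed.

Lemma cont0_S b s m x : cont0 b s m.+1 x = qcomm b (s m) (cont0 b s m x).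
Proof. by case: m => [|m]; rewrite /cont0 ?cont_0 ?cont_1 ?cont_SS ?scale0r ?subr0. Qed.

Lemma qcommD b r x y : qcomm b r (x + y) = qcomm b r x + qcomm b r y.
Proof. by rewrite !qcommE mulrDr mulrDl scalerDr opprD addrACA. Qed.

Lemma qcommZ b r c x : qcomm b r (c *: x) = c *: qcomm b r x.
Proof. by rewrite !qcommE -scalerAr -scalerAl scalerBr !scalerA mulrC. Qed.

Lemma qcommN b r x : qcomm b r (- x) = - qcomm b r x.
Proof. by rewrite -scaleN1r qcommZ scaleN1r. Qed.

Lemma qcommB b r x y : qcomm b r (x - y) = qcomm b r x - qcomm b r y.
Proof. by rewrite qcommD qcommN. Qed.

Lemma qcomm0 b r : qcomm b r 0 = 0.
Proof. by rewrite !qcommE mulr0 mul0r scaler0 subr0. Qed.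

(** Left and right multiplication by [b] commute. This is what permits the expansion of a continuant
    from its other end. *)
Lemma qcommC b r r' x : qcomm b r (qcomm b r' x) = qcomm b r' (qcomm b r x).
Proof. by rewrite !qcommE; expand_products; lin_split F; ring. Qed.

Lemma contD b s d l m x y : cont b s d l m (x + y) = cont b s d l m x + cont b s d l m y.
Proof.
elim/ltn_ind: m => [[|[|m]] IH]; first by rewrite !cont_0.
  by rewrite !cont_1 qcommD.
by rewrite !cont_SS !IH // qcommD scalerDr opprD addrACA.
Qed.

Lemma contZ b s d l m c x : cont b s d l m (c *: x) = c *: cont b s d l m x.
Proof.
elim/ltn_ind: m => [[|[|m]] IH]; first by rewrite !cont_0.
  by rewrite !cont_1 qcommZ.
by rewrite !cont_SS !IH // qcommZ [in RHS]scalerBr !scalerA [d _ * c]mulrC.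
Qed.

Lemma cont_at0 b s d l m : cont b s d l m 0 = 0.
Proof. by rewrite -(scale0r (0 : A)) contZ !scale0r. Qed.

Lemma eq_cont b s s' d d' l m x :
  (forall k, (k < m)%N -> s (l + k)%N = s' (l + k)%N) ->
  (forall k, (0 < k < m)%N -> d (l + k)%N = d' (l + k)%N) ->
  cont b s d l m x = cont b s' d' l m x.
Proof.
elim/ltn_ind: m => [[|[|m]] IH] eq_s eq_d; first by rewrite !cont_0.
  by rewrite !cont_1; have := eq_s 0%N isT; rewrite addn0 => ->.
rewrite !cont_SS eq_s // eq_d ?ltnSn // !IH // => k lt_k.
- by apply: eq_s; lia.
- by apply: eq_d; lia.
- by apply: eq_s; lia.
- by apply: eq_d; lia.
Qed.

(** [cont_SS] expands the tridiagonal determinant along its last row; this is the expansion along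
    the first row, for which the offset [l] is needed. *)
Lemma cont_SSl b s d l m x : cont b s d l m.+2 x =
  qcomm b (s l) (cont b s d l.+1 m.+1 x) - d l.+1 *: cont b s d l.+2 m x.
Proof.
elim/ltn_ind: m => [[|[|m]] IH].
- by rewrite cont_SS !cont_1 !cont_0 addn1 qcommC.
- rewrite !cont_SS !cont_0 !cont_1 !(addnS, addSn) !addn0 !qcommB !qcommZ.
  by rewrite (qcommC b (s l.+1)) (qcommC b (s l.+2)) addrAC.
- rewrite cont_SS (IH m.+1) // (IH m) // (cont_SS _ _ _ l.+1 m.+1) (cont_SS _ _ _ l.+2 m).
  rewrite !qcommB !qcommZ (qcommC b (s l)) !(addSn, addnS) !scalerBr !scalerA.
  by lin_split F; ring.
Qed.

Lemma cont_rev b s s' d d' n x :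
  (forall k, (k < n)%N -> s' k = s (n.-1 - k)%N) ->
  (forall k, (0 < k < n)%N -> d' k = d (n - k)%N) ->
  cont b s d 0 n x = cont b s' d' 0 n x.
Proof.
move=> eq_s eq_d.
(* An initial stretch of one continuant is matched with a final stretch of the other: the former
   grows by [cont_SS], the latter by [cont_SSl]. *)
suff H m : (m <= n)%N -> cont b s' d' 0 m x = cont b s d (n - m) m x.
  by rewrite H // subnn.
elim/ltn_ind: m => [[|[|m]] IH] le_mn; first by rewrite !cont_0.
  by rewrite !cont_1 eq_s // subn0 subn1.
rewrite cont_SS cont_SSl !IH ?(ltnW le_mn) //; last by lia.
rewrite add0n eq_s // eq_d; last by lia.
by congr (qcomm b (s _) (cont b s d _ _ _) - d _ *: cont b s d _ _ _); lia.
Qed.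

Lemma cont0_rev b s s' n x :
  (forall k, (k < n)%N -> s' k = s (n.-1 - k)%N) -> cont0 b s n x = cont0 b s' n x.
Proof. by move=> eq_s; apply: cont_rev. Qed.

(** The hypothesis says L_b = r R_b on x, and it persists for x b. So the factor with index k acts
    as (r - s_k) R_b. *)
Lemma cont0_scal b s x r n : b * x = r *: (x * b) ->
  cont0 b s n x = (\prod_(k < n) (r - s k)) *: (x * b ^+ n).
Proof.
move=> bx; elim: n => [|n IH]; first by rewrite cont0_0 big_ord0 scale1r mulr1.
rewrite cont0_S IH qcommZ big_ord_recr /= -scalerA; congr (_ *: _).
by rewrite !qcommE mulrA bx -!scalerAl -!mulrA -exprS -exprSr -scalerBl.
Qed.

Lemma cont0_kill b s x r n k : b * x = r *: (x * b) -> (k < n)%N -> s k = r ->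
  cont0 b s n x = 0.
Proof.
move=> bx lt_kn sk; rewrite (cont0_scal _ _ bx) (bigD1 (Ordinal lt_kn)) //= sk.
by rewrite subrr mul0r scale0r.
Qed.

(* The term d(m) x(m-1) cancels the commutator of [M] with the partial Serre
   element [cont0 P s m x0]. *)
Lemma cont_chain (P M k x0 : A) (c g kappa : F) s d :
  M * P = c *: (P * M) + g *: (1 - k ^+ 2) -> k * P = c *: (P * k) ->
  k * x0 = s 0%N *: (x0 * k) -> M * x0 = s 0%N *: (x0 * M) ->
  (forall m, s m.+1 = c * s m) -> d 0%N = 0 -> (forall m, d m.+1 = c * d m + g * (1 - s m ^+ 2)) ->
  forall m, cont (P + M + kappa *: k) s d 0 m x0 = cont0 P s m x0.
Proof.
move=> MP kP kx0 Mx0 sS d0 dS.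
pose x m := cont0 P s m x0.
have x_0 : x 0%N = x0 by apply: cont0_0.
have xS m : x m.+1 = P * x m - s m *: (x m * P) by rewrite /x cont0_S qcommE.
have kx m : k * x m = s m *: (x m * k).
  elim: m => [|m IH]; rewrite ?x_0 // xS.
  rewrite mulrBr mulrBl -!scalerAr -!scalerAl !mulrA kP IH -!scalerAl -!mulrA kP IH.
  rewrite -!scalerAr !scalerBr !scalerA !mulrA sS; lin_split F; ring.
pose e m := M * x m - s m *: (x m * M).
have eS m : e m.+1 = c *: (P * e m) - s m *: (e m * P) + (g * (1 - s m ^+ 2)) *: x m.
  have kkx : k ^+ 2 * x m = (s m ^+ 2) *: (x m * k ^+ 2).
    by rewrite (expr2 k) -mulrA kx -scalerAr (mulrA k (x m)) kx -scalerAl scalerA -mulrA (expr2 (s m)).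
  have MPx : M * P * x m = c *: (P * M * x m) + g *: (x m - (s m ^+ 2) *: (x m * k ^+ 2)).
    by rewrite MP mulrDl -!scalerAl mulrBl mul1r kkx.
  have xMP : x m * M * P = c *: (x m * P * M) + g *: (x m - x m * k ^+ 2).
    by rewrite -mulrA MP mulrDr -!scalerAr mulrBr mulr1 mulrA.
  rewrite /e xS sS.
  by expand_products; rewrite MPx xMP; lin_split F; ring.
(* Inserting e m = d m x(m-1) into [eS] and using s m = c s(m-1), the first two terms combine to c
   d(m) x(m), and [dS] supplies the rest. The value 0 of the predecessor at m = 0 is harmless
   because d 0 = 0. *)
have eE m : e m = d m *: x m.-1.
  elim: m => [|m IH]; first by rewrite /e x_0 Mx0 subrr d0 scale0r.
  rewrite eS IH -scalerAr -scalerAl !scalerA dS scalerDl; congr (_ + _).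
  case: m {IH} => [|m] /=; first by rewrite d0 !mulr0 !scale0r subr0.
  by rewrite xS sS; expand_products; lin_split F; ring.
have step m : qcomm (P + M + kappa *: k) (s m) (x m) = x m.+1 + d m *: x m.-1.
  rewrite -eE xS qcommE /e; expand_products.
  by rewrite kx; expand_products; lin_split F; ring.
elim/ltn_ind => [[|[|m]] IH]; first by rewrite cont_0 cont0_0.
  by rewrite cont_1 -[in LHS]x_0 step d0 scale0r addr0.
by rewrite cont_SS !IH // -/(x _) -/(x m) step add0n addrK.
Qed.

Lemma cont0_chain (P M x0 : A) (c : F) s m :
  M * P = c *: (P * M) -> M * x0 = s 0%N *: (x0 * M) ->
  (forall m, s m.+1 = c * s m) -> cont0 (P + M) s m x0 = cont0 P s m x0.
Proof.
move=> MP Mx0 sS; have H := @cont_chain P M 0 x0 c 0 0 s (fun=> 0).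
rewrite !scale0r !addr0 in H.
apply: H; rewrite ?mul0r ?mulr0 ?scaler0 // => n.
by rewrite mul0r addr0.
Qed.

End Continuants.

(** This is v^(2m - a) with natural exponents only; [a] will be -a_ij. *)
HB.lock Definition sexp (F : fieldType) (v : F) (a m : nat) : F := (v ^+ m) ^+ 2 / v ^+ a.

Lemma sexpE (F : fieldType) (v : F) a m : sexp v a m = (v ^+ m) ^+ 2 / v ^+ a.
Proof. by rewrite sexp.unlock. Qed.

Section Sexp.
Variables (F : fieldType) (v : F).
Hypothesis v0 : v != 0.

Lemma sexp0 a : sexp v a 0 = (v ^+ a)^-1.
Proof. by rewrite sexpE expr0 expr1n mul1r. Qed.

Lemma sexpS a m : sexp v a m.+1 = v ^+ 2 * sexp v a m.
Proof. by rewrite !sexpE (exprS v m) exprMn mulrA. Qed.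

Lemma sexpa a : sexp v a a = v ^+ a.
Proof. by rewrite sexpE expr2 mulfK // expf_neq0. Qed.

(** The exponent 2m - a changes sign under m -> a - m, so reversing the twists amounts to inverting
    v. *)
Lemma sexpV a m : (m <= a)%N -> sexp v^-1 a m = sexp v a (a - m).
Proof.
move=> le_ma; rewrite !sexpE; have [n ->] : exists n, a = (m + n)%N by exists (a - m)%N; lia.
by rewrite addKn !exprD !exprVn; field; rewrite !expf_neq0 ?oner_eq0.
Qed.

End Sexp.

(** * Partial Serre elements under torus factors, brackets and sums *)

Section QCalculus.
Variables (F : fieldType) (A : algType F).

(** Moving g past the partial Serre element costs the same scalar c2 c1^m as moving Z g^m past P.
    Hence both halves of each q-commutator are rescaled alike and the torus factors can be pulled
    out to the right. It serves to pass from E_{tau i} K_i^-1 to E_{tau i}. *)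
Lemma cont0_twist (P g u0 Z : A) (c1 c2 lam : F) s m :
  g * P = c1 *: (P * g) -> g * u0 = c2 *: (u0 * g) -> Z * P = c2 *: (P * Z) ->
  Z * g = g * Z ->
  exists t, cont0 (lam *: (P * g)) s m (u0 * Z) = t *: (cont0 P s m u0 * Z * g ^+ m).
Proof.
move=> gP gu0 ZP Zg.
have gu n : g * cont0 P s n u0 = (c2 * c1 ^+ n) *: (cont0 P s n u0 * g).
  elim: n => [|n IH]; first by rewrite cont0_0 mulr1.
  rewrite cont0_S qcommE; expand_products; rewrite gP IH -[_ * P * g]mulrA.
  rewrite -!scalerAl -[P * g * _]mulrA -[_ * g * P]mulrA gP IH exprS.
  by expand_products; lin_split F; ring.
have ZgP n : Z * g ^+ n * P = (c2 * c1 ^+ n) *: (P * Z * g ^+ n).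
  elim: n => [|n IH]; first by rewrite !mulr1.
  rewrite !(exprSr _ n) mulrA -[_ * g * P]mulrA gP -scalerAr (mulrA _ P) IH.
  by expand_products; lin_split F; ring.
have gZn n : g * Z * g ^+ n = Z * g ^+ n.+1 by rewrite -Zg exprS mulrA.
elim: m => [|m [t IH]]; first by exists 1; rewrite !cont0_0 mulr1 scale1r.
exists (lam * t * (c2 * c1 ^+ m)); rewrite cont0_S IH qcommZ cont0_S !qcommE.
set u := cont0 P s m u0.
have -> : lam *: (P * g) * (u * Z * g ^+ m) =
    (lam * (c2 * c1 ^+ m)) *: (P * u * Z * g ^+ m.+1).
  have -> : lam *: (P * g) * (u * Z * g ^+ m) = lam *: (P * (g * u) * (Z * g ^+ m)).
    by rewrite -scalerAl !mulrA.
  by rewrite gu -scalerAr -scalerAl scalerA -!mulrA (mulrA g) gZn.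
have -> : u * Z * g ^+ m * (lam *: (P * g)) =
    (lam * (c2 * c1 ^+ m)) *: (u * P * Z * g ^+ m.+1).
  have -> : u * Z * g ^+ m * (lam *: (P * g)) = lam *: (u * (Z * g ^+ m * P) * g).
    by rewrite -scalerAr !mulrA.
  by rewrite ZgP -scalerAr -scalerAl scalerA exprSr !mulrA.
by expand_products; lin_split F; ring.
Qed.

(** The classical reason why E_i and the Serre elements in F_i commute: [e m] is the bracket of E_i
    with x m, and D that of E_i with X = F_i. With E and F exchanged the same lemma handles the
    Serre elements of the E's. *)
Lemma cont0_bracket (v : F) (a : nat) (X K K' x0 : A) (e : nat -> A) :
  v != 0 -> v - v^-1 != 0 ->
  K * X = (v ^- 2) *: (X * K) -> K * x0 = (v ^+ a) *: (x0 * K) ->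
  K' * x0 = (v ^- a) *: (x0 * K') -> K' * X = (v ^+ 2) *: (X * K') ->
  let D := (v - v^-1)^-1 *: (K - K') in
  let s := sexp v a in
  let x m := cont0 X s m x0 in
  e 0%N = 0 -> (forall m, e m.+1 = qcomm X (s m) (e m) + (D * x m - s m *: (x m * D))) ->
  e a.+1 = 0.
Proof.
move=> v0 vv0 KX Kx0 K'x0 K'X D s x e0 eS.
have xS m : x m.+1 = X * x m - s m *: (x m * X) by rewrite /x cont0_S qcommE.
have s0 m : s m != 0 by rewrite /s sexpE mulf_neq0 ?invr_eq0 ?expf_neq0.
have Kx m : K * x m = (s m)^-1 *: (x m * K).
  elim: m => [|m IH]; first by rewrite /x cont0_0 Kx0 /s sexp0 invrK.
  have KXx : K * X * x m = (v ^- 2 / s m) *: (X * x m * K).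
    by rewrite KX -scalerAl -(mulrA X K) IH -scalerAr scalerA mulrA.
  rewrite xS; expand_products; rewrite KXx IH.
  expand_products; rewrite -(mulrA (x m) K) KX /s sexpS.
  by expand_products; lin_split F; field; rewrite v0 -/s s0.
have K'x m : K' * x m = s m *: (x m * K').
  elim: m => [|m IH]; first by rewrite /x cont0_0 K'x0 /s sexp0.
  have K'Xx : K' * X * x m = (v ^+ 2 * s m) *: (X * x m * K').
    by rewrite K'X -scalerAl -(mulrA X K') IH -scalerAr scalerA mulrA.
  rewrite xS; expand_products; rewrite K'Xx IH.
  expand_products; rewrite -(mulrA (x m) K') K'X /s sexpS.
  expand_products; lin_split F; ring.
(* [C m] is [m]_v [a + 1 - m]_v. Its increment [a - 2m]_v is the coefficient of x(m) K in D x(m) -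
   s(m) x(m) D, where the parts with K' cancel. The second factor vanishes at m = a + 1. *)
pose C m := (v ^+ m - v ^- m) * (v ^+ a * v / v ^+ m - v ^+ m / (v ^+ a * v)) /
  (v - v^-1) ^+ 2.
suff eE m : e m = C m *: (x m.-1 * K).
  by rewrite eE /C exprSr divff ?mulf_neq0 ?expf_neq0 // subrr mulr0 mul0r scale0r.
elim: m => [|m IH]; first by rewrite e0 /C expr0 invr1 subrr !mul0r scale0r.
rewrite eS IH qcommZ.
have -> : C m *: qcomm X (s m) (x m.-1 * K) = C m *: (x m * K).
  case: m {IH} => [|m]; first by rewrite /C expr0 invr1 subrr !mul0r !scale0r.
  congr (_ *: _); rewrite /= xS qcommE; expand_products; rewrite -(mulrA _ K) KX /s sexpS.
  by expand_products; lin_split F; field.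
rewrite /D; expand_products; rewrite Kx K'x; expand_products.
have v21 : v * v - 1 != 0.
  by apply: contra_neq vv0 => /eqP; rewrite subr_eq0 => /eqP v2; rewrite -(mul1r v^-1) -v2 mulfK ?subrr.
by lin_split F; rewrite /C /s sexpE ?(exprS v m); field; rewrite ?expf_neq0 ?v0 ?vv0 ?v21.
Qed.

(** [kk] q-commutes with P and with M by the same scalar, so its contributions assemble into powers
    of P + M. [N] does not; its contributions are carried along as P^m N and disappear in the last
    step unless a = 0. *)
Lemma cont0_mixed (w A0 : F) (a : nat) (P M kk N x0 : A) :
  w != 0 -> 1 - w ^+ 2 != 0 ->
  let s := sexp w a in
  M * P = (w ^+ 2) *: (P * M) ->
  M * x0 - s 0%N *: (x0 * M) = A0 *: (kk - N) ->
  kk * P = (w ^+ a * w ^+ 2) *: (P * kk) -> kk * M = (w ^+ a * w ^+ 2) *: (M * kk) ->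
  N * P = (w ^+ 2 / w ^+ a) *: (P * N) -> N * M = (w ^+ a / w ^+ 2) *: (M * N) ->
  cont0 P s a.+1 x0 = 0 ->
  cont0 (P + M) s a.+1 x0 =
    (A0 * \prod_(l < a) (1 - (w ^+ l.+2) ^+ 2)) *: ((P + M) ^+ a * kk)
      - (if a == 0%N then A0 else 0) *: N.
Proof.
move=> w0 w21 s MP Mx0 kkP kkM NP NM Pkill.
have wa0 n : w ^+ n != 0 by rewrite expf_neq0.
pose x m := cont0 P s m x0.
have x_0 : x 0%N = x0 by apply: cont0_0.
have xS m : x m.+1 = P * x m - s m *: (x m * P) by rewrite /x cont0_S qcommE.
pose e m := M * x m - s m *: (x m * M).
have eS m : e m.+1 = (w ^+ 2) *: (P * e m) - s m *: (e m * P).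
  have MPx : M * P * x m = (w ^+ 2) *: (P * M * x m) by rewrite MP -scalerAl.
  have xMP : x m * M * P = (w ^+ 2) *: (x m * P * M).
    by rewrite -mulrA MP -scalerAr mulrA.
  by rewrite /e xS /s sexpS; expand_products; rewrite MPx xMP; lin_split F; ring.
have PnNP n : P ^+ n * N * P = (w ^+ 2 / w ^+ a) *: (P ^+ n.+1 * N).
  by rewrite -mulrA NP -scalerAr mulrA (exprSr P).
pose Pi m := \prod_(l < m) (1 - (w ^+ l.+1 / w ^+ a) ^+ 2).
have eE m : e m.+1 = - (A0 * (w ^+ m.+1) ^+ 2 * (1 - w ^- a ^+ 2) * Pi m) *: (P ^+ m.+1 * N).
  elim: m => [|m IH].
    rewrite eS /e x_0 Mx0 /Pi big_ord0; expand_products.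
    rewrite kkP NP; expand_products; rewrite /s sexp0.
    by lin_split F; field; rewrite ?wa0 ?w0.
  have PP : P * (P ^+ m.+1 * N) = P ^+ m.+2 * N by rewrite mulrA -exprS.
  rewrite eS IH -scalerAr -scalerAl PP PnNP /Pi big_ord_recr /= -/(Pi m).
  by rewrite /s sexpS sexpE !(exprS w); expand_products; lin_split F; field; rewrite ?wa0 ?w0.
set B := P + M.
pose kap m := \prod_(l < m) (1 - (w ^+ l.+2) ^+ 2).
pose phi m := (1 - (w ^+ m.+1) ^+ 2) / (1 - w ^+ 2) * Pi m.
have step m : qcomm B (s m) (x m) = x m.+1 + e m.
  by rewrite qcommE xS /e /B; expand_products; lin_split F; ring.
have kkB : kk * B = (w ^+ a * w ^+ 2) *: (B * kk).
  by rewrite mulrDr mulrDl kkP kkM scalerDr.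
have MPn n : M * P ^+ n = (w ^+ n) ^+ 2 *: (P ^+ n * M).
  elim: n => [|n IH]; first by rewrite mulr1 mul1r expr1n scale1r.
  rewrite (exprSr P) (exprSr w n) mulrA IH -scalerAl -(mulrA _ M) MP -scalerAr scalerA.
  by rewrite -(mulrA _ P) exprMn.
have yE m : cont0 B s m.+1 x0 =
    x m.+1 + (A0 * kap m) *: (B ^+ m * kk) - (A0 * phi m) *: (P ^+ m * N).
  elim: m => [|m IH].
    rewrite cont0_S cont0_0 -x_0 step /e x_0 Mx0 /kap /phi /Pi !big_ord0 !mul1r expr1.
    by rewrite divff // !mulr1 scalerBr addrA.
  rewrite cont0_S IH qcommB qcommD !qcommZ step eE.
  have -> : qcomm B (s m.+1) (B ^+ m * kk) = (1 - (w ^+ m.+2) ^+ 2) *: (B ^+ m.+1 * kk).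
    have h1 : B * (B ^+ m * kk) = B ^+ m.+1 * kk by rewrite mulrA -exprS.
    have h2 : B ^+ m * kk * B = (w ^+ a * w ^+ 2) *: (B ^+ m.+1 * kk).
      by rewrite -(mulrA _ kk) kkB -scalerAr (mulrA _ B) (exprSr B).
    by rewrite qcommE h1 h2 /s sexpE !(exprS w); lin_split F; field; rewrite ?wa0.
  have -> : qcomm B (s m.+1) (P ^+ m * N) =
      (1 - (w ^+ m.+2 / w ^+ a) ^+ 2) *: (P ^+ m.+1 * N).
    have PNM : P ^+ m * N * M = (w ^+ a / w ^+ 2 / (w ^+ m) ^+ 2) *: (M * P ^+ m * N).
      rewrite -mulrA NM -scalerAr mulrA MPn -scalerAl scalerA.
      by rewrite divfK // expf_neq0.
    have PP : P * (P ^+ m * N) = P ^+ m.+1 * N by rewrite mulrA -exprS.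
    rewrite qcommE /B mulrDl mulrDr PnNP PNM PP (mulrA M).
    by rewrite /s sexpE !(exprS w); expand_products; lin_split F; field; rewrite ?wa0 ?w0.
  rewrite /kap /phi /Pi !big_ord_recr /= -/(Pi m) -/(kap m) !(exprS w) expr0.
  by lin_split F; field; rewrite ?wa0 ?w0.
rewrite yE [x _]Pkill add0r -/(kap a); congr (_ - _).
(* For a > 0 the factor l = a - 1 of [Pi a] is 1 - 1. For a = 0 the product is empty and the N-term
   survives. *)
rewrite /phi /Pi; case: (posnP a) => [->|a_gt0].
  by rewrite big_ord0 expr1 divff // !mulr1 mul1r.
have lt_a : (a.-1 < a)%N by rewrite prednK.
rewrite (bigD1 (Ordinal lt_a)) //= prednK // divff // expr1n subrr mul0r !mulr0 scale0r.
by rewrite scale0r.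
Qed.

End QCalculus.

(** * Continuants of torus elements *)

(* v^(2m - a) eta [m]_v [a + 1 - m]_v *)
HB.lock Definition dcoef (F : fieldType) (v : F) (a : nat) (eta : F) (m : nat) : F :=
  eta * sexp v a m * (v ^+ m - v ^- m) * (v ^+ a * v / v ^+ m - v ^+ m / (v ^+ a * v)) /
    (v - v^-1) ^+ 2.

Section ContinuantCoefficients.
Variables (F : fieldType) (v : F).
Hypotheses (v0 : v != 0) (vn1 : forall n, (0 < n)%N -> v ^+ n != 1).

Let vX n : v ^+ n != 0. Proof. by rewrite expf_neq0. Qed.

Lemma expr2_neq1 : v ^+ 2 - 1 != 0. Proof. by rewrite subr_eq0 vn1. Qed.

Lemma subrV_neq0 : v - v^-1 != 0.
Proof.
have -> : v - v^-1 = (v ^+ 2 - 1) / v by field.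
by rewrite mulf_neq0 ?invr_eq0 ?expr2_neq1.
Qed.

Let v21 : v * v - 1 != 0. Proof. exact: expr2_neq1. Qed.
Let vX1 : 1 + - v * v != 0. Proof. by rewrite mulNr -oppr_eq0 opprB. Qed.
Let vv1 := subrV_neq0.

Lemma dcoef0 a eta : dcoef v a eta 0 = 0.
Proof. by rewrite dcoef.unlock expr0 invr1 subrr mulr0 !mul0r. Qed.

(** With [dcoef0], this is the recursion that [cont_chain] demands for c = v^2 and g = eta v^2 / (v
    - v^-1), the constant in the bracket of varsigma_i E_i K_i^-1 with F_i. The formula for [dcoef]
    is its solution. *)
Lemma dcoefS a eta m : dcoef v a eta m.+1 =
  v ^+ 2 * dcoef v a eta m + eta * v ^+ 2 / (v - v^-1) * (1 - sexp v a m ^+ 2).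
Proof.
rewrite !dcoef.unlock sexpS sexpE (exprS v m).
by field; rewrite v0 !vX v21.
Qed.

(** The recursion of the chain with P and M exchanged: solving e f = v^2 f e + g (1 - k^2) for f e
    inverts v^2 and replaces g by -v^-2 g. *)
Lemma dcoefS_inv a eta m : dcoef v^-1 a (eta * v ^+ 2) m.+1 =
  v ^- 2 * dcoef v^-1 a (eta * v ^+ 2) m +
    - (v ^- 2 * (eta * v ^+ 2 / (v - v^-1))) * (1 - sexp v^-1 a m ^+ 2).
Proof.
rewrite !dcoef.unlock sexpS sexpE !exprVn (exprS v m).
by field; rewrite ?v0 ?vX ?v21 ?vX1 ?oner_eq0.
Qed.

(** Under m -> a + 1 - m the two quantum integers are swapped and the exponent 2m - a becomes 2 -
    (2m - a). The extra v^2 is the origin of condition (a), which says that the bar image of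
    varsigma_i is varsigma_i q_i^2. *)
Lemma dcoefV a eta m : (m <= a.+1)%N ->
  dcoef v^-1 a (eta * v ^+ 2) m = dcoef v a eta (a.+1 - m).
Proof.
move=> le_ma; have [n def_a] : exists n, (a.+1 = m + n)%N by exists (a.+1 - m)%N; lia.
rewrite !dcoef.unlock !sexpE def_a addKn !exprVn.
have va : v ^+ a * v = v ^+ m * v ^+ n by rewrite -exprSr def_a exprD.
have -> : v ^+ a = v ^+ m * v ^+ n / v by rewrite -va mulfK.
by field; rewrite v0 !vX v21 vX1 oner_eq0.
Qed.

Lemma cont_revV (A : algType F) (b x : A) a eta :
  cont b (sexp v a) (dcoef v a eta) 0 a.+1 x =
  cont b (sexp v^-1 a) (dcoef v^-1 a (eta * v ^+ 2)) 0 a.+1 x.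
Proof.
apply: cont_rev => m lt_m; first by rewrite sexpV.
by rewrite dcoefV //; case/andP: lt_m => _ /ltnW.
Qed.

Lemma cont0_revV (A : algType F) (b x : A) a :
  cont0 b (sexp v a) a.+1 x = cont0 b (sexp v^-1 a) a.+1 x.
Proof. by apply: cont0_rev => m lt_m; rewrite sexpV. Qed.

(** The exponents 2l - a, for l from 0 to a, add up to 0. *)
Lemma prod_sexp a : \prod_(l < a.+1) sexp v a l = 1.
Proof.
suff H n : \prod_(l < n) sexp v a l = v ^+ (n * n.-1) / v ^+ (a * n).
  by rewrite H /= mulnC divff.
elim: n => [|n IH]; first by rewrite big_ord0 muln0 divff.
rewrite big_ord_recr /= IH sexpE mulnS exprD mulSn exprD.
have -> : v ^+ (n * n) = v ^+ (n * n.-1) * v ^+ n.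
  by rewrite -exprD -mulnSr; case: (n).
by field; rewrite !vX.
Qed.

(* Reversing the tridiagonal matrix rescales its rows by -s_l^-1, which have
   product (-1)^(a+1). *)
Lemma scalar_cont_eq0 (kappa : F) a eta : (2 : F) != 0 -> ~~ odd a ->
  cont (kappa : F^o) (sexp v a) (dcoef v a eta) 0 a.+1 1 = 0.
Proof.
move=> two_neq0 even_a.
have s0 m : sexp v a m != 0 by rewrite sexpE mulf_neq0 ?invr_eq0 ?expf_neq0.
set K := (kappa : F^o); pose p m : F := \prod_(l < m) - (sexp v a l)^-1.
have rescale m : cont K (sexp v^-1 a) (dcoef v^-1 a (eta * v ^+ 2)) 0 m 1 =
    p m *: cont K (sexp v a) (dcoef v a eta) 0 m 1.
  have T (r : F) (x : F^o) : r != 0 -> qcomm K r^-1 x = - r^-1 *: qcomm K r x.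
    move=> r0; rewrite !qcommE [x * K]mulrC; lin_split F; by field.
  have sV l : sexp v^-1 a l = (sexp v a l)^-1.
    by rewrite !sexpE !exprVn; field; rewrite !vX oner_eq0.
  elim/ltn_ind: m => [[|[|m]] IH]; first by rewrite !cont_0 /p big_ord0 scale1r.
    by rewrite !cont_1 sV T // /p big_ord1.
  rewrite !cont_SS !add0n sV T // !IH // !qcommZ /p !big_ord_recr /= -/(p m) !dcoef.unlock.
  rewrite sV (sexpS v); lin_split F; first by ring.
  by rewrite !(exprS v^-1) !exprVn !(exprS v m) sexpE; field; rewrite ?v0 ?vX ?v21 ?vX1 ?oner_eq0 ?s0.
have : cont K (sexp v a) (dcoef v a eta) 0 a.+1 1 = - cont K (sexp v a) (dcoef v a eta) 0 a.+1 1.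
  rewrite {1}cont_revV rescale /p prodrN card_ord /= -[X in _ *: X]scale1r.
  rewrite prodfV prod_sexp invr1 mulr1 scale1r -signr_odd /= (negPf even_a) /= expr1.
  by rewrite scaleN1r.
move/eqP; rewrite -subr_eq0 opprK -mulr2n -scaler_nat scaler_eq0 (negPf two_neq0) /=.
by move/eqP.
Qed.

Section TorusElement.
Variables (a : nat) (vs kappa : F).
Let g := locked (vs * v ^+ 2 / (v - v^-1)).
Let gE : g = vs * v ^+ 2 / (v - v^-1). Proof. by rewrite /g -lock. Qed.
Let s' := sexp v^-1 a.
Let d' := dcoef v^-1 a (vs * v ^+ 2).

Let qnum r := (1 - v ^- r ^+ 2) / (1 - v ^- 2).
Let qnum' r := ((v ^+ r) ^+ 2 - 1) / (v ^+ 2 - 1).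

Let tA m r := v ^- a - v ^+ a * (v ^+ r) ^+ 2 / ((v ^+ m) ^+ 4 * v ^+ 2).
Let tB m r := kappa * (v ^- r ^+ 2 - v ^+ a / (v ^+ m) ^+ 2).
Let tC r := v ^+ a * g * qnum r.+1 / (v ^+ r.+1) ^+ 2.

(** Coefficient of Z e^r k^(m - r) in the m-th continuant on Z. One step of the recursion raises r
    through e ([tA]), keeps it through kappa k ([tB]), and lowers it through the k^2-part of the
    bracket of f with e^r ([tC]); [tA] and [tB] are indexed by the target r. *)
Fixpoint torus_coef (m r : nat) : F :=
  if m is m'.+1 then
    tA m' r * (if r is r'.+1 then torus_coef m' r' else 0)
      + tB m' r * torus_coef m' r + tC r * torus_coef m' r.+1
  else (r == 0%N)%:R.

Lemma torus_coefS m r : torus_coef m.+1 r =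
  tA m r * (if r is r'.+1 then torus_coef m r' else 0)
    + tB m r * torus_coef m r + tC r * torus_coef m r.+1.
Proof. by []. Qed.

Let w r := - (v ^+ a * g * qnum' r / (v ^+ r) ^+ 2).

Lemma torus_coef_gt m r : (m < r)%N -> torus_coef m r = 0.
Proof.
elim: m r => [|m IH] [|r] //= lt_mr; rewrite !IH ?mulr0 ?addr0 //; lia.
Qed.

Let s'E m : s' m = v ^+ a / (v ^+ m) ^+ 2.
Proof. by rewrite /s' sexpE !exprVn; field; rewrite !vX oner_eq0. Qed.

Let d'E m : d' m = vs * v ^+ a * v ^+ 2 / (v ^+ m) ^+ 2 * (v ^+ m - v ^- m) *
  (v ^+ a * v / v ^+ m - v ^+ m / (v ^+ a * v)) / (v - v^-1) ^+ 2.
Proof.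
by rewrite /d' dcoef.unlock -/s' s'E !exprVn; field; rewrite ?v0 ?vX ?v21 ?vX1 ?oner_eq0.
Qed.

(** The part of the bracket of f with e^r that contains no k^2 yields, with coefficient w r,
    monomials of degree two less. By this identity they add up to d' times the last but one
    continuant, exactly what the continuant recursion subtracts. *)
Lemma torus_coef_lower m r : w r.+1 * torus_coef m.+1 r.+1 = d' m.+1 * torus_coef m r.
Proof.
elim: m r => [|m IH] r.
  rewrite /= !mulr0 !addr0; case: r => [|r] /=; last by rewrite !mulr0.
  rewrite !mulr1 /w /qnum' /tA gE d'E !(exprS v) !expr0.
  by field; rewrite ?v0 ?vX ?v21 ?vX1 ?oner_eq0.
set x := torus_coef m.+1 r.
(* By induction the terms with [tB] and [tC] acquire the common factor v^-2 d'(m+1) and, by the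
   recursion for x, sum to x - tA p. Then [xp] and [wA] collect everything as d'(m+2) x. *)
have wC : w r.+1 * tC r.+1 = v ^- 2 * tC r * w r.+2.
  rewrite /w /tC /qnum /qnum' gE !(exprS v) !expr0.
  by field; rewrite ?v0 ?vX ?v21 ?vX1 ?oner_eq0.
have B_shift : tB m.+1 r.+1 = v ^- 2 * tB m r.
  by rewrite /tB !(exprS v) !expr0; field; rewrite ?v0 ?vX ?oner_eq0.
have wA : w r.+1 * tA m.+1 r.+1 + v ^- 2 * (d' m.+1 - tA m r * w r) = d' m.+2.
  rewrite !d'E /w /tA /qnum' gE !(exprS v) !expr0.
  by field; rewrite ?v0 ?vX ?v21 ?vX1 ?oner_eq0.
set p := if r is r'.+1 then torus_coef m r' else 0.
have xp : w r * x = d' m.+1 * p.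
  by rewrite /x /p; case: (r) => [|r'] //; rewrite /w /qnum' expr0 expr1n subrr; ring.
have xE : x = tA m r * p + tB m r * torus_coef m r + tC r * torus_coef m r.+1 by [].
transitivity (w r.+1 * tA m.+1 r.+1 * x + tB m.+1 r.+1 * (w r.+1 * torus_coef m.+1 r.+1) +
    w r.+1 * tC r.+1 * torus_coef m.+1 r.+2); first by rewrite torus_coefS -/x; ring.
rewrite IH wC -[_ * w r.+2 * _]mulrA IH B_shift -wA.
transitivity (w r.+1 * tA m.+1 r.+1 * x + v ^- 2 * (d' m.+1 * x - tA m r * (d' m.+1 * p))).
  by rewrite {3}xE; ring.
by rewrite -xp; ring.
Qed.

Lemma sum_shift (A : lmodType F) (G : nat -> F) (h : nat -> A) N : G 0%N = 0 -> G N = 0 ->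
  \sum_(r < N) G r *: h r.-1 = \sum_(r < N) G r.+1 *: h r.
Proof.
move=> G0 GN; transitivity (\sum_(r < N.+1) G r *: h r.-1).
  by rewrite big_ord_recr /= GN scale0r addr0.
by rewrite big_ord_recl G0 scale0r add0r.
Qed.

Section Monomials.
Variables (A : algType F) (f e k Z : A).
Hypotheses (ef0 : e * f = (v ^+ 2) *: (f * e) + (vs * v ^+ 2 / (v - v^-1)) *: (1 - k ^+ 2))
  (kf : k * f = (v ^+ 2) *: (f * k)) (ke : k * e = v ^- 2 *: (e * k))
  (fZ : f * Z = (v ^+ a) *: (Z * f)) (eZ : e * Z = v ^- a *: (Z * e))
  (kZ : k * Z = Z * k).

Let ef : e * f = (v ^+ 2) *: (f * e) + g *: (1 - k ^+ 2). Proof. by rewrite gE. Qed.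

Let ken n : k * e ^+ n = v ^- n ^+ 2 *: (e ^+ n * k).
Proof.
elim: n => [|n IH]; first by rewrite mulr1 mul1r expr0 invr1 expr1n scale1r.
rewrite (exprS e) mulrA ke -scalerAl -(mulrA e k) IH -scalerAr scalerA (mulrA e); congr (_ *: _).
by rewrite (exprS v n); field; rewrite ?v0 ?vX.
Qed.

Let kne n : k ^+ n * e = v ^- n ^+ 2 *: (e * k ^+ n).
Proof.
elim: n => [|n IH]; first by rewrite mulr1 mul1r expr0 invr1 expr1n scale1r.
rewrite (exprSr k) -(mulrA _ k e) ke -scalerAr (mulrA _ e k) IH -scalerAl scalerA -(mulrA e).
congr (_ *: _).
by rewrite (exprS v n); field; rewrite ?v0 ?vX.
Qed.

Let fkn n : f * k ^+ n = v ^- n ^+ 2 *: (k ^+ n * f).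
Proof.
elim: n => [|n IH]; first by rewrite mulr1 mul1r expr0 invr1 expr1n scale1r.
have fk : f * k = v ^- 2 *: (k * f) by rewrite kf scalerA mulVf // scale1r.
rewrite (exprS k) mulrA fk -scalerAl -(mulrA k f) IH -scalerAr scalerA (mulrA k); congr (_ *: _).
by rewrite (exprS v n); field; rewrite ?v0 ?vX.
Qed.

Let fen n : f * e ^+ n = v ^- n ^+ 2 *: (e ^+ n * f) -
  (g / (v ^+ n) ^+ 2) *: (qnum' n *: e ^+ n.-1 - qnum n *: (e ^+ n.-1 * k ^+ 2)).
Proof.
elim: n => [|n IH].
  rewrite mulr1 mul1r expr0 invr1 expr1n scale1r /qnum /qnum' expr1n subrr mul0r scale0r.
  by rewrite expr0 invr1 expr1n subrr mul0r scale0r subrr scaler0 subr0.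
have fe : f * e = v ^- 2 *: (e * f - g *: (1 - k ^+ 2)).
  by rewrite ef addrK scalerA mulVf // scale1r.
have kke : k ^+ 2 * e ^+ n = (v ^- n ^+ 2) ^+ 2 *: (e ^+ n * k ^+ 2).
  rewrite (expr2 k) -(mulrA k k) ken -scalerAr (mulrA k) ken -scalerAl scalerA -(mulrA _ k k).
  by rewrite (expr2 (v ^- n ^+ 2)).
have een (y : A) : (n != 0)%N -> e * (e ^+ n.-1 * y) = e ^+ n * y.
  by case: (n) => // n' _; rewrite mulrA -exprS.
rewrite (exprS e) mulrA fe -scalerAl mulrBl -(mulrA e f) IH -scalerAl mulrBl mul1r kke /=.
have [n0|n0] := eqVneq n 0%N.
  rewrite n0 /qnum /qnum' !expr0 !invr1 !expr1n !subrr !mul0r !scale0r subrr scaler0 subr0.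
  rewrite !mul1r !expr1 !scale1r !mulr1.
  by expand_products; lin_split F; field; rewrite ?v0 ?vX ?v21 ?vX1 ?oner_eq0.
have een1 : e * e ^+ n.-1 = e ^+ n by have := een 1 n0; rewrite !mulr1.
rewrite mulrBr -!scalerAr mulrBr -!scalerAr een1 een // !mulrA -(exprS e n).
rewrite /qnum /qnum' !(exprS v n).
by expand_products; lin_split F; field; rewrite ?v0 ?vX ?v21 ?vX1 ?oner_eq0.
Qed.

Let mon m r := Z * e ^+ r * k ^+ (m - r).

Let mon_step m r : (r <= m)%N ->
  qcomm (f + e + kappa *: k) (s' m) (mon m r) =
    w r *: mon m.-1 r.-1 + (v ^+ a * g * qnum r / (v ^+ r) ^+ 2) *: mon m.+1 r.-1
    + tA m r.+1 *: mon m.+1 r.+1 + tB m r *: mon m.+1 r.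
Proof.
move=> le_rm; have [t ->] : exists t, m = (r + t)%N by exists (m - r)%N; lia.
rewrite /mon subSS (subSn (leq_addr t r)) !addKn.
have fx : f * (Z * e ^+ r * k ^+ t) = (s' (r + t)) *: (Z * e ^+ r * k ^+ t * f)
    + w r *: (Z * e ^+ r.-1 * k ^+ ((r + t).-1 - r.-1))
    + (v ^+ a * g * qnum r / (v ^+ r) ^+ 2) *: (Z * e ^+ r.-1 * k ^+ ((r + t).+1 - r.-1)).
  have -> : f * (Z * e ^+ r * k ^+ t) = v ^+ a *: (Z * (f * e ^+ r) * k ^+ t).
    by rewrite !mulrA fZ -!scalerAl.
  have fek : Z * e ^+ r * f * k ^+ t = v ^- t ^+ 2 *: (Z * e ^+ r * k ^+ t * f).
    by rewrite -(mulrA _ f) fkn -scalerAr mulrA.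
  rewrite fen mulrBr mulrBl -!(scalerAr, scalerAl) (mulrA Z) fek.
  case: r {le_rm fek} => [|r] /=.
    rewrite /w /qnum /qnum' expr0 invr1 !expr1n !subrr !mul0r !scale0r subrr.
    rewrite s'E add0n !(mulr0, mul0r, scaler0, oppr0, scale0r, addr0, subr0, scale1r).
    by rewrite scalerA exprVn.
  rewrite s'E /w addnC addKn (_ : (t + r.+1).+1 - r = 2 + t)%N; last lia.
  rewrite (exprD k) !(exprD v) !mulrA mulrBr mulrBl -!(scalerAr, scalerAl) !mulrA.
  by lin_split F; rewrite ?/qnum ?/qnum' ?(exprS v r); field; rewrite ?v0 ?vX ?v21 ?vX1 ?oner_eq0.
have ex : e * (Z * e ^+ r * k ^+ t) = v ^- a *: (Z * e ^+ r.+1 * k ^+ t).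
  by rewrite !mulrA eZ -!scalerAl -(mulrA Z e) -exprS.
have kx : k * (Z * e ^+ r * k ^+ t) = v ^- r ^+ 2 *: (Z * e ^+ r * k ^+ t.+1).
  rewrite !mulrA kZ -(mulrA Z k) ken -scalerAr -scalerAl mulrA -(mulrA _ k).
  by rewrite -exprS.
have xe : Z * e ^+ r * k ^+ t * e = v ^- t ^+ 2 *: (Z * e ^+ r.+1 * k ^+ t).
  by rewrite -(mulrA _ _ e) kne -scalerAr mulrA -(mulrA Z _ e) -exprSr.
have xk : Z * e ^+ r * k ^+ t * k = Z * e ^+ r * k ^+ t.+1 by rewrite -(mulrA _ _ k) -exprSr.
rewrite qcommE !mulrDl !mulrDr fx ex -scalerAl -scalerAr kx xe xk.
rewrite /tA /tB s'E exprD (exprS v r).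
by lin_split F; field; rewrite ?v0 ?vX ?v21 ?vX1 ?oner_eq0.
Qed.

(** Summing up to one bound N for all degrees lets the shifts of r pass without boundary terms, as
    coefficients with r > m vanish. *)
Lemma cont_torus_sum N m : (m < N)%N ->
  cont (f + e + kappa *: k) s' d' 0 m Z = \sum_(r < N.+1) torus_coef m r *: mon m r.
Proof.
set B := f + e + kappa *: k.
have step n : (n.+1 < N)%N ->
    qcomm B (s' n) (\sum_(r < N.+1) torus_coef n r *: mon n r) =
    \sum_(r < N.+1) torus_coef n.+1 r *: mon n.+1 r +
    d' n *: \sum_(r < N.+1) torus_coef n.-1 r *: mon n.-1 r.
  move=> lt_nN.
  have -> : qcomm B (s' n) (\sum_(r < N.+1) torus_coef n r *: mon n r) =
      \sum_(r < N.+1) torus_coef n r *: qcomm B (s' n) (mon n r).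
    rewrite (big_morph _ (qcommD B (s' n)) (qcomm0 B (s' n))).
    by apply: eq_bigr => r _; rewrite qcommZ.
  have -> : \sum_(r < N.+1) torus_coef n r *: qcomm B (s' n) (mon n r) =
      \sum_(r < N.+1) (torus_coef n r * w r) *: mon n.-1 r.-1
      + \sum_(r < N.+1) (torus_coef n r * (v ^+ a * g * qnum r / (v ^+ r) ^+ 2)) *: mon n.+1 r.-1
      + \sum_(r < N.+1) (torus_coef n r * tA n r.+1) *: mon n.+1 r.+1
      + \sum_(r < N.+1) (torus_coef n r * tB n r) *: mon n.+1 r.
    rewrite -!big_split; apply: eq_bigr => r _ /=.
    have [le_rn|lt_nr] := leqP r n; first by rewrite mon_step // !scalerDr !scalerA.
    by rewrite torus_coef_gt // !mul0r !scale0r !addr0.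
  have w_0 : w 0 = 0 by rewrite /w /qnum' expr0 expr1n subrr !mul0r mulr0 !mul0r oppr0.
  have q_0 : qnum 0 = 0 by rewrite /qnum expr0 invr1 expr1n subrr mul0r.
  pose P r := if r is r'.+1 then torus_coef n r' else 0.
  have c_N : torus_coef n N = 0 by apply: torus_coef_gt; lia.
  have c_N1 : torus_coef n N.+1 = 0 by apply: torus_coef_gt; lia.
  have S1 := @sum_shift _ (fun r => torus_coef n r * w r) (mon n.-1) N.+1.
  have S2 := @sum_shift _ (fun r => torus_coef n r * (v ^+ a * g * qnum r / (v ^+ r) ^+ 2))
    (mon n.+1) N.+1.
  have S3 := @sum_shift _ (fun r => tA n r * P r) (fun r => mon n.+1 r.+1) N.+1.
  rewrite /= c_N1 w_0 q_0 c_N !(mulr0, mul0r) in S1 S2 S3.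
  rewrite S1 // S2 //.
  have -> : \sum_(r < N.+1) (torus_coef n r * tA n r.+1) *: mon n.+1 r.+1 =
      \sum_(r < N.+1) (tA n r * P r) *: mon n.+1 r.
    transitivity (\sum_(r < N.+1) (tA n r.+1 * P r.+1) *: mon n.+1 r.+1).
      by apply: eq_bigr => r _; rewrite mulrC.
    rewrite -S3 //.
    by apply: eq_bigr => -[[|r] lt_r] _ //=; rewrite mulr0 !scale0r.
  rewrite -addrA -addrA [LHS]addrC; congr (_ + _).
    rewrite -!big_split; apply: eq_bigr => r _; rewrite [LHS]/= -!scalerDl torus_coefS -/(P r).
    by congr (_ *: _); rewrite /tC; ring.
  rewrite scaler_sumr; apply: eq_bigr => r _; rewrite scalerA; congr (_ *: _).
  case: n {lt_nN c_N c_N1 S1 S2 S3 P} => [|n]; last by rewrite mulrC torus_coef_lower.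
  by rewrite /= mul0r /d' dcoef.unlock expr0 invr1 subrr mulr0 !mul0r.
elim/ltn_ind: m => [[|[|m]] IH] lt_mN.
- rewrite cont_0 big_ord_recl /= big1 ?addr0; last by move=> r _; rewrite scale0r.
  by rewrite scale1r /mon !mulr1.
- have /= d'0 : d' 0 = 0 by rewrite /d' dcoef.unlock expr0 invr1 subrr mulr0 !mul0r.
  by rewrite cont_1 -(cont_0 B s' d' 0 Z) IH // ?step ?d'0 ?scale0r ?addr0 //; lia.
- rewrite cont_SS !add0n (IH m.+1) // ?step ?(IH m) /= ?addrK //; lia.
Qed.

Lemma cont_torus : (2 : F) != 0 -> vs != 0 -> ~~ odd a ->
  cont (f + e + kappa *: k) s' d' 0 a.+1 Z = 0.
Proof.
move=> two_neq0 vs0 even_a; rewrite (@cont_torus_sum a.+2) //.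
have g0 : g != 0 by rewrite gE !mulf_neq0 ?invr_eq0 ?vv1.
rewrite big1 // => -[[|r] lt_r] _; last first.
  have w0 : w r.+1 != 0.
    rewrite oppr_eq0 !mulf_neq0 ?invr_eq0 ?expf_neq0 ?expr2_neq1 //.
    by rewrite -exprM subr_eq0 vn1 // muln_gt0.
  (* d'(a + 1) contains [0]_v and is 0, while w(r + 1) is nonzero because vs is. So every
     coefficient with r >= 1 vanishes in degree a + 1. *)
  have /eqP := torus_coef_lower a r; rewrite d'E !(exprSr v a).
  rewrite [X in _ * (X - _)]divff ?[X in _ * (_ - X)]divff ?mulf_neq0 // subrr mulr0 !mul0r.
  by rewrite mulf_eq0 (negPf w0) orFb => /eqP ->; rewrite scale0r.
(* Since tC 0 = - w 1, [torus_coef_lower] turns the recursion at r = 0 into that of the continuant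
   of the scalar kappa. *)
suff cE m : torus_coef m 0 = cont (kappa : F^o) s' d' 0 m 1.
  by rewrite cE -cont_revV scalar_cont_eq0 // scale0r.
have bE n (x : F^o) : qcomm (kappa : F^o) (s' n) x = (kappa * (1 - s' n)) *: x.
  rewrite qcommE [x * _]mulrC -[X in X - _]scale1r -scalerBl.
  rewrite -[LHS]/((1 - s' n) * ((kappa : F) * x)) -[RHS]/(kappa * (1 - s' n) * x).
  by rewrite mulrA (mulrC kappa).
elim/ltn_ind: m => [[|[|m]] IH].
- by rewrite cont_0.
- rewrite cont_1 bE torus_coefS /= !mulr0 add0r addr0 !mulr1 /tB s'E !expr0 invr1 expr1n.
  by rewrite /GRing.scale /= mulr1.
- rewrite cont_SS !add0n bE -!IH // torus_coefS mulr0 add0r /tB -s'E expr0 invr1 expr1n.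
  rewrite -[_ *: _ in RHS]/(_ * _); congr (_ + _).
  rewrite -[X in - X]torus_coef_lower /w /tC /qnum /qnum' expr1.
  by field; rewrite ?v0 ?vX ?v21 ?vX1 ?oner_eq0.
Qed.

End Monomials.
End TorusElement.

End ContinuantCoefficients.

(** * Quantum Serre elements *)

Section SerreElement.
Variables (F : fieldType) (v : F).
Hypotheses (v0 : v != 0) (vn1 : forall n, (0 < n)%N -> v ^+ n != 1).

Let vX n : v ^+ n != 0. Proof. by rewrite expf_neq0. Qed.
Let v21 : v * v - 1 != 0. Proof. exact: expr2_neq1. Qed.
Let vv1 := subrV_neq0 v0 vn1.

Lemma qint_nat n : qint v n%:Z = (v ^+ n - v ^- n) / (v - v^-1).
Proof. by rewrite /qint -exprnN. Qed.

Lemma qint_neq0 n : (0 < n)%N -> qint v n%:Z != 0.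
Proof.
move=> n0; rewrite qint_nat mulf_neq0 ?invr_eq0 //.
have -> : v ^+ n - v ^- n = (v ^+ (n * 2) - 1) / v ^+ n.
  by rewrite exprM; field; rewrite vX.
by rewrite mulf_neq0 ?invr_eq0 // subr_eq0 vn1 // muln_gt0 n0.
Qed.

Lemma qfact_neq0 n : qfact v n != 0.
Proof.
rewrite /qfact big_nat_cond prodf_seq_neq0; apply/allP => k _; apply/implyP => /andP[/andP[k0 _] _].
exact: qint_neq0.
Qed.

Lemma qbinom_pascal n t :
  v ^+ t * qbinom v (n + t).+1%:Z n.+1 =
  qbinom v (n + t)%:Z n + v ^+ (n + t).+1 * qbinom v (n + t)%:Z n.+1.
Proof.
rewrite /qbinom [in LHS]big_ord_recl [in X in _ = _ + X]big_ord_recr /= subr0.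
have -> : \prod_(i < n) qint v ((n + t).+1%:Z - (bump 0 i)%:Z) =
    \prod_(i < n) qint v ((n + t)%:Z - i%:Z).
  by apply: eq_bigr => i _; congr qint; rewrite /bump /=; lia.
have -> : (n + t)%:Z - n%:Z = t%:Z by lia.
have := qfact_neq0 n; have := qint_neq0 (ltn0Sn n).
rewrite /qfact (big_nat_recr n.+1) //= -/(qfact v n) !qint_nat.
move: (qfact v n) (\prod_(i < n) _) => f p n0 f0.
rewrite !exprS exprD in n0 *.
have n0' : v * v ^+ n * (v * v ^+ n) - 1 != 0.
  apply: contraNneq n0 => h.
  have -> : v * v ^+ n - (v * v ^+ n)^-1 = (v * v ^+ n * (v * v ^+ n) - 1) / (v * v ^+ n).
    by field; rewrite ?v0 ?vX.
  by rewrite h !mul0r.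
by field; rewrite ?v0 ?vX ?v21 ?f0 ?n0'.
Qed.

Lemma qbinom_gt n : qbinom v n%:Z n.+1 = 0.
Proof. by rewrite /qbinom big_ord_recr /= subrr /qint expr0z subrr mul0r mulr0 mul0r. Qed.

Lemma qbinom_0 n : qbinom v n 0 = 1.
Proof. by rewrite /qbinom big_ord0 /qfact big_geq // divr1. Qed.

(** The q-binomial theorem for the product of the commuting operators L_x - c v^(2k) R_x. *)
Lemma cont0_qbinom (A : algType F) (x y : A) (c : F) m :
  cont0 x (fun k => c * (v ^+ k) ^+ 2) m y =
  \sum_(n < m.+1) ((- c) ^+ (m - n) * v ^+ (m.-1 * (m - n)) * qbinom v m n)
    *: (x ^+ n * y * x ^+ (m - n)).
Proof.
elim: m => [|m IH].
  by rewrite cont0_0 big_ord1 /= qbinom_0 !mulr1 scale1r mul1r.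
pose a k n := (- c) ^+ (k - n) * v ^+ (k.-1 * (k - n)) * qbinom v k n.
pose mon n := x ^+ n * y * x ^+ (m.+1 - n).
rewrite cont0_S IH qcommE mulr_sumr mulr_suml.
have -> : \sum_(n < m.+1) x * (a m n *: (x ^+ n * y * x ^+ (m - n))) =
    \sum_(n < m.+1) a m n *: mon n.+1.
  by apply: eq_bigr => n _; rewrite -scalerAr !mulrA -exprS.
have -> : \sum_(n < m.+1) a m n *: (x ^+ n * y * x ^+ (m - n)) * x =
    \sum_(n < m.+2) a m n *: mon n.
  rewrite [RHS]big_ord_recr /= [a m m.+1]/a qbinom_gt mulr0 scale0r addr0.
  apply: eq_bigr => n _; rewrite -scalerAl -(mulrA _ _ x) -exprSr /mon subSn //.
  by rewrite -ltnS.
rewrite -[RHS]/(\sum_(n < m.+2) a m.+1 n *: mon n) [X in _ - _ *: X]big_ord_recl [RHS]big_ord_recl.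
rewrite scalerDr opprD addrCA scaler_sumr -sumrB; congr (_ + _).
  rewrite scalerA -scaleNr; congr (_ *: _); rewrite /a !subn0 /= !qbinom_0 !mulr1.
  case: m {IH mon} => [|m] /=; first by rewrite !mul0n !expr0; ring.
  have -> : (m.+1 * m.+2 = m * m.+1 + m.+1 * 2)%N by lia.
  by rewrite exprD [v ^+ (m.+1 * 2)]exprM (exprS (- c) m.+1); ring.
apply: eq_bigr => -[n lt_n] _; rewrite /= /bump /= add1n scalerA -scalerBl; congr (_ *: _).
have [t def_m] : exists t, m = (n + t)%N by exists (m - n)%N; lia.
rewrite /a subSS {IH mon lt_n}def_m /= addKn.
have -> : v ^+ ((n + t) * t) = v ^+ ((n + t).-1 * t) * v ^+ t.
  by rewrite -exprD; congr (_ ^+ _); case: n => [|n]; case: t => [|t]; lia.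
rewrite -!mulrA qbinom_pascal mulrDr mulrDr; congr (_ + _).
case: t => [|t]; first by rewrite addn0 qbinom_gt !mulr0 oppr0.
have -> : (n + t.+1 - n.+1 = t)%N by lia.
have -> : ((n + t.+1).-1 * t.+1 = (n + t.+1).-1 * t + (n + t))%N by lia.
have -> : v ^+ (n + t.+1).+1 = v ^+ (n + t) * v ^+ 2 by rewrite -exprD; congr (_ ^+ _); lia.
have -> : v ^+ (n + t.+1) = v ^+ (n + t) * v by rewrite -exprSr; congr (_ ^+ _); lia.
by rewrite (exprS (- c) t) !exprD; ring.
Qed.

End SerreElement.

Section CartanData.
Variables (K : fieldType) (I : finType) (C : cartan_datum I) (D : root_datum C).

Local Notation q := (@q K).
Local Notation q_ := (q_ K C).
Local Notation Y := (coweights D).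
Local Notation cartan := (cartan_entry D).

Lemma dot_diagE i : dot C i i = (2 * eps C i)%N%:Z.
Proof. by rewrite /eps; have [n _ ->] := dot_diag C i; rewrite absz_nat mulKn. Qed.

Lemma eps_gt0 i : (0 < eps C i)%N.
Proof. by rewrite /eps; have [n n0 ->] := dot_diag C i; rewrite absz_nat mulKn. Qed.

Lemma dotE i j : dot C i j = (eps C i)%:Z * cartan i j.
Proof.
apply: (@intr_inj rat); rewrite rmorphM /= pairing_coroot_root dot_diagE -!pmulrn natrM.
by field; rewrite pnatr_eq0 -lt0n eps_gt0.
Qed.

Definition neg_cartan (i j : I) : nat := `|cartan i j|.

Local Notation a_ := neg_cartan.

Lemma cartanE i j : i != j -> cartan i j = - (a_ i j)%:Z.
Proof.
move=> ne; have [n] := dot_offdiag C ne.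
rewrite -(pairing_coroot_root D) -/(cartan i j) => cE.
suff cE' : cartan i j = - n%:Z by rewrite /a_ cE' abszN absz_nat.
by apply: (@intr_inj rat); rewrite cE rmorphN.
Qed.

Lemma serre_degree i j : i != j -> `|1 - cartan i j|%N = (a_ i j).+1.
Proof. by move=> ne; rewrite cartanE // opprK -PoszD absz_nat. Qed.

Lemma q_expn_neq1 n : (0 < n)%N -> q ^+ n != 1.
Proof.
move=> n0; rewrite /q -rmorphXn -(rmorph1 (@Kq_frac K)) -subr_eq0 -rmorphB Kq_frac_eq0.
by rewrite monic_neq0 // monicXnsubC.
Qed.

Lemma q_i_neq0 i : q_ i != 0. Proof. by rewrite expf_neq0 ?q_neq0. Qed.

Lemma q_i_expn_neq1 i n : (0 < n)%N -> q_ i ^+ n != 1.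
Proof. by move=> n0; rewrite -exprM q_expn_neq1 // muln_gt0 eps_gt0. Qed.

(** Take c = v^-a and m = a + 1 in [cont0_qbinom]: the power v^((m-1)(m-n)) there is cancelled by
    c^(m-n), leaving signs and q-binomials. *)
Lemma serreE (A : algType (Kq K)) i j (x y : A) : i != j ->
  serre D i j x y = (-1) ^+ (a_ i j).+1 *: cont0 x (sexp (q_ i) (a_ i j)) (a_ i j).+1 y.
Proof.
move=> ne; rewrite /serre serre_degree //; set a := a_ i j; set v := q_ i.
have v0 : v != 0 by apply: q_i_neq0.
have -> : cont0 x (sexp v a) a.+1 y = cont0 x (fun k => (v ^+ a)^-1 * (v ^+ k) ^+ 2) a.+1 y.
  by apply: eq_cont => // k _; rewrite add0n sexpE mulrC.
rewrite (cont0_qbinom v0 (fun n => @q_i_expn_neq1 i n)) scaler_sumr.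
apply: eq_bigr => -[n lt_n] _ /=; rewrite scalerA; congr (_ *: _).
rewrite [(- _^-1) ^+ _]exprNn exprVn exprM /=.
have -> : (-1) ^+ a.+1 = (-1) ^+ n * (-1) ^+ (a.+1 - n) :> Kq K by rewrite -exprD subnKC.
have sgn : (-1) ^+ (a.+1 - n) * (-1) ^+ (a.+1 - n) = 1 :> Kq K by rewrite -exprMn mulrNN mulr1 expr1n.
set w := (v ^+ a) ^+ (a.+1 - n); have w0 : w != 0 by do 2 apply: expf_neq0.
transitivity ((-1) ^+ n * qbinom v a.+1 n * (((-1) ^+ (a.+1 - n) * (-1) ^+ (a.+1 - n)) * (w^-1 * w))).
  by rewrite sgn mulVf // !mulr1.
by ring.
Qed.

Definition qdot (i j : I) : Kq K := q ^ dot C i j.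

Lemma qdotC i j : qdot i j = qdot j i. Proof. by rewrite /qdot dotC. Qed.

Lemma qdot_diag i : qdot i i = q_ i ^+ 2.
Proof. by rewrite /qdot dot_diagE -exprM mulnC. Qed.

Lemma qdot_offdiag i j : i != j -> qdot i j = (q_ i ^+ a_ i j)^-1.
Proof. by move=> ne; rewrite /qdot dotE cartanE // mulrN -exprnN -exprM. Qed.

(** K at eps_i h_i is tilde K_i; with this normalization the pairing with alpha_j is the symmetric
    number i . j. *)
Definition hK (i : I) : Y := coroot D i *+ eps C i.

Lemma pairing0l x : pairing (0 : Y) x = 0.
Proof. by have /eqP := pairingDl (0 : Y) 0 x; rewrite addr0 -subr_eq subrr eq_sym => /eqP. Qed.

Lemma pairingNl (h : Y) x : pairing (- h) x = - pairing h x.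
Proof. by apply/eqP; rewrite -subr_eq0 opprK addrC -pairingDl subrr pairing0l. Qed.

Lemma pairing_hK i j : pairing (hK i) (Defs.root D j) = dot C i j.
Proof.
rewrite (dotE i j) /cartan_entry /hK; elim: (eps C i) => [|n IH].
  by rewrite mulr0n mul0r pairing0l.
by rewrite mulrS pairingDl IH intS mulrDl mul1r.
Qed.
End CartanData.

(** * The action of U on the algebra of the F_i and K_h *)

Section LeftMultiplication.
Variables (F : fieldType) (A : algType F).

Lemma alg_nontrivial : exists x : A, x != 0.
Proof. by exists 1; apply: oner_neq0. Qed.

Local Notation E := (endo alg_nontrivial).

Fact lmul_linear (x : A) c y z : x * (c *: y + z) = c *: (x * y) + x * z.
Proof. by rewrite mulrDr scalerAr. Qed.
Definition lmul (x : A) : E := Endo alg_nontrivial (lmul_linear x).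

Lemma lmulM x y : lmul (x * y) = lmul x * lmul y.
Proof. by apply: endoP => z; rewrite endoME /= mulrA. Qed.
Lemma lmulZ c x : lmul (c *: x) = c *: lmul x.
Proof. by apply: endoP => z; rewrite endoZE /= scalerAl. Qed.
Lemma lmulB x y : lmul (x - y) = lmul x - lmul y.
Proof. by apply: endoP => z; rewrite endoBE /= mulrBl. Qed.
Lemma lmul0 : lmul 0 = 0.
Proof. by apply: endoP => z; rewrite endo0E /= mul0r. Qed.
Lemma lmul1 : lmul 1 = 1.
Proof. by apply: endoP => z; rewrite endo1E /= mul1r. Qed.

Lemma lmulX x n : lmul (x ^+ n) = lmul x ^+ n.
Proof. by elim: n => [|n IH]; rewrite ?lmul1 // !exprS lmulM IH. Qed.

Lemma cont0_lmul x y s m : cont0 (lmul x) s m (lmul y) = lmul (cont0 x s m y).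
Proof.
elim: m => [|m IH]; first by rewrite !cont0_0.
by rewrite !cont0_S IH !qcommE lmulB lmulZ !lmulM.
Qed.

(* Square-zero extension: [lmul2 x e] is the matrix [[x, e], [0, x]]. *)
Lemma alg2_nontrivial : exists x : A * A, x != 0.
Proof. by exists (1, 1); rewrite xpair_eqE oner_eq0. Qed.

Local Notation E2 := (endo alg2_nontrivial).

Fact lmul2_linear (x e : A) c (p r : A * A) :
  (x * (c *: p + r).1 + e * (c *: p + r).2, x * (c *: p + r).2) =
  c *: (x * p.1 + e * p.2, x * p.2) + (x * r.1 + e * r.2, x * r.2).
Proof.
by congr pair; rewrite /= !mulrDr -!scalerAr ?scalerDr // addrACA.
Qed.
Definition lmul2 (x e : A) : E2 := Endo alg2_nontrivial (lmul2_linear x e).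

Lemma lmul2M x e y f : lmul2 x e * lmul2 y f = lmul2 (x * y) (x * f + e * y).
Proof.
apply: endoP => p; rewrite endoME /=; congr pair; last by rewrite mulrA.
by rewrite mulrDr mulrDl !mulrA addrA.
Qed.
Lemma lmul2B x e y f : lmul2 x e - lmul2 y f = lmul2 (x - y) (e - f).
Proof.
apply: endoP => p; rewrite endoBE /=; congr pair; rewrite /= !mulrBl //.
by rewrite opprD addrACA.
Qed.
Lemma lmul2Z c x e : c *: lmul2 x e = lmul2 (c *: x) (c *: e).
Proof. by apply: endoP => p; congr pair; rewrite /= -!scalerAl // scalerDr. Qed.

Lemma qcomm_lmul2 x e y f s : qcomm (lmul2 x e) s (lmul2 y f) =
  lmul2 (qcomm x s y) (qcomm x s f + (e * y - s *: (y * e))).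
Proof.
rewrite !qcommE !lmul2M lmul2Z lmul2B; congr lmul2.
by rewrite [y * e + f * x]addrC scalerDr opprD addrACA.
Qed.

End LeftMultiplication.

Lemma qcomm_bracket (F : fieldType) (A : algType F) (G b x : A) s :
  G * qcomm b s x - qcomm b s x * G =
  qcomm b s (G * x - x * G) + ((G * b - b * G) * x - s *: (x * (G * b - b * G))).
Proof. by rewrite !qcommE; expand_products; lin_split F; ring. Qed.

Section Borel.
Variables (K : fieldType) (I : finType) (C : cartan_datum I) (D : root_datum C).

Local Notation q := (@q K).
Local Notation q_ := (q_ K C).
Local Notation Y := (coweights D).
Local Notation a_ := (neg_cartan D).
Local Notation alpha := (Defs.root D).
Local Notation k_ := (hK D).

Definition borel_free : algType (Kq K) := freealg (Kq K) (I + Y)%type.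
Definition bfF (i : I) : borel_free := fgen (Kq K) (inl i).
Definition bfK (h : Y) : borel_free := fgen (Kq K) (inr h).

Inductive borel_relator : borel_free -> Prop :=
| borel_K0 : borel_relator (bfK 0 - 1)
| borel_KD h h' : borel_relator (bfK h * bfK h' - bfK (h + h'))
| borel_KF h i :
    borel_relator (bfK h * bfF i - q ^ (- pairing h (alpha i)) *: (bfF i * bfK h))
| borel_serre i j : i != j -> borel_relator (serre D i j (bfF i) (bfF j)).

Lemma serre_morph (A B : algType (Kq K)) (phi : {lrmorphism A -> B}) i j x y :
  phi (serre D i j x y) = serre D i j (phi x) (phi y).
Proof.
rewrite /serre linear_sum; apply: eq_bigr => n _.
by rewrite linearZ !rmorphM !rmorphXn.
Qed.

Lemma serre_0 (A : algType (Kq K)) i j (x : A) : serre D i j x 0 = 0.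
Proof. by rewrite /serre big1 // => n _; rewrite mulr0 mul0r scaler0. Qed.

Lemma borel_proper : ~ ideal_gen borel_relator 1.
Proof.
(* The character F_i -> 0, K_h -> 1 respects all relators. *)
have [phi phiE] := freealg_lift (fun g : (I + Y)%type => (if g is inr _ then 1 else 0) : (Kq K)^o).
have phiF i : phi (bfF i) = 0 by apply: phiE.
have phiK h : phi (bfK h) = 1 by apply: phiE.
have phi_rel x : borel_relator x -> phi x = 0.
  case=> [|h h'|h i|i j ne].
  - by rewrite rmorphB /= rmorph1 phiK subrr.
  - by rewrite rmorphB rmorphM /= !phiK mulr1 subrr.
  - by rewrite linearB linearZ !rmorphM /= phiF mulr0 mul0r scaler0 subrr.
  - by rewrite serre_morph /= !phiF serre_0.
have phi_ideal x : ideal_gen borel_relator x -> phi x = 0.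
  elim=> {x} [|||b x _ IH|b x _ IH]; [exact: phi_rel | exact: raddf0 | | |].
  - by move=> x y _ x0 _ y0; rewrite raddfD /= x0 y0 addr0.
  - by rewrite rmorphM /= IH mulr0.
  - by rewrite rmorphM /= IH mul0r.
by move/phi_ideal/eqP; rewrite rmorph1 oner_eq0.
Qed.

Definition borel : algType (Kq K) := quotalg borel_proper.

Definition borel_pi : borel_free -> borel := quotalg_pi borel_proper.
HB.instance Definition _ := GRing.LRMorphism.on borel_pi.

Definition bF (i : I) : borel := borel_pi (bfF i).
Definition bK (h : Y) : borel := borel_pi (bfK h).

Lemma borel_rel x : borel_relator x -> borel_pi x = 0.
Proof.
move=> Sx; rewrite -(raddf0 borel_pi); apply/eqP/quotalg_piP; rewrite subr0.
exact: ideal_gen_base.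
Qed.

Lemma bK0 : bK 0 = 1.
Proof. by apply/eqP; rewrite -subr_eq0 -(rmorph1 borel_pi) -rmorphB; apply/eqP/borel_rel/borel_K0. Qed.

Lemma bKD h h' : bK h * bK h' = bK (h + h').
Proof. by apply/eqP; rewrite -subr_eq0 -rmorphM -rmorphB; apply/eqP/borel_rel/borel_KD. Qed.

Lemma bKF h i : bK h * bF i = q ^ (- pairing h (alpha i)) *: (bF i * bK h).
Proof.
apply/eqP; rewrite -subr_eq0 -!rmorphM -linearZ -rmorphB.
exact/eqP/borel_rel/borel_KF.
Qed.

Lemma bserre i j : i != j -> serre D i j (bF i) (bF j) = 0.
Proof. by move=> ne; rewrite -(serre_morph borel_pi) /=; apply/borel_rel/borel_serre. Qed.

Lemma bserre_cont i j : i != j -> cont0 (bF i) (sexp (q_ i) (a_ i j)) (a_ i j).+1 (bF j) = 0.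
Proof.
move=> ne; have /eqP := bserre ne.
by rewrite serreE // scaler_eq0 signr_eq0 => /eqP.
Qed.

Lemma borel_ind (P : borel -> Prop) :
  P 1 -> (forall c x, P x -> P (c *: x)) -> (forall x y, P x -> P y -> P (x + y)) ->
  (forall i x, P x -> P (bF i * x)) -> (forall h x, P x -> P (bK h * x)) ->
  forall x, P x.
Proof.
move=> P1 PZ PD PF PK x; have [y ->] := quotalg_pi_surj x.
suff: forall z, P z -> P (borel_pi y * z) by move=> /(_ 1 P1); rewrite mulr1.
elim/freealg_ind: y {x} => [[i|h]||c y IH|y y' IH IH'|y y' IH IH'] z Pz.
- exact: PF.
- exact: PK.
- by rewrite rmorph1 mul1r.
- by rewrite linearZ -scalerAl; apply/PZ/IH.
- by rewrite raddfD mulrDl; apply: PD; [apply: IH | apply: IH'].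
- by rewrite rmorphM -mulrA; apply/IH/IH'.
Qed.

End Borel.

Section VermaAction.
Variables (K : fieldType) (I : finType) (C : cartan_datum I) (D : root_datum C).

Local Notation q := (@q K).
Local Notation q_ := (q_ K C).
Local Notation Y := (coweights D).
Local Notation a_ := (neg_cartan D).
Local Notation alpha := (Defs.root D).
Local Notation k_ := (hK D).
Local Notation Bo := (borel K D).
Local Notation bF := (bF K D).
Local Notation bK := (@bK K I C D).
Local Notation E := (endo (alg_nontrivial Bo)).

Lemma bKX h n : bK h ^+ n = bK (h *+ n).
Proof. by elim: n => [|n IH]; rewrite ?mulr0n ?bK0 // exprS IH bKD mulrS. Qed.

Lemma bKFk i j : bK (k_ i) * bF j = (qdot K C i j)^-1 *: (bF j * bK (k_ i)).
Proof. by rewrite bKF pairing_hK /qdot invr_expz. Qed.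

Lemma bKFkN i j : bK (- k_ i) * bF j = qdot K C i j *: (bF j * bK (- k_ i)).
Proof. by rewrite bKF pairingNl opprK pairing_hK. Qed.

Lemma qdot_neq0 i j : qdot K C i j != 0. Proof. by rewrite expfz_neq0 ?q_neq0. Qed.

Definition bD (i : I) : Bo := (q_ i - (q_ i)^-1)^-1 *: (bK (k_ i) - bK (- k_ i)).

Lemma bD_K i h : bD i * bK h = bK h * bD i.
Proof.
by rewrite /bD -scalerAl -scalerAr mulrBl mulrBr !bKD ![h + _]addrC.
Qed.

Section Derivation.
Variable i : I.

Local Notation E2 := (endo (alg2_nontrivial Bo)).

Fact kop_linear h c (p r : Bo * Bo) :
  (q ^ (- pairing h (alpha i)) *: (bK h * (c *: p + r).1), bK h * (c *: p + r).2) =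
  c *: (q ^ (- pairing h (alpha i)) *: (bK h * p.1), bK h * p.2)
    + (q ^ (- pairing h (alpha i)) *: (bK h * r.1), bK h * r.2).
Proof.
congr pair; rewrite /= mulrDr -scalerAr // scalerDr !scalerA.
by congr (_ *: _ + _); rewrite mulrC.
Qed.
(** A representation by upper triangular matrices whose off-diagonal entry is x -> E_i x. The upper
    diagonal entry of K_h carries the scalar acquired when E_i passes K_h. *)
Definition kop h : E2 := Endo (alg2_nontrivial Bo) (kop_linear h).

Definition fop j : E2 := lmul2 (bF j) (if j == i then bD i else 0).

(** [g] computes the derivation with x -> e and y -> f on partial Serre elements. *)
Lemma cont0_lmul2_fst (x y e f : Bo) s m :
  exists g : nat -> Bo, [/\ g 0%N = f,
    forall n, g n.+1 = qcomm x (s n) (g n) + (e * cont0 x s n y - s n *: (cont0 x s n y * e))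
  & cont0 (lmul2 x e) s m (lmul2 y f) = lmul2 (cont0 x s m y) (g m)].
Proof.
pose g := fix g n := if n is n'.+1 then
  qcomm x (s n') (g n') + (e * cont0 x s n' y - s n' *: (cont0 x s n' y * e)) else f.
exists g; split=> //; elim: m => [|m IH]; first by rewrite !cont0_0.
by rewrite !cont0_S IH qcomm_lmul2.
Qed.

Lemma kop_fop h j : kop h * fop j = q ^ (- pairing h (alpha j)) *: (fop j * kop h).
Proof.
apply: endoP => p; rewrite endoZE !endoME /fop /=; congr pair; last first.
  by rewrite /= mulrA bKF -scalerAl mulrA.
rewrite /= mulrDr scalerDr mulrA bKF -!scalerAl -!scalerAr !scalerDr !scalerA !mulrA.
congr (_ + _); first by rewrite mulrC.
by case: eqP => [->|_]; rewrite ?bD_K // mulr0 !mul0r !scaler0.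
Qed.

(** The off-diagonal entry is E_i applied to a Serre element. For j = i it is 0 by [cont0_bracket].
    For l = i the letter F_l is replaced by a combination of K_l and its inverse, which are killed
    by the factors with index 0 and a. Otherwise nothing remains. *)
Lemma fop_serre j l : j != l -> serre D j l (fop j) (fop l) = 0.
Proof.
move=> ne; rewrite serreE // /fop.
have v0 := @q_i_neq0 K I C j; have vn1 := @q_i_expn_neq1 K I C j.
have vv1 := subrV_neq0 v0 vn1.
set e := if j == i then _ else _; set f := if l == i then _ else _.
have [g [g0 gS ->]] := cont0_lmul2_fst (bF j) (bF l) e f (sexp (q_ j) (a_ j l)) (a_ j l).+1.
rewrite bserre_cont //; suff -> : g (a_ j l).+1 = 0.
  by apply: endoP => p; rewrite endoZE /= !mul0r addr0 scaler0.
rewrite /e /f in g0 gS; case: (eqVneq j i) => [ji|ji] in g0 gS.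
  have li : (l == i) = false by rewrite -ji eq_sym (negPf ne).
  rewrite li -ji in g0 gS.
  apply: (cont0_bracket v0 vv1 _ _ _ _ g0 gS).
  - by rewrite bKFk qdot_diag.
  - by rewrite bKFk (qdot_offdiag K D) // invrK.
  - by rewrite bKFkN (qdot_offdiag K D).
  - by rewrite bKFkN qdot_diag.
have gE n : g n = cont0 (bF j) (sexp (q_ j) (a_ j l)) n f.
  elim: n => [|n IH]; first by rewrite cont0_0 g0.
  by rewrite gS cont0_S IH mul0r mulr0 scaler0 subr0 addr0.
rewrite gE /f; case: eqP => [li|_]; last by rewrite /cont0 cont_at0.
rewrite -li /bD /cont0 contZ -[- bK _]scaleN1r contD contZ.
have -> : cont (bF j) (sexp (q_ j) (a_ j l)) (fun=> 0) 0 (a_ j l).+1 (bK (k_ l)) = 0.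
  apply: (@cont0_kill _ _ _ _ _ (qdot K C l j) _ 0) => //.
    by rewrite bKFk scalerA divff ?qdot_neq0 // scale1r.
  by rewrite sexp0 qdotC (qdot_offdiag K D).
have -> : cont (bF j) (sexp (q_ j) (a_ j l)) (fun=> 0) 0 (a_ j l).+1 (bK (- k_ l)) = 0.
  apply: (@cont0_kill _ _ _ _ _ (qdot K C l j)^-1 _ (a_ j l)) => //.
    by rewrite bKFkN scalerA mulVf ?qdot_neq0 // scale1r.
  by rewrite sexpa // qdotC (qdot_offdiag K D) // invrK.
by rewrite scaler0 addr0 scaler0.
Qed.

Lemma derivation_lift : exists psi : {lrmorphism Bo -> E2},
  (forall j, psi (bF j) = fop j) /\ (forall h, psi (bK h) = kop h).
Proof.
have [phi phiE] := freealg_lift (fun g : (I + Y)%type =>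
  match g with inl j => fop j | inr h => kop h end).
have phiF j : phi (bfF K D j) = fop j by apply: phiE.
have phiK h : phi (bfK K h) = kop h by apply: phiE.
have phi_rel x : borel_relator x -> phi x = 0.
  case=> [|h h'|h j|j l ne].
  - rewrite rmorphB /= rmorph1 phiK; apply/eqP; rewrite subr_eq0; apply/eqP/endoP => -[u w].
    by rewrite /= pairing0l oppr0 expr0z scale1r bK0 !mul1r.
  - rewrite rmorphB rmorphM /= !phiK; apply/eqP; rewrite subr_eq0; apply/eqP/endoP => -[u w].
    rewrite endoME /= -scalerAr scalerA !mulrA bKD; congr pair; congr (_ *: _).
    by rewrite pairingDl opprD expfzDr ?q_neq0.
  - by rewrite linearB linearZ !rmorphM /= phiF phiK kop_fop subrr.
  - by rewrite serre_morph /= !phiF fop_serre.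
have [psi psiE] := quotalg_lift (borel_proper (D:=D)) phi_rel.
by exists psi; split=> [j|h]; rewrite psiE ?phiF ?phiK.
Qed.

Lemma derivation_exists : exists e : E,
  [/\ e 1 = 0, forall j x, e (bF j * x) = bF j * e x + (if j == i then bD i else 0) * x
    & forall h x, e (bK h * x) = q ^ (- pairing h (alpha i)) *: (bK h * e x)].
Proof.
have [psi [psiF psiK]] := derivation_lift.
have snd_psi x p : (psi x p).2 = x * p.2.
  elim/borel_ind: x p => [|c x IH|x y IHx IHy|j x IH|h x IH] p.
  - by rewrite rmorph1 mul1r.
  - by rewrite linearZ /= IH scalerAl.
  - by rewrite raddfD /= IHx IHy mulrDl.
  - by rewrite rmorphM /= psiF /= IH mulrA.
  - by rewrite rmorphM /= psiK /= IH mulrA.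
(* The lower diagonal entry of the matrix of x is x, so its value at (0, 1) is (e x, x); the first
   component defines the derivation. *)
have e_lin c x y : (psi (c *: x + y) (0, 1)).1 = c *: (psi x (0, 1)).1 + (psi y (0, 1)).1.
  by rewrite linearD linearZ.
exists (Endo (alg_nontrivial Bo) e_lin); split=> [|j x|h x] /=.
- by rewrite rmorph1.
- by rewrite rmorphM /= psiF /= snd_psi mulr1.
- by rewrite rmorphM /= psiK.
Qed.

End Derivation.

Local Notation U := (qg K D).

(** A Verma module whose highest weight is left free: E_i kills 1, while F_i and K_h act by left
    multiplication. *)
Lemma verma_action : exists rho : {lrmorphism U -> E},
  [/\ forall i, rho (qE K D i) 1 = 0,
      forall i j x, rho (qE K D i) (bF j * x) =
        bF j * rho (qE K D i) x + (if j == i then bD i else 0) * x,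
      forall i h x, rho (qE K D i) (bK h * x) =
        q ^ (- pairing h (alpha i)) *: (bK h * rho (qE K D i) x),
      forall i, rho (qF K D i) = lmul (bF i)
    & forall h, rho (qK K h) = lmul (bK h)].
Proof.
have [e eP] := choice derivation_exists.
have e1 i : e i 1 = 0 by have [] := eP i.
have eF i j x : e i (bF j * x) = bF j * e i x + (if j == i then bD i else 0) * x.
  by have [] := eP i.
have eK i h x : e i (bK h * x) = q ^ (- pairing h (alpha i)) *: (bK h * e i x).
  by have [] := eP i.
have FE i j : lmul (bF j) * e i - e i * lmul (bF j) = if j == i then - lmul (bD i) else 0.
  apply: endoP => x; rewrite endoBE !endoME /= eF opprD addNKr.
  by case: eqP => _; rewrite ?mul0r ?oppr0.
have KE h i : lmul (bK h) * e i = q ^ pairing h (alpha i) *: (e i * lmul (bK h)).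
  apply: endoP => x; rewrite endoZE !endoME /= eK scalerA -expfzDr ?q_neq0 //.
  by rewrite subrr expr0z scale1r.
have EK i h : e i * lmul (bK h) = (q ^ pairing h (alpha i))^-1 *: (lmul (bK h) * e i).
  by rewrite KE scalerA mulVf ?scale1r // expfz_neq0 ?q_neq0.
(* The Serre element of the operators e kills 1, q-commutes with every K_h and commutes with every
   F_k, hence kills the whole module. *)
have e_serre i j : i != j -> serre D i j (e i) (e j) = 0.
  move=> ne; rewrite serreE //.
  have v0 := @q_i_neq0 K I C i; have vn1 := @q_i_expn_neq1 K I C i.
  have vv1 := subrV_neq0 v0 vn1.
  set v := q_ i in v0 vn1 vv1 *; set a := a_ i j.
  pose u m := cont0 (e i) (sexp v a) m (e j).
  suff u0 : u a.+1 = 0 by rewrite -/(u _) u0 scaler0.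
  have u1 m : u m 1 = 0.
    elim: m => [|m IH]; first by rewrite /u cont0_0.
    rewrite /u cont0_S qcommE endoBE endoZE !endoME -/(u m) IH e1 !endo0.
    by rewrite scaler0 subr0.
  have uK m h : exists c, u m * lmul (bK h) = c *: (lmul (bK h) * u m).
    elim: m => [|m [c IH]]; first by rewrite /u cont0_0 EK; eexists.
    exists ((q ^ pairing h (alpha i))^-1 * c); rewrite /u cont0_S -/(u m) qcommE.
    rewrite mulrBl -mulrA IH -scalerAl -mulrA EK -!scalerAr !mulrA EK IH.
    by expand_products; lin_split (Kq K); ring.
  have uF k : lmul (bF k) * u a.+1 - u a.+1 * lmul (bF k) = 0.
    pose g m := lmul (bF k) * u m - u m * lmul (bF k).
    have gS m : g m.+1 = qcomm (e i) (sexp v a m) (g m) +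
        ((if k == i then - lmul (bD i) else 0) * u m -
          sexp v a m *: (u m * (if k == i then - lmul (bD i) else 0))).
      by rewrite /g /u cont0_S -/(u m) qcomm_bracket FE.
    have g0 : g 0%N = if k == j then - lmul (bD j) else 0.
      by rewrite /g /u cont0_0 FE.
    rewrite -/(g _); case: (eqVneq k i) => [ki|ki] in gS.
      have kj : (k == j) = false by rewrite ki (negPf ne).
      (* The bracket of F_i with E_i is minus [bD i], so K_i and its inverse exchange roles in
         [cont0_bracket]. *)
      have gS' m : g m.+1 = qcomm (e i) (sexp v a m) (g m) +
          ((v - v^-1)^-1 *: (lmul (bK (- k_ i)) - lmul (bK (k_ i))) * u m -
            sexp v a m *: (u m * ((v - v^-1)^-1 *: (lmul (bK (- k_ i)) - lmul (bK (k_ i)))))).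
        by rewrite gS /bD lmulZ lmulB -scalerN opprB.
      rewrite kj in g0; apply: (cont0_bracket v0 vv1 _ _ _ _ g0 gS').
      - by rewrite KE pairingNl pairing_hK -invr_expz -/(qdot K C i i) qdot_diag.
      - by rewrite KE pairingNl pairing_hK -invr_expz -/(qdot K C i j)
          (qdot_offdiag K D) // invrK.
      - by rewrite KE pairing_hK -/(qdot K C i j) (qdot_offdiag K D).
      - by rewrite KE pairing_hK -/(qdot K C i i) qdot_diag.
    have gE n : g n = cont0 (e i) (sexp v a) n (g 0%N).
      elim: n => [|n IH]; first by rewrite cont0_0.
      by rewrite gS cont0_S IH mul0r mulr0 scaler0 subr0 addr0.
    rewrite gE g0; case: eqP => [kj|_]; last by rewrite /cont0 cont_at0.
    rewrite /bD lmulZ lmulB -scalerN opprB /cont0 contZ -[- lmul _]scaleN1r contD contZ.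
    have -> : cont (e i) (sexp v a) (fun=> 0) 0 a.+1 (lmul (bK (k_ j))) = 0.
      apply: (cont0_kill (EK _ _) (ltnSn a)).
      by rewrite sexpa // pairing_hK -/(qdot K C j i) qdotC (qdot_offdiag K D) // invrK.
    have -> : cont (e i) (sexp v a) (fun=> 0) 0 a.+1 (lmul (bK (- k_ j))) = 0.
      apply: (cont0_kill (EK _ _) (ltn0Sn a)).
      rewrite sexp0 // pairingNl pairing_hK -invr_expz -/(qdot K C j i) qdotC.
      by rewrite (qdot_offdiag K D) // invrK.
    by rewrite scaler0 addr0 scaler0.
  apply: endoP => x; rewrite endo0E.
  elim/borel_ind: x => [|c x IH|x y IHx IHy|k x IH|h x IH].
  - exact: u1.
  - by rewrite endoZ IH scaler0.
  - by rewrite endoD IHx IHy addr0.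
  - have /eqP := congr1 (fun f : E => f x) (uF k); rewrite endoBE !endoME endo0E IH.
    by rewrite endo0 sub0r oppr_eq0 => /eqP.
  - have [c /(congr1 (fun f : E => f x))] := uK a.+1 h.
    by rewrite endoZE !endoME IH endo0 scaler0.
have [phi phiE] := freealg_lift (fun g : (I + I + Y)%type =>
  match g with inl (inl i) => e i | inl (inr i) => lmul (bF i) | inr h => lmul (bK h) end).
have phi_E i : phi (fE K D i) = e i by apply: phiE.
have phi_F i : phi (fF K D i) = lmul (bF i) by apply: phiE.
have phi_K h : phi (fK K h) = lmul (bK h) by apply: phiE.
have phi_rel x : qg_relator x -> phi x = 0.
  case=> [|h h'|h i|h i|i j|i j ne|i j ne].
  - by rewrite rmorphB /= rmorph1 phi_K bK0 lmul1 subrr.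
  - by rewrite rmorphB rmorphM /= !phi_K -lmulM bKD subrr.
  - by rewrite linearB linearZ !rmorphM /= phi_E phi_K KE subrr.
  - by rewrite linearB linearZ !rmorphM /= phi_F phi_K -!lmulM bKF lmulZ subrr.
  - rewrite !linearB !linearZ /= !rmorphM !rmorphXn /= phi_E phi_F !phi_K.
    rewrite -[e i * _ - _]opprB FE -!lmulX !bKX mulNrn -/(k_ i).
    have [_|_] := eqVneq j i; first by rewrite mulr1n /bD lmulZ lmulB; lin_split (Kq K); ring.
    by rewrite mulr0n mul0r !scale0r !addr0 oppr0.
  - by rewrite serre_morph /= !phi_E e_serre.
  - rewrite serre_morph /= !phi_F serreE // cont0_lmul bserre_cont // lmul0.
    by rewrite scaler0.
have [rho rhoE] := quotalg_lift (qg_relator_proper (D:=D)) phi_rel.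
have rho_E i : rho (qE K D i) = e i by rewrite -phi_E; apply: rhoE.
exists rho; split=> [i|i j x|i h x|i|h]; rewrite ?rho_E //.
- by rewrite -phi_F; apply: rhoE.
- by rewrite -phi_K; apply: rhoE.
Qed.

End VermaAction.

(** * Relations between the B_i *)

Section QuasiCommutation.
Variables (F : fieldType) (A : algType F).

Definition qcommutes (c : F) (x y : A) := x * y = c *: (y * x).

Lemma qcommutesMl c d x y z : qcommutes c x z -> qcommutes d y z -> qcommutes (c * d) (x * y) z.
Proof.
rewrite /qcommutes => xz yz; rewrite -(mulrA x) yz -scalerAr (mulrA x) xz -scalerAl scalerA.
by rewrite [d * c]mulrC (mulrA z).
Qed.

Lemma qcommutesMr c d x y z : qcommutes c x y -> qcommutes d x z -> qcommutes (c * d) x (y * z).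
Proof.
rewrite /qcommutes => xy xz; rewrite (mulrA x) xy -scalerAl -(mulrA y x) xz -scalerAr.
by rewrite scalerA (mulrA y).
Qed.

Lemma qcommutesZl c a x y : qcommutes c x y -> qcommutes c (a *: x) y.
Proof. by rewrite /qcommutes => xy; rewrite -scalerAl xy -scalerAr !scalerA [c * a]mulrC. Qed.

Lemma qcommutesZr c a x y : qcommutes c x y -> qcommutes c x (a *: y).
Proof. by rewrite /qcommutes => xy; rewrite -scalerAr xy -scalerAl !scalerA [c * a]mulrC. Qed.

Lemma qcommutesV c x y : c != 0 -> qcommutes c x y -> qcommutes c^-1 y x.
Proof. by rewrite /qcommutes => c0 ->; rewrite scalerA mulVf // scale1r. Qed.

Lemma qcommutes1 x y : x * y = y * x -> qcommutes 1 x y.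
Proof. by rewrite /qcommutes scale1r. Qed.

End QuasiCommutation.

Section Relations.
Variables (K : fieldType) (I : finType) (C : cartan_datum I) (D : root_datum C).

Local Notation q := (@q K).
Local Notation q_ := (q_ K C).
Local Notation Y := (coweights D).
Local Notation a_ := (neg_cartan D).
Local Notation alpha := (Defs.root D).
Local Notation U := (qg K D).
Local Notation E := (qE K D).
Local Notation F := (qF K D).
Local Notation qdot := (qdot K C).

Definition qk (i : I) : U := qK K (hK D i).
Definition qkV (i : I) : U := qK K (- hK D i).

Lemma qg_rel x y : qg_relator (x - y) -> qg_pi x = qg_pi y :> U.
Proof. by move/qg_pi_relator/eqP; rewrite raddfB subr_eq0 => /eqP. Qed.

Lemma qKE h i : qcommutes (q ^ pairing h (alpha i)) (qK K h) (E i).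
Proof. by have := qg_rel (relator_KE K h i); rewrite linearZ !rmorphM. Qed.

Lemma qKF h i : qcommutes (q ^ (- pairing h (alpha i))) (qK K h) (F i).
Proof. by have := qg_rel (relator_KF K h i); rewrite linearZ !rmorphM. Qed.

Lemma qKC h h' : qK K h * qK K h' = qK K h' * qK K h :> U.
Proof. by rewrite !qKD addrC. Qed.

Lemma qkE i j : qcommutes (qdot i j) (qk i) (E j).
Proof. by have := qKE (hK D i) j; rewrite pairing_hK. Qed.
Lemma qkF i j : qcommutes (qdot i j)^-1 (qk i) (F j).
Proof. by have := qKF (hK D i) j; rewrite pairing_hK -invr_expz. Qed.
Lemma qkVE i j : qcommutes (qdot i j)^-1 (qkV i) (E j).
Proof. by have := qKE (- hK D i) j; rewrite pairingNl pairing_hK -invr_expz. Qed.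
Lemma qkVF i j : qcommutes (qdot i j) (qkV i) (F j).
Proof. by have := qKF (- hK D i) j; rewrite pairingNl pairing_hK opprK. Qed.

Lemma qKX h n : qK K h ^+ n = qK K (h *+ n) :> U.
Proof. by elim: n => [|n IH]; rewrite ?mulr0n ?qK0 // exprS IH qKD mulrS. Qed.

Lemma qKtildeVE i : qKtildeV K D i = qkV i.
Proof. by rewrite /qKtildeV qKX mulNrn. Qed.

Lemma qEF i j : E i * F j = F j * E i +
  (if i == j then (q_ i - (q_ i)^-1)^-1 *: (qk i - qkV i) else 0).
Proof.
have EF := qg_pi_relator (relator_EF K D i j).
rewrite !linearB !linearZ /= !rmorphM !rmorphXn /= in EF.
have {EF}/(canRL (subrK _)) := canRL (addrK _) EF; rewrite -!/(E _) -!/(F _) => ->.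
rewrite -!/(qK K _) !qKX mulNrn -/(qk i) -/(qkV i) sub0r opprD addrC; congr (_ + _).
case: eqP => _; last by rewrite mul0r !scale0r subr0 oppr0.
by rewrite mul1r !scalerN !opprK scalerBr.
Qed.

Lemma qEFC i j : i != j -> E i * F j = F j * E i.
Proof. by move=> ne; rewrite qEF (negPf ne) addr0. Qed.

Lemma qserreE i j : i != j -> cont0 (E i) (sexp (q_ i) (a_ i j)) (a_ i j).+1 (E j) = 0.
Proof.
move=> ne; have /eqP := qg_pi_relator (relator_serreE K D ne).
by rewrite serre_morph /= serreE // scaler_eq0 signr_eq0 => /eqP.
Qed.

Lemma qserreF i j : i != j -> cont0 (F i) (sexp (q_ i) (a_ i j)) (a_ i j).+1 (F j) = 0.
Proof.
move=> ne; have /eqP := qg_pi_relator (relator_serreF K D ne).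
by rewrite serre_morph /= serreE // scaler_eq0 signr_eq0 => /eqP.
Qed.

End Relations.

Section IotaRelations.
Variables (K : fieldType) (I : finType) (C : cartan_datum I) (D : root_datum C).
Variables (t : diagram_involution D) (varsigma kappa : I -> Kq K).

Local Notation q_ := (q_ K C).
Local Notation a_ := (neg_cartan D).
Local Notation U := (qg K D).
Local Notation E := (qE K D).
Local Notation F := (qF K D).
Local Notation qdot := (qdot K C).
Local Notation qk := (qk K D).
Local Notation qkV := (qkV K D).
Local Notation tau := (tau t).
Local Notation B := (qB t varsigma kappa).

Lemma tau_inj : injective tau. Proof. exact: can_inj (tauK t). Qed.

Lemma eps_tau i : eps C (tau i) = eps C i.
Proof. by rewrite /eps tau_dot. Qed.

Lemma q_i_tau i : q_ (tau i) = q_ i. Proof. by rewrite /Defs.q_ eps_tau. Qed.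

Lemma qdot_tau i j : qdot (tau i) (tau j) = qdot i j.
Proof. by rewrite /qdot tau_dot. Qed.

Lemma cartan_tau i j : cartan_entry D (tau i) (tau j) = cartan_entry D i j.
Proof. by rewrite /cartan_entry -!tauX_root -tauY_coroot tau_pairing. Qed.

Lemma neg_cartan_tau i j : a_ (tau i) (tau j) = a_ i j.
Proof. by rewrite /neg_cartan cartan_tau. Qed.

Definition qe (i : I) : U := varsigma i *: (E (tau i) * qkV i).

Lemma qB_E i : B i = F i + qe i + kappa i *: qkV i.
Proof. by rewrite /qB qKtildeVE. Qed.

Lemma qe_F_comm i j : j != tau i -> qcommutes (qdot i j) (qe i) (F j).
Proof.
move=> ne; apply: qcommutesZl; rewrite -[qdot i j]mul1r.
apply: qcommutesMl; last exact: qkVF.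
by apply: qcommutes1; rewrite qEFC // eq_sym.
Qed.

Lemma qkV_neq0 i j : (qdot i j)^-1 != 0. Proof. by rewrite invr_eq0 qdot_neq0. Qed.

Lemma F_qkV i j : qcommutes (qdot i j)^-1 (F j) (qkV i).
Proof. by apply: qcommutesV; rewrite ?qdot_neq0 //; apply: qkVF. Qed.

Lemma E_qkV i j : qcommutes (qdot i j) (E j) (qkV i).
Proof. by rewrite -[qdot i j]invrK; apply: qcommutesV; rewrite ?qkV_neq0 //; apply: qkVE. Qed.

(** Pulling out the torus factors leaves the Serre element of E_{tau i} and E_{tau j} with inverted
    q_i, and reversal turns it into the usual one. *)
Lemma EkV_kill i j : i != j ->
  cont0 (qe i) (sexp (q_ i)^-1 (a_ i j)) (a_ i j).+1 (E (tau j) * qkV j) = 0.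
Proof.
move=> ne; have ne' : tau i != tau j by rewrite (inj_eq tau_inj).
have ZP : qkV j * E (tau i) = (qdot i (tau j))^-1 *: (E (tau i) * qkV j).
  by rewrite qkVE qdotC -qdot_tau tauK.
have [c ->] := @cont0_twist _ _ (E (tau i)) (qkV i) (E (tau j)) (qkV j) _ _ (varsigma i)
  (sexp (q_ i)^-1 (a_ i j)) (a_ i j).+1 (qkVE K D i (tau i)) (qkVE K D i (tau j)) ZP (qKC K _ _).
rewrite -cont0_revV ?q_i_neq0 //.
have := qserreE K D ne'; rewrite q_i_tau neg_cartan_tau => ->.
by rewrite !mul0r scaler0.
Qed.

(** F_i and [qe i] q-commute when tau i differs from i, so no d-term arises, and either summand of
    B_i can be eliminated by [cont0_chain]. *)
Lemma cont0_qB_tau_neq i j : tau i != i -> i != j -> j != tau i ->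
  kappa i = 0 -> (kappa j != 0 -> tau j = j) ->
  cont0 (B i) (sexp (q_ i) (a_ i j)) (a_ i j).+1 (B j) = 0.
Proof.
move=> ti ne jti ki kj.
set v := q_ i; set a := a_ i j.
have v0 : v != 0 by apply: q_i_neq0.
have vn1 : forall n, (0 < n)%N -> v ^+ n != 1 by move=> n; apply: q_i_expn_neq1.
have v2 : v ^+ 2 != 0 by rewrite expf_neq0.
have vd : qdot i j = (v ^+ a)^-1 by rewrite (qdot_offdiag K D).
have sE m : sexp v^-1 a m.+1 = v ^- 2 * sexp v^-1 a m by rewrite sexpS exprVn.
have sF m : sexp v a m.+1 = v ^+ 2 * sexp v a m by rewrite sexpS.
have eF : qe i * F i = (v ^+ 2) *: (F i * qe i).
  by have := @qe_F_comm i i; rewrite eq_sym ti => /(_ isT); rewrite qdot_diag.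
have Fe : F i * qe i = v ^- 2 *: (qe i * F i) by rewrite eF scalerA mulVf // scale1r.
have FkV : F i * qkV j = (v ^+ a) *: (qkV j * F i).
  by rewrite F_qkV qdotC vd invrK.
have s'0 : sexp v^-1 a 0 = v ^+ a by rewrite sexp0 exprVn invrK.
rewrite !qB_E ki scale0r addr0 /cont0 !contD [in X in _ + X + _]/(qe j) !contZ -!/(cont0 _ _ _ _).
have -> : cont0 (F i + qe i) (sexp v a) a.+1 (F j) = 0.
  rewrite (cont0_chain _ eF _ sF) ?qserreF //.
  by rewrite sexp0 -vd qe_F_comm.
(* Reversal inverts v, which is the twist required for eliminating F_i instead of [qe i]. *)
have chainE x0 : F i * x0 = (v ^+ a) *: (x0 * F i) ->
    cont0 (F i + qe i) (sexp v a) a.+1 x0 = cont0 (qe i) (sexp v^-1 a) a.+1 x0.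
  move=> Fx0; rewrite cont0_revV // [F i + qe i]addrC.
  by rewrite (cont0_chain _ Fe _ sE) ?s'0.
rewrite add0r !chainE //; last first.
  by rewrite mulrA -qEFC ?(inv_eq (tauK t)) // -mulrA FkV -scalerAr mulrA.
rewrite EkV_kill // scaler0 add0r.
have [->|kj0] := eqVneq (kappa j) 0; first by rewrite scale0r.
have Ek : qcommutes (v ^+ a)^-1 (E (tau i)) (qkV j).
  by rewrite -vd qdotC -[qdot j i]qdot_tau (kj kj0); apply: E_qkV.
have ek : qcommutes (v ^+ a)^-1 (qe i) (qkV j).
  apply: qcommutesZl; rewrite -[(v ^+ a)^-1]mulr1.
  exact: (qcommutesMl Ek (qcommutes1 (qKC K (- hK D i) (- hK D j)))).
have v'0 : v^-1 != 0 by rewrite invr_eq0; exact: v0.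
have s'a : sexp v^-1 a a = (v ^+ a)^-1 by rewrite (sexpa v'0) exprVn.
by rewrite (cont0_kill ek (ltnSn a) s'a) scaler0.
Qed.

(** The bracket of [qe i] with F_i is now nonzero, and the d-terms compensate it on F_j and on the
    E-part of B_j. The part kappa_j K_j^-1 is settled by [cont_torus], which is where an even a_ij
    and 2 != 0 are needed. *)
Lemma cont_qB_tau_eq i j : tau i = i -> i != j -> (2 : Kq K) != 0 -> varsigma i != 0 ->
  (kappa j != 0 -> tau j = j /\ ~~ odd (a_ i j)) ->
  cont (B i) (sexp (q_ i) (a_ i j)) (dcoef (q_ i) (a_ i j) (varsigma i)) 0 (a_ i j).+1 (B j) = 0.
Proof.
move=> ti ne two_neq0 vs0 kj.
set v := q_ i; set a := a_ i j; set vs := varsigma i.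
have v0 : v != 0 by apply: q_i_neq0.
have vn1 : forall n, (0 < n)%N -> v ^+ n != 1 by move=> n; apply: q_i_expn_neq1.
have v2 : v ^+ 2 != 0 by rewrite expf_neq0.
have vd : qdot i j = (v ^+ a)^-1 by rewrite (qdot_offdiag K D).
have vd' : qdot i (tau j) = (v ^+ a)^-1 by rewrite -vd -qdot_tau tauK ti.
have sE m : sexp v^-1 a m.+1 = v ^- 2 * sexp v^-1 a m by rewrite sexpS exprVn.
have sF m : sexp v a m.+1 = v ^+ 2 * sexp v a m by rewrite sexpS.
have s'0 : sexp v^-1 a 0 = v ^+ a by rewrite sexp0 exprVn invrK.
have [g gE] : exists g, g = vs * v ^+ 2 / (v - v^-1) by eexists.
have kF : qkV i * F i = (v ^+ 2) *: (F i * qkV i) by rewrite qkVF qdot_diag.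
have kE : qkV i * E i = v ^- 2 *: (E i * qkV i) by rewrite qkVE qdot_diag.
have ke : qkV i * qe i = v ^- 2 *: (qe i * qkV i).
  by rewrite /qe ti -scalerAr mulrA kE -!scalerAl scalerA mulrC -scalerA.
have eF : qe i * F i = (v ^+ 2) *: (F i * qe i) + g *: (1 - qkV i ^+ 2).
  have kk : qk i * qkV i = 1 by apply: qKV.
  rewrite /qe ti -scalerAl -mulrA kF -scalerAr mulrA qEF eqxx mulrDl -!scalerAl mulrBl kk.
  rewrite -expr2 -scalerAr mulrA gE; lin_split (Kq K); rewrite -/v -/vs; ring.
have Fe : F i * qe i = v ^- 2 *: (qe i * F i) + (- (v ^- 2 * g)) *: (1 - qkV i ^+ 2).
  by rewrite eF scalerDr !scalerA (mulVf v2) scale1r scaleNr addrK.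
have FkV : F i * qkV j = (v ^+ a) *: (qkV j * F i) by rewrite F_qkV qdotC vd invrK.
rewrite qB_E (qB_E j) !contD [in X in _ + X + _]/(qe j) !contZ.
have -> : cont (F i + qe i + kappa i *: qkV i) (sexp v a) (dcoef v a vs) 0 a.+1 (F j) = 0.
  have kFj : qkV i * F j = sexp v a 0 *: (F j * qkV i) by rewrite sexp0 -vd; apply: qkVF.
  have eFj : qe i * F j = sexp v a 0 *: (F j * qe i).
    by rewrite sexp0 -vd; apply: qe_F_comm; rewrite ti eq_sym.
  have dS m : dcoef v a vs m.+1 = v ^+ 2 * dcoef v a vs m + g * (1 - sexp v a m ^+ 2).
    by rewrite gE; apply: dcoefS.
  by rewrite (cont_chain _ eF kF kFj eFj sF (dcoef0 _ _ _) dS); apply: qserreF.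
rewrite add0r !(cont_revV v0 vn1).
have -> : cont (F i + qe i + kappa i *: qkV i) (sexp v^-1 a) (dcoef v^-1 a (vs * v ^+ 2))
    0 a.+1 (E (tau j) * qkV j) = 0.
  have kx : qkV i * (E (tau j) * qkV j) = sexp v^-1 a 0 *: (E (tau j) * qkV j * qkV i).
    by rewrite mulrA qkVE vd' invrK -scalerAl -!mulrA (qKC K) s'0.
  have Fx : F i * (E (tau j) * qkV j) = sexp v^-1 a 0 *: (E (tau j) * qkV j * F i).
    have ne' : tau j != i by rewrite (inv_eq (tauK t)) ti eq_sym.
    by rewrite mulrA -(qEFC K D ne') -mulrA FkV -scalerAr mulrA s'0.
  have dS m : dcoef v^-1 a (vs * v ^+ 2) m.+1 =
      v ^- 2 * dcoef v^-1 a (vs * v ^+ 2) m + - (v ^- 2 * g) * (1 - sexp v^-1 a m ^+ 2).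
    by rewrite gE; apply: dcoefS_inv.
  rewrite [F i + qe i]addrC (cont_chain _ Fe ke kx Fx sE (dcoef0 _ _ _) dS).
  exact: EkV_kill.
rewrite scaler0 add0r.
have [->|kj0] := eqVneq (kappa j) 0; first by rewrite scale0r.
have [tj even_a] := kj kj0.
have Ek : qcommutes (v ^+ a)^-1 (E (tau i)) (qkV j).
  by rewrite -vd qdotC -[qdot j i]qdot_tau tj; apply: E_qkV.
have ek : qcommutes (v ^+ a)^-1 (qe i) (qkV j).
  apply: qcommutesZl; rewrite -[(v ^+ a)^-1]mulr1.
  exact: (qcommutesMl Ek (qcommutes1 (qKC K (- hK D i) (- hK D j)))).
rewrite gE in eF.
by rewrite (cont_torus v0 vn1 (kappa i) eF kF ke FkV ek (qKC K _ _) two_neq0 vs0 even_a) scaler0.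
Qed.

(* The coefficients of the two lower terms B_i^a K_{j,i} and B_i^a K_{i,j} of the
   relation between B_i and B_(tau i), where a = - a_{i, tau i}. *)
Definition mixed_coef (v : Kq K) (a : nat) (c : Kq K) : Kq K :=
  c / (v - v^-1) * \prod_(l < a) (1 - (v ^+ l.+2) ^+ 2).

(** The summand F_j yields the term in K_j K_i^-1. The E-summand, after reversal and with F_i and
    [qe i] exchanged, is the same computation with v inverted and yields the term in K_i K_j^-1. *)
Lemma cont0_qB_mixed i (j := tau i) : j != i -> kappa i = 0 -> kappa j = 0 ->
  (a_ i j = 0%N -> varsigma i = varsigma j) ->
  let a := a_ i j in let v := q_ i in
  cont0 (B i) (sexp v a) a.+1 (B j) =
    mixed_coef v a (varsigma i / v ^+ a) *: (B i ^+ a * qK K (hK D j - hK D i)) +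
    mixed_coef v^-1 a (varsigma j) *: (B i ^+ a * qK K (hK D i - hK D j)).
Proof.
move=> ji ki kj vs_eq a v.
have ne : i != j by rewrite eq_sym.
have tj : tau j = i by apply: tauK.
have v0 : v != 0 by apply: q_i_neq0.
have vn1 : forall n, (0 < n)%N -> v ^+ n != 1 by move=> n; apply: q_i_expn_neq1.
have v2 : v ^+ 2 != 0 by apply: expf_neq0.
have v0' : v^-1 != 0 by rewrite invr_eq0; exact: v0.
have v21 : 1 - v ^+ 2 != 0 by rewrite subr_eq0 eq_sym; apply: vn1.
have v21' : 1 - v^-1 ^+ 2 != 0 by rewrite subr_eq0 eq_sym exprVn invr_eq1; apply: vn1.
have vd : qdot i j = (v ^+ a)^-1 by rewrite (qdot_offdiag K D).
have vdj : qdot j j = v ^+ 2 by rewrite qdot_diag q_i_tau.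
have vdi : qdot i i = v ^+ 2 by rewrite qdot_diag.
have vdC : qdot j i = (v ^+ a)^-1 by rewrite qdotC.
have eF : qcommutes (v ^+ 2) (qe i) (F i) by rewrite -vdi; apply: qe_F_comm; rewrite eq_sym.
have Fe : qcommutes (v^-1 ^+ 2) (F i) (qe i).
  by rewrite exprVn; apply: qcommutesV; [exact: v2 | exact: eF].
have qe_E : qe i = varsigma i *: (E j * qkV i) by [].
have qe_Ej : qe j = varsigma j *: (E i * qkV j) by rewrite /qe tj.
have kk1 : qK K (hK D j - hK D i) = qk j * qkV i by rewrite qKD.
have kk2 : qK K (hK D i - hK D j) = qk i * qkV j by rewrite qKD.
have va0 : v ^+ a != 0 by apply: expf_neq0; exact: v0.
have XkV l l' : qcommutes 1 (qk l * qkV l') (qkV i).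
  by apply: qcommutes1; rewrite qKD qKC.
have VkV l l' : qcommutes 1 (qkV l * qkV l') (qkV i).
  by apply: qcommutes1; rewrite qKD qKC.
have H1 : cont0 (F i + qe i) (sexp v a) a.+1 (F j) =
    (varsigma i / v ^+ a / (v - v^-1) * \prod_(l < a) (1 - (v ^+ l.+2) ^+ 2)) *:
      ((F i + qe i) ^+ a * (qk j * qkV i))
    - (if a == 0%N then varsigma i / v ^+ a / (v - v^-1) else 0) *: (qkV j * qkV i).
  apply: cont0_mixed; [exact: v0 | exact: v21 | exact: eF | | | | | | exact: qserreF].
  - rewrite sexp0 qe_E -!scalerAl -!scalerAr -(mulrA (E j)) qkVF vd -scalerAr !mulrA qEF eqxx q_i_tau.
    by rewrite mulrDl -scalerAl mulrBl -/v; lin_split (Kq K); ring.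
  - by have := qcommutesMl (qkF K D j i) (qkVF K D i i); rewrite vdC vdi invrK.
  - have := qcommutesMr (qcommutesMl (qkE K D j j) (qkVE K D i j)) (XkV _ _).
    by rewrite vdj vd invrK mulr1 [v ^+ 2 * _]mulrC; apply: qcommutesZr.
  - by have := qcommutesMl (qkVF K D j i) (qkVF K D i i); rewrite vdC vdi mulrC.
  - have := qcommutesMr (qcommutesMl (qkVE K D j j) (qkVE K D i j)) (VkV _ _).
    by rewrite vdj vd invrK mulr1 [v ^- 2 * _]mulrC; apply: qcommutesZr.
have absorb (Z : U) : v ^+ a *: (varsigma j *: (v ^- a *: Z)) = varsigma j *: Z.
  by rewrite !scalerA [v ^+ a * _]mulrC -mulrA (divff va0) mulr1.
have H2 : cont0 (qe i + F i) (sexp v^-1 a) a.+1 (qe j) =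
    (- (varsigma j / (v - v^-1)) * \prod_(l < a) (1 - (v^-1 ^+ l.+2) ^+ 2)) *:
      ((qe i + F i) ^+ a * (qk i * qkV j))
    - (if a == 0%N then - (varsigma j / (v - v^-1)) else 0) *: (qkV i * qkV j).
  apply: cont0_mixed; [exact: v0' | exact: v21' | exact: Fe | | | | | | ].
  - rewrite sexp0 exprVn invrK qe_Ej -!scalerAl -!scalerAr -(mulrA (E i)) qkVF vdC -!scalerAr.
    rewrite !mulrA qEF eqxx mulrDl -!scalerAl mulrBl -/v.
    by rewrite absorb; lin_split (Kq K); ring.
  - have := qcommutesMr (qcommutesMl (qkE K D i j) (qkVE K D j j)) (XkV _ _).
    by rewrite vdj vd mulr1 !exprVn; apply: qcommutesZr.
  - by have := qcommutesMl (qkF K D i i) (qkVF K D j i); rewrite vdC vdi !exprVn mulrC.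
  - have := qcommutesMr (qcommutesMl (qkVE K D i j) (qkVE K D j j)) (VkV _ _).
    by rewrite vdj vd mulr1 !exprVn [_^-1 * _]mulrC; apply: qcommutesZr.
  - by have := qcommutesMl (qkVF K D i i) (qkVF K D j i); rewrite vdC vdi !exprVn invrK mulrC.
  - by rewrite qe_Ej /cont0 contZ; have := EkV_kill ne; rewrite tj /cont0 => ->; rewrite scaler0.
rewrite (qB_E i) (qB_E j) ki kj !scale0r !addr0 /cont0 contD -!/(cont0 _ _ _ _) H1.
rewrite (cont0_revV v0) [F i + qe i]addrC H2 kk1 kk2 (qKC K (- hK D i)).
have e1 : mixed_coef v a (varsigma i / v ^+ a) =
  varsigma i / v ^+ a / (v - v^-1) * \prod_(l < a) (1 - (v ^+ l.+2) ^+ 2) by [].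
have e2 : mixed_coef v^-1 a (varsigma j) =
    - (varsigma j / (v - v^-1)) * \prod_(l < a) (1 - (v^-1 ^+ l.+2) ^+ 2).
  by rewrite /mixed_coef invrK -[v^-1 - v]opprB invrN mulrN.
(* The terms in K_i^-1 K_j^-1 occur only for a = 0, where varsigma_i = varsigma_j makes them
   cancel. *)
rewrite e1 e2 addrACA -[RHS]addr0; congr (_ + _).
case: (eqVneq a 0%N) => [a0|_]; last by rewrite !scale0r oppr0 addr0.
by rewrite (vs_eq a0) a0 expr0 divr1 -opprD -scalerDl subrr scale0r oppr0.
Qed.

End IotaRelations.

(** * Filtration by word length *)

Section Filtration.
Variables (F : fieldType) (A : algType F) (I : Type) (Z : zmodType).
Variables (b : I -> A) (k : Z -> A) (c : Z -> I -> F).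

Definition bword (w : seq I) : A := \prod_(i <- w) b i.

Inductive span_lt (n : nat) : A -> Prop :=
| span_lt0 : span_lt n 0
| span_lt_cons r z w x : (size w < n)%N -> span_lt n x ->
    span_lt n (r *: (k z * bword w) + x).

Lemma span_ltD n x y : span_lt n x -> span_lt n y -> span_lt n (x + y).
Proof.
move=> Sx Sy; elim: Sx => [|r z w x' lt_w _ IH]; first by rewrite add0r.
by rewrite -addrA; apply: span_lt_cons.
Qed.

Lemma span_ltZ n r x : span_lt n x -> span_lt n (r *: x).
Proof.
elim=> [|s z w x' lt_w _ IH]; first by rewrite scaler0; apply: span_lt0.
by rewrite scalerDr scalerA; apply: span_lt_cons.
Qed.

Lemma span_ltN n x : span_lt n x -> span_lt n (- x).
Proof. by rewrite -scaleN1r; apply: span_ltZ. Qed.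

Lemma span_ltB n x y : span_lt n x -> span_lt n y -> span_lt n (x - y).
Proof. by move=> Sx Sy; apply/span_ltD/span_ltN. Qed.

Lemma span_lt_sum n (T : Type) (s : seq T) (f : T -> A) :
  (forall i, span_lt n (f i)) -> span_lt n (\sum_(i <- s) f i).
Proof.
move=> Sf; elim: s => [|i s IH]; first by rewrite big_nil; apply: span_lt0.
by rewrite big_cons; apply: span_ltD.
Qed.

Lemma span_ltW m n x : (m <= n)%N -> span_lt m x -> span_lt n x.
Proof.
move=> le_mn; elim=> [|r z w x' lt_w _ IH]; first exact: span_lt0.
by apply: span_lt_cons => //; apply: leq_trans le_mn.
Qed.

Lemma span_lt_word n z w : (size w < n)%N -> span_lt n (k z * bword w).
Proof.
move=> lt_w; rewrite -[k z * _]scale1r -[_ *: _]addr0.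
by apply: span_lt_cons => //; apply: span_lt0.
Qed.

Lemma span_lt_eq0 x : span_lt 0 x -> x = 0.
Proof. by case. Qed.

Hypotheses (k0 : k 0 = 1) (kD : forall z z', k z * k z' = k (z + z')).
Hypothesis bk : forall i z, b i * k z = c z i *: (k z * b i).

Lemma bword_cons i w : bword (i :: w) = b i * bword w.
Proof. by rewrite /bword big_cons. Qed.

Lemma span_lt_bword n w : (size w < n)%N -> span_lt n (bword w).
Proof. by move=> lt_w; rewrite -[bword w]mul1r -k0; apply: span_lt_word. Qed.

(** Degree is measured by the effect of left multiplication on the filtration, which makes it
    additive under products without any reordering of words. *)
Definition deg_le (m : nat) (x : A) := forall n y, span_lt n y -> span_lt (n + m) (x * y).

Lemma deg_leM m n x y : deg_le m x -> deg_le n y -> deg_le (m + n) (x * y).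
Proof. by move=> dx dy p z /dy/dx; rewrite -mulrA -addnA (addnC n). Qed.

Lemma deg_leD m x y : deg_le m x -> deg_le m y -> deg_le m (x + y).
Proof. by move=> dx dy p z Sz; rewrite mulrDl; apply: span_ltD; [apply: dx | apply: dy]. Qed.

Lemma deg_leZ m r x : deg_le m x -> deg_le m (r *: x).
Proof. by move=> dx p z Sz; rewrite -scalerAl; apply/span_ltZ/dx. Qed.

Lemma deg_leN m x : deg_le m x -> deg_le m (- x).
Proof. by rewrite -scaleN1r; apply: deg_leZ. Qed.

Lemma deg_leB m x y : deg_le m x -> deg_le m y -> deg_le m (x - y).
Proof. by move=> dx dy; apply/deg_leD/deg_leN. Qed.

Lemma deg_leW m n x : (m <= n)%N -> deg_le m x -> deg_le n x.
Proof. by move=> le_mn dx p z /dx; apply: span_ltW; rewrite leq_add2l. Qed.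

Lemma deg_le0 m : deg_le m 0.
Proof. by move=> p z _; rewrite mul0r; apply: span_lt0. Qed.

Lemma deg_le1 : deg_le 0 1.
Proof. by move=> p z; rewrite mul1r addn0. Qed.

Lemma deg_le_k z : deg_le 0 (k z).
Proof.
move=> n y Sy; rewrite addn0; elim: Sy => [|r z' w x' lt_w _ IH].
  by rewrite mulr0; apply: span_lt0.
rewrite mulrDr -scalerAr mulrA kD; exact: span_lt_cons.
Qed.

Lemma deg_le_b i : deg_le 1 (b i).
Proof.
move=> n y Sy; rewrite addn1; elim: Sy => [|r z w x' lt_w _ IH].
  by rewrite mulr0; apply: span_lt0.
rewrite mulrDr -scalerAr mulrA bk -scalerAl scalerA -mulrA -bword_cons.
exact: span_lt_cons.
Qed.

Lemma deg_le_bword w : deg_le (size w) (bword w).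
Proof.
elim: w => [|i w IH]; first by rewrite /bword big_nil; apply: deg_le1.
by rewrite bword_cons; apply: (@deg_leM 1); first exact: deg_le_b.
Qed.

Lemma span_lt_deg n x : span_lt n x -> deg_le n x.
Proof.
elim=> [|r z w x' lt_w _ IH]; first exact: deg_le0.
apply: deg_leD => //; apply: deg_leZ; apply: (@deg_leM 0 n); first exact: deg_le_k.
by apply: deg_leW (deg_le_bword w); apply: ltnW.
Qed.

Lemma span_ltM m n x y : span_lt m x -> span_lt n y -> span_lt (n + m) (x * y).
Proof. by move/span_lt_deg => dx /dx. Qed.

Lemma deg_le_qcomm m i s x : deg_le m x -> deg_le m.+1 (qcomm (b i) s x).
Proof.
move=> dx; rewrite qcommE; apply: deg_leB; first exact: (deg_leM (deg_le_b i)).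
by apply: deg_leZ; rewrite -addn1; apply: deg_leM => //; apply: deg_le_b.
Qed.

Lemma deg_le_cont i s d l m n x : deg_le n x -> deg_le (m + n) (cont (b i) s d l m x).
Proof.
move=> dx; elim/ltn_ind: m => [[|[|m]] IH]; first by rewrite cont_0.
  by rewrite cont_1; apply: deg_le_qcomm.
rewrite cont_SS; apply: deg_leB; first by apply: deg_le_qcomm; apply: (IH m.+1).
by apply: deg_leZ; apply: deg_leW (IH m _); lia.
Qed.

(** The truncation differs from the vanishing continuant only by d-terms, in each of which a scalar
    replaces two factors b_i. *)
Lemma deg_le_cont0 i j s d m :
  cont (b i) s d 0 m (b j) = 0 -> deg_le m (cont0 (b i) s m (b j)).
Proof.
move=> rel; rewrite -[cont0 _ _ _ _]subr0 -rel.
elim/ltn_ind: m {rel} => [[|[|m]] IH].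
- by rewrite cont0_0 cont_0 subrr; apply: deg_le0.
- by rewrite cont0_S cont0_0 cont_1 subrr; apply: deg_le0.
- rewrite cont0_S cont_SS opprB addrCA -qcommB addrC; apply: deg_leD.
    by apply: deg_le_qcomm; apply: IH.
  apply: deg_leZ; apply: deg_leW (deg_le_cont _ _ _ _ _ (deg_le_b j)); lia.
Qed.

End Filtration.

(** * Scalars acting through the bar automorphism *)

Definition twisted (K : fieldType) (A : algType (Kq K)) : Type := A.

HB.lock Definition twisted_scale (K : fieldType) (A : algType (Kq K)) (c : Kq K)
  (x : twisted A) : twisted A := bar c *: (x : A).

Section Twisted.
Variables (K : fieldType) (A : algType (Kq K)).

HB.instance Definition _ := GRing.NzRing.copy (twisted A) A.

Fact twisted_scaleE c x : twisted_scale c x = bar c *: (x : A) :> A.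
Proof. by rewrite twisted_scale.unlock. Qed.

Fact twisted_scaleA a b (x : twisted A) :
  twisted_scale a (twisted_scale b x) = twisted_scale (a * b) x.
Proof. by rewrite !twisted_scaleE scalerA (rmorphM (@bar K)). Qed.
Fact twisted_scale1 : left_id 1 (@twisted_scale K A).
Proof. by move=> x; rewrite twisted_scaleE (rmorph1 (@bar K)) scale1r. Qed.
Fact twisted_scaleDr : right_distributive (@twisted_scale K A) +%R.
Proof. by move=> c x y; rewrite !twisted_scaleE; apply: (@scalerDr _ A). Qed.
Fact twisted_scaleDl (x : twisted A) : {morph (@twisted_scale K A)^~ x : a b / a + b}.
Proof. by move=> a b; rewrite !twisted_scaleE (rmorphD (@bar K)); apply: (@scalerDl _ A). Qed.

HB.instance Definition _ := GRing.Zmodule_isLmodule.Build (Kq K) (twisted A)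
  twisted_scaleA twisted_scale1 twisted_scaleDr twisted_scaleDl.

Fact twisted_scaleAl (c : Kq K) (x y : twisted A) : c *: (x * y) = c *: x * y.
Proof.
rewrite -[LHS]/(twisted_scale c (x * y)) -[c *: x]/(twisted_scale c x) !twisted_scaleE.
exact: (@scalerAl _ A).
Qed.
HB.instance Definition _ := GRing.Lmodule_isLalgebra.Build (Kq K) (twisted A) twisted_scaleAl.

Fact twisted_scaleAr (c : Kq K) (x y : twisted A) : c *: (x * y) = x * (c *: y).
Proof.
rewrite -[LHS]/(twisted_scale c (x * y)) -[c *: y]/(twisted_scale c y) !twisted_scaleE.
exact: (@scalerAr _ A).
Qed.
HB.instance Definition _ := GRing.Lalgebra_isAlgebra.Build (Kq K) (twisted A) twisted_scaleAr.

Lemma scale_twisted c (x : twisted A) : c *: x = bar c *: (x : A) :> A.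
Proof. by rewrite -[LHS]/(twisted_scale c x) twisted_scaleE. Qed.

Lemma qcomm_twisted (b x : twisted A) r : qcomm b r x = qcomm (b : A) (bar r) x :> A.
Proof. by rewrite !qcommE; congr (_ - _); apply: scale_twisted. Qed.

Lemma cont_twisted (b x : twisted A) s d l m :
  cont b s d l m x = cont (b : A) (bar (K:=K) \o s) (bar (K:=K) \o d) l m x :> A.
Proof.
elim/ltn_ind: m => [[|[|m]] IH]; first by rewrite !cont_0.
  by rewrite !cont_1; apply: qcomm_twisted.
rewrite !cont_SS -IH // -[cont (b : A) _ _ l m x]IH //.
congr (_ - _); [exact: qcomm_twisted | exact: scale_twisted].
Qed.

End Twisted.

Section PairComponents.
Variables (F : fieldType) (A B : algType F).

Lemma cont_fst (b x : A * B) s d l m : (cont b s d l m x).1 = cont b.1 s d l m x.1.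
Proof.
have qfst r (y : A * B) : (qcomm b r y).1 = qcomm b.1 r y.1 by rewrite !qcommE.
elim/ltn_ind: m => [[|[|m]] IH]; first by rewrite !cont_0.
  by rewrite !cont_1.
by rewrite !cont_SS /= qfst !IH.
Qed.

Lemma cont_snd (b x : A * B) s d l m : (cont b s d l m x).2 = cont b.2 s d l m x.2.
Proof.
have qsnd r (y : A * B) : (qcomm b r y).2 = qcomm b.2 r y.2 by rewrite !qcommE.
elim/ltn_ind: m => [[|[|m]] IH]; first by rewrite !cont_0.
  by rewrite !cont_1.
by rewrite !cont_SS /= qsnd !IH.
Qed.

End PairComponents.

(** * The graph of the bar involution *)

Section BarCoefficients.
Variables (K : fieldType) (I : finType) (C : cartan_datum I).

Local Notation bar := (@bar K).
Local Notation q_ := (q_ K C).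

Lemma barV x : bar x^-1 = (bar x)^-1. Proof. exact: (fmorphV bar). Qed.
Lemma barX x n : bar (x ^+ n) = bar x ^+ n. Proof. exact: (rmorphXn bar). Qed.
Lemma barM x y : bar (x * y) = bar x * bar y. Proof. exact: (rmorphM bar). Qed.
Lemma barB x y : bar (x - y) = bar x - bar y. Proof. exact: (rmorphB bar). Qed.

Lemma bar_q_ i : bar (q_ i) = (q_ i)^-1.
Proof. by rewrite /Defs.q_ barX bar_q exprVn. Qed.

Lemma bar_sexp v a m : bar v = v^-1 -> bar (sexp v a m) = sexp v^-1 a m.
Proof. by move=> bv; rewrite !sexpE barM barV !barX bv. Qed.

Lemma bar_dcoef v a eta m : bar v = v^-1 -> bar (dcoef v a eta m) = dcoef v^-1 a (bar eta) m.
Proof.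
by move=> bv; rewrite !dcoef.unlock !(barM, barB, barV, barX) bar_sexp // !bv.
Qed.

Lemma bar_mixed_coef v a c : bar v = v^-1 -> bar (mixed_coef v a c) = mixed_coef v^-1 a (bar c).
Proof.
move=> bv; rewrite /mixed_coef barM (rmorph_prod bar) !(barM, barB, barV, barX) !bv.
by congr (_ * _); apply: eq_bigr => l _; rewrite (rmorphB bar) (rmorph1 bar) !(rmorphXn bar) /= bv.
Qed.

Lemma bar_exprz (x : int) : bar (@q K ^ x) = (@q K) ^ (- x).
Proof.
case: x => n; first by rewrite -exprnP barX bar_q exprVn exprnN.
by rewrite NegzE -!exprnN opprK barV barX bar_q exprVn invrK.
Qed.

End BarCoefficients.

(** * Serre elements in the double algebra *)

Section DoubleAlgebra.
Variables (K : fieldType) (charK0 : [pchar K] =i pred0).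
Variables (I : finType) (C : cartan_datum I) (D : root_datum C) (t : diagram_involution D).
Variables (varsigma kappa : I -> Kq K) (Hpar : iqg_parameters t varsigma kappa).

Local Notation q := (@q K).
Local Notation q_ := (q_ K C).
Local Notation U := (qg K D).
Local Notation a_ := (neg_cartan D).
Local Notation alpha := (Defs.root D).
Local Notation tau := (tau t).
Local Notation B := (qB t varsigma kappa).

Hypothesis Ha : forall i, tau i = i -> (exists2 j, j != i & cartan_entry D i j <> 0) ->
  bar (varsigma i * q_ i) = varsigma i * q_ i.
Hypothesis Hb : forall i, tau i <> i -> cartan_entry D i (tau i) = 0 ->
  bar (varsigma i) = varsigma i /\ varsigma i = varsigma (tau i).
Hypothesis Hc : forall i, tau i <> i -> cartan_entry D i (tau i) <> 0 ->
  varsigma (tau i) = q_ i ^ (- cartan_entry D i (tau i)) * bar (varsigma i).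

Definition dbl : algType (Kq K) := (U * twisted U)%type.

Definition db (i : I) : dbl := (B i, B i : twisted U).
Definition dk (mu : Yi t) : dbl := (qK K (val mu), qK K (- val mu) : twisted U).

Lemma dk0 : dk 0 = 1.
Proof. by congr pair; rewrite ?oppr0; apply: qK0. Qed.

Lemma dkD mu nu : dk mu * dk nu = dk (mu + nu).
Proof. by congr pair; rewrite /= ?opprD; apply: qKD. Qed.

Lemma pairing_tau_root (mu : Yi t) i :
  pairing (val mu) (alpha (tau i)) = - pairing (val mu) (alpha i).
Proof.
have /eqP mu_tau : tauY t (val mu) == - val mu := valP mu.
by rewrite -pairingNl -mu_tau -[RHS](tau_pairing t) tauYK tauX_root.
Qed.

Lemma qK_qB (mu : Yi t) i :
  qcommutes (q ^ (- pairing (val mu) (alpha i))) (qK K (val mu)) (B i).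
Proof.
have qe_c : qcommutes (q ^ (- pairing (val mu) (alpha i))) (qK K (val mu)) (qe t varsigma i).
  apply: qcommutesZr; rewrite -pairing_tau_root -[q ^ _]mulr1.
  exact: (qcommutesMr (qKE K _ _) (qcommutes1 (qKC K _ _))).
have kV_c : qcommutes (q ^ (- pairing (val mu) (alpha i))) (qK K (val mu)) (kappa i *: qkV K D i).
  have [k0|k0] := eqVneq (kappa i) 0.
    by rewrite k0 scale0r /qcommutes mulr0 mul0r scaler0.
  have [_ kap0 _] := Hpar.
  have [|nti] := EM (tau i = i /\
    forall k, tau k = k -> (2 %| pairing (coroot D k) (Defs.root D i))%Z); last first.
    by rewrite (kap0 _ nti) eqxx in k0.
  (* For tau i = i the pairing of mu with alpha_i equals its negative, hence is 0. So K_mu commutes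
     with the term kappa_i K_i^-1 and still satisfies the weight relation. *)
  case=> ti _; have := pairing_tau_root mu i; rewrite ti => /eqP.
  rewrite -subr_eq0 opprK -mulr2n mulrn_eq0 /= => /eqP ->.
  by rewrite oppr0 expr0z; apply: qcommutesZr; apply: qcommutes1; apply: qKC.
rewrite qB_E /qcommutes !mulrDr !mulrDl !scalerDr (qKF K (val mu) i).
by congr (_ + _ + _); [exact: qe_c | exact: kV_c].
Qed.

Lemma qKN_qB (mu : Yi t) i :
  qcommutes (q ^ pairing (val mu) (alpha i)) (qK K (- val mu)) (B i).
Proof. by have := qK_qB (- mu) i; rewrite /= pairingNl opprK. Qed.

Lemma db_dk i mu :
  db i * dk mu = q ^ pairing (val mu) (alpha i) *: (dk mu * db i).
Proof.
congr pair.
  rewrite -[RHS]/(q ^ pairing (val mu) (alpha i) *: (qK K (val mu) * B i)) qK_qB.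
  by rewrite scalerA -expfzDr ?q_neq0 // subrr expr0z scale1r.
(* K at -mu has the inverse weight, but scalars of the second factor act through bar, so both
   components obey the same relation. *)
rewrite -[RHS]/(q ^ pairing (val mu) (alpha i) *: ((qK K (- val mu) * B i) : twisted U)).
rewrite scale_twisted qKN_qB bar_exprz scalerA -expfzDr ?q_neq0 // addNr expr0z.
by rewrite scale1r.
Qed.

Local Notation span := (span_lt db dk).
Local Notation deg := (deg_le db dk).

Lemma two_neq0 : (2 : Kq K) != 0.
Proof.
have two_K : (2 : K) != 0 by have := charK0 2; rewrite inE /= => /negbT.
by rewrite -(rmorph_nat (@Kq_const K)) fmorph_eq0.
Qed.

Lemma db_qserre_deg i j : i != j ->
  deg (a_ i j).+1 (cont0 (db i) (sexp (q_ i) (a_ i j)) (a_ i j).+1 (db j)).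
Proof.
move=> ne; have [vs0 kap0 vs_tau] := Hpar.
set v := q_ i; set a := a_ i j.
have v0 : v != 0 by apply: q_i_neq0.
have vn1 : forall n, (0 < n)%N -> v ^+ n != 1 by move=> n; apply: q_i_expn_neq1.
have bv : bar v = v^-1 by apply: bar_q_.
have kap l : kappa l != 0 -> tau l = l /\
    forall k, tau k = k -> (2 %| pairing (coroot D k) (Defs.root D l))%Z.
  move=> k0; have [//|nk] := EM (tau l = l /\
    forall k, tau k = k -> (2 %| pairing (coroot D k) (Defs.root D l))%Z).
  by rewrite (kap0 _ nk) eqxx in k0.
have bs (k : nat) : bar (sexp v a k) = sexp v^-1 a k by apply: bar_sexp.
have pair0 (x : dbl) : x.1 = 0 -> x.2 = 0 :> U -> x = 0 by case: x => x1 x2 /= -> ->.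
have [ti|ti] := eqVneq (tau i) i.
  have kj : kappa j != 0 -> tau j = j /\ ~~ odd a.
    move=> /kap[tj even_j]; split=> //.
    have := even_j i ti; rewrite -/(cartan_entry D i j) (cartanE D ne) -/a dvdzE /= abszN.
    by rewrite absz_nat dvdn2.
  have rel := @cont_qB_tau_eq K I C D t varsigma kappa i j ti ne two_neq0 (vs0 i) kj.
  apply: (deg_le_cont0 db_dk (d := dcoef v a (varsigma i))).
  apply: pair0; first by rewrite cont_fst; exact: rel.
  rewrite cont_snd cont_twisted /= -[RHS]rel (cont_revV v0 vn1).
  apply: eq_cont => k; rewrite add0n => lt_k; first exact: bs.
  (* The coefficients d enter only at indices 0 < k < a + 1. So a is positive and a_ij nonzero, as
     condition (a) requires. *)
  have a0 : a != 0%N by apply/eqP => a0; move: lt_k; rewrite a0; case: k => [|[]].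
  rewrite /= bar_dcoef //; congr dcoef.
  have vs_bar : bar (varsigma i * v) = varsigma i * v.
    apply: (Ha ti); exists j; first by rewrite eq_sym.
    by move=> c0; rewrite /a /neg_cartan c0 in a0.
  rewrite barM bv in vs_bar; rewrite expr2 mulrA -vs_bar -mulrA mulVf ?mulr1 //.
have ki : kappa i = 0.
  by have [//|/kap[ti' _]] := eqVneq (kappa i) 0; rewrite ti' eqxx in ti.
have [def_j|jti] := eqVneq j (tau i); last first.
  have kj : kappa j != 0 -> tau j = j by case/kap.
  have rel := @cont0_qB_tau_neq K I C D t varsigma kappa i j ti ne jti ki kj.
  apply: (deg_le_cont0 db_dk (d := fun=> 0)).
  apply: pair0; first by rewrite cont_fst; exact: rel.
  rewrite cont_snd cont_twisted /= -[RHS]rel (cont0_revV v0).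
  apply: eq_cont => k; rewrite add0n => lt_k; first exact: bs.
  by rewrite /= (rmorph0 (@bar K)).
have kj : kappa j = 0.
  have [//|/kap[tj _]] := eqVneq (kappa j) 0.
  by rewrite -(inj_eq (@tau_inj _ _ _ t)) -def_j tj eqxx in ti.
have ji : tau i != i := ti.
rewrite def_j in kj ne *.
have aE : a = a_ i (tau i) by rewrite /a def_j.
have cartan0 : a = 0%N -> cartan_entry D i (tau i) = 0.
  by rewrite aE /neg_cartan => /eqP; rewrite absz_eq0 => /eqP.
have vs_eq : a_ i (tau i) = 0%N -> varsigma i = varsigma (tau i).
  by rewrite -aE => /cartan0; apply: vs_tau.
have tau_hK l : tauY t (hK D l) = hK D (tau l).
  by rewrite /hK raddfMn /= tauY_coroot eps_tau.
have mu_in : hK D (tau i) - hK D i \in Yi_pred t.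
  by rewrite unfold_in raddfB /= !tau_hK tauK opprB.
pose mu : Yi t := exist (fun h => h \in Yi_pred t) _ mu_in.
have rel := cont0_qB_mixed ji ki kj vs_eq; rewrite -aE -/v /= in rel.
(* By (b) for a = 0 and by (c) otherwise, bar exchanges the two mixed coefficients. Passing to the
   second component also exchanges K_mu and K_{-mu}, so the relation is preserved. *)
have bar_c1 : bar (mixed_coef v a (varsigma i / v ^+ a)) = mixed_coef v^-1 a (varsigma (tau i)).
  rewrite bar_mixed_coef //; congr mixed_coef.
  rewrite barM barV barX bv exprVn invrK.
  have ti' : tau i <> i by apply/eqP.
  have [a0|a0] := eqVneq a 0%N.
    by have [-> <-] := Hb ti' (cartan0 a0); rewrite a0 expr0 mulr1.
  rewrite (Hc ti'); first by rewrite (cartanE D ne) opprK -aE -exprnP mulrC.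
  by rewrite (cartanE D ne) -aE => /eqP; rewrite oppr_eq0 eqz_nat (negPf a0).
have bar_c2 : bar (mixed_coef v^-1 a (varsigma (tau i))) = mixed_coef v a (varsigma i / v ^+ a).
  by rewrite -bar_c1 barK.
have -> : cont0 (db i) (sexp v a) a.+1 (db (tau i)) =
    mixed_coef v a (varsigma i / v ^+ a) *: (db i ^+ a * dk mu) +
    mixed_coef v^-1 a (varsigma (tau i)) *: (db i ^+ a * dk (- mu)).
  have dbX n : db i ^+ n = (B i ^+ n, B i ^+ n : twisted U).
    by elim: n => [//|n IH]; rewrite exprS IH exprS.
  rewrite dbX [LHS]surjective_pairing; congr pair.
    rewrite /cont0 cont_fst [LHS]rel; congr (_ + _ *: (_ * qK K _)).
    by rewrite /= opprB.
  rewrite /cont0 cont_snd cont_twisted /=.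
  transitivity (cont0 (B i) (sexp v a) a.+1 (B (tau i))).
    rewrite (cont0_revV v0); apply: eq_cont => k; rewrite add0n => lt_k; first exact: bs.
    by rewrite /= (rmorph0 (@bar K)).
  rewrite rel addrC; congr (_ + _).
    rewrite -[RHS]/(_ *: ((B i ^+ a * qK K (- val mu)) : twisted U)) scale_twisted bar_c1.
    by rewrite /= opprB.
  rewrite -[RHS]/(_ *: ((B i ^+ a * qK K (- val (- mu))) : twisted U)) scale_twisted bar_c2.
  by rewrite /= opprK.
have deg_bX n : deg n (db i ^+ n).
  elim: n => [|n IH]; first exact: deg_le1.
  by rewrite exprS; apply: (deg_leM (deg_le_b db_dk i)).
have deg_bk nu : deg a.+1 (db i ^+ a * dk nu).
  apply: (deg_leW (leqnSn a)); rewrite -{1}(addn0 a).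
  exact: (deg_leM (deg_bX a) (deg_le_k dkD nu)).
by apply: deg_leD; apply: deg_leZ.
Qed.

End DoubleAlgebra.

(** * Leading terms of words in the B_i *)

Section BorelFiltration.
Variables (K : fieldType) (I : finType) (C : cartan_datum I) (D : root_datum C).
Variables (t : diagram_involution D) (varsigma kappa : I -> Kq K).

Local Notation q := (@q K).
Local Notation alpha := (Defs.root D).
Local Notation bF := (bF K D).
Local Notation bK := (@bK K I C D).
Local Notation span := (span_lt bF bK).
Local Notation Bo := (borel K D).
Local Notation U := (qg K D).

Lemma bF_bK i h : bF i * bK h = q ^ pairing h (alpha i) *: (bK h * bF i).
Proof. by rewrite bKF scalerA -expfzDr ?q_neq0 // subrr expr0z scale1r. Qed.

Variable rho : {lrmorphism U -> endo (alg_nontrivial Bo)}.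
Hypotheses (rhoE1 : forall i, rho (qE K D i) 1 = 0)
  (rhoEF : forall i j x, rho (qE K D i) (bF j * x) =
     bF j * rho (qE K D i) x + (if j == i then bD K D i else 0) * x)
  (rhoEK : forall i h x, rho (qE K D i) (bK h * x) =
     q ^ (- pairing h (alpha i)) *: (bK h * rho (qE K D i) x))
  (rhoF : forall i, rho (qF K D i) = lmul (bF i))
  (rhoK : forall h, rho (qK K h) = lmul (bK h)).

Let span_b := deg_le_b bF_bK.

Lemma span_bK n h x : span n x -> span n (bK h * x).
Proof. by move=> Sx; have := deg_le_k (b := bF) (@bKD K I C D) h Sx; rewrite addn0. Qed.

Lemma span_bF n i x : span n x -> span n.+1 (bF i * x).
Proof. by move/(span_b i); rewrite addn1. Qed.

Lemma span_bD n i x : span n x -> span n (bD K D i * x).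
Proof.
by move=> Sx; rewrite -scalerAl mulrBl; apply/span_ltZ/span_ltB; apply: span_bK.
Qed.

(** E_i replaces one letter of the word by a combination of torus elements and so lowers the
    length. *)
Lemma span_rhoE_word i w : span (size w) (rho (qE K D i) (bword bF w)).
Proof.
elim: w => [|j w IH]; first by rewrite /bword big_nil rhoE1; apply: span_lt0.
rewrite bword_cons rhoEF; apply: span_ltD; first exact: span_bF.
have Sw : span (size w).+1 (bword bF w) by apply: span_lt_bword; first exact: bK0.
by case: eqP => _; [apply: span_bD | rewrite mul0r; apply: span_lt0].
Qed.

Lemma span_rhoE n i x : span n x -> span n (rho (qE K D i) x).
Proof.
elim=> [|r h w y lt_w _ IH]; first by rewrite endo0; apply: span_lt0.
rewrite endoD endoZ rhoEK; apply: span_ltD => //; do 2 apply: span_ltZ.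
by apply/span_bK/(span_ltW (ltnW lt_w))/span_rhoE_word.
Qed.

Lemma rho_B_word w : exists2 r, span (size w) r &
  rho (bword (qB t varsigma kappa) w) 1 = bword bF w + r.
Proof.
elim: w => [|i w [r Sr IH]].
  by exists 0; [apply: span_lt0 | rewrite /bword !big_nil rmorph1 addr0].
set y := rho _ 1 in IH.
have Sy : span (size w).+1 y.
  rewrite IH; apply: span_ltD; last exact: span_ltW Sr.
  by apply: span_lt_bword; first exact: bK0.
exists (bF i * r + (varsigma i *: rho (qE K D (tau t i)) (bK (- hK D i) * y)
    + kappa i *: (bK (- hK D i) * y))).
  apply: span_ltD; first exact: span_bF.
  by apply: span_ltD; apply: span_ltZ; first apply: span_rhoE; apply: span_bK.
have rhoB x : rho (qB t varsigma kappa i) x = bF i * x +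
    (varsigma i *: rho (qE K D (tau t i)) (bK (- hK D i) * x) + kappa i *: (bK (- hK D i) * x)).
  rewrite qB_E /qe 2!linearD 2!linearZ /= rmorphM /= rhoF /qkV rhoK.
  by rewrite -addrA.
rewrite bword_cons rmorphM endoME -/y rhoB {1}IH mulrDr -bword_cons.
by rewrite -addrA.
Qed.

End BorelFiltration.

(** * The free Borel algebra acting on values in the graph *)

Section WordAction.
Variables (K : fieldType) (I : finType) (C : cartan_datum I) (D : root_datum C).
Variables (A : algType (Kq K)) (Z : zmodType) (b : I -> A) (k : Z -> A) (c : Z -> I -> Kq K).

Local Notation q := (@q K).
Local Notation q_ := (q_ K C).
Local Notation Y := (coweights D).
Local Notation alpha := (Defs.root D).
Local Notation a_ := (neg_cartan D).
Local Notation span := (span_lt b k).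

Hypotheses (k0 : k 0 = 1) (kD : forall z z', k z * k z' = k (z + z')).
Hypothesis bk : forall i z, b i * k z = c z i *: (k z * b i).
Hypothesis b_serre : forall i j, i != j ->
  deg_le b k (a_ i j).+1 (cont0 (b i) (sexp (q_ i) (a_ i j)) (a_ i j).+1 (b j)).

(* On this module a word K_h F_w of the free algebra, applied to [wvac] below,
   has [bword b w] as its only value, at [h] and [size w], while the relators of
   the Borel algebra lower the degree of the values. *)
Definition wmod : lmodType (Kq K) := (Y -> nat -> A).

Lemma wmod_nontrivial : exists f : wmod, f != 0.
Proof.
exists (fun _ _ => 1); apply/eqP => /(congr1 (fun f : wmod => f 0 0%N)).
by move/eqP; rewrite oner_eq0.
Qed.

Local Notation E := (endo wmod_nontrivial).

Fact wF_linear i r (f g : wmod) :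
  ((fun y n => if n is m.+1 then q ^ pairing y (alpha i) *: (b i * (r *: f + g) y m) else 0)
     : wmod) =
  r *: ((fun y n => if n is m.+1 then q ^ pairing y (alpha i) *: (b i * f y m) else 0) : wmod)
    + ((fun y n => if n is m.+1 then q ^ pairing y (alpha i) *: (b i * g y m) else 0) : wmod).
Proof.
apply/funext => y; apply/funext => -[|m].
  by rewrite -[RHS]/(r *: 0 + 0) scaler0 addr0.
rewrite -[RHS]/(r *: (q ^ pairing y (alpha i) *: (b i * f y m))
  + q ^ pairing y (alpha i) *: (b i * g y m)).
by rewrite -[(_ + _) y m]/(r *: f y m + g y m) mulrDr -scalerAr scalerDr !scalerA mulrC.
Qed.
(** A function f stands for a formal sum of K_y f(y, n), and the power of q comes from F_i K_y =
    q^<y, alpha_i> K_y F_i. The torus is kept as an argument y because the Borel algebra contains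
    all K_y, while in the graph only those with y in Y^i are available. *)
Definition wF i : E := Endo wmod_nontrivial (@wF_linear i).

Fact wK_linear (h : Y) r (f g : wmod) :
  ((fun y n => (r *: f + g) (y - h) n) : wmod) =
  r *: ((fun y n => f (y - h) n) : wmod) + ((fun y n => g (y - h) n) : wmod).
Proof. by []. Qed.
Definition wK h : E := Endo wmod_nontrivial (@wK_linear h).

Lemma wF_S i f y n : wF i f y n.+1 = q ^ pairing y (alpha i) *: (b i * f y n).
Proof. by []. Qed.
Lemma wF_0 i f y : wF i f y 0 = 0. Proof. by []. Qed.
Lemma wKE h f y n : wK h f y n = f (y - h) n. Proof. by []. Qed.

(** At fixed y the power of q depends only on the letters and not on their order, so the operators
    form the same q-commutators as the b_i. *)
Lemma wF_cont0 i j r m f y n :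
  cont0 (wF i) r m (wF j) f y (m.+1 + n)%N =
    ((q ^ pairing y (alpha i)) ^+ m * q ^ pairing y (alpha j)) *:
      (cont0 (b i) r m (b j) * f y n).
Proof.
elim: m f n => [|m IH] f n; first by rewrite !cont0_0 mul1r.
rewrite !cont0_S !qcommE endoBE endoZE !endoME.
set u := cont0 (wF i) r m (wF j); set x := cont0 (b i) r m (b j).
rewrite -[LHS]/(wF i (u f) y (m.+1 + n).+1 - r m *: u (wF i f) y (m.+2 + n)%N).
rewrite wF_S IH addSnnS IH wF_S -/x exprS.
by expand_products; lin_split (Kq K); ring.
Qed.

Lemma wF_cont0_low i j r m f y n : (n <= m)%N -> cont0 (wF i) r m (wF j) f y n = 0.
Proof.
elim: m f n => [|m IH] f n le_nm.
  by rewrite cont0_0; case: n le_nm.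
rewrite cont0_S qcommE endoBE endoZE !endoME.
set u := cont0 (wF i) r m (wF j).
rewrite -[LHS]/(wF i (u f) y n - r m *: u (wF i f) y n).
case: n le_nm => [|n] le_nm; first by rewrite wF_0 IH // scaler0 subr0.
rewrite wF_S IH // mulr0 scaler0 sub0r.
have [le_nm'|lt_mn] := leqP n.+1 m; first by rewrite IH // scaler0 oppr0.
have -> : n.+1 = (m.+1 + 0)%N by lia.
by rewrite wF_cont0 wF_0 mulr0 !scaler0 oppr0.
Qed.

Lemma wact_exists : exists phi : {lrmorphism borel_free K D -> E},
  (forall i, phi (bfF K D i) = wF i) /\ (forall h, phi (bfK K h) = wK h).
Proof.
have [phi phiE] := freealg_lift (fun g : (I + Y)%type =>
  match g with inl j => wF j | inr h => wK h end).
by exists phi; split=> [i|h]; apply: phiE.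
Qed.

Variable phi : {lrmorphism borel_free K D -> E}.
Hypotheses (phiF : forall i, phi (bfF K D i) = wF i) (phiK : forall h, phi (bfK K h) = wK h).

(** For o = 1 the value at n has degree at most n, for o = 0 degree less than n. *)
Let bounded o (f : wmod) := forall y n, span (n + o)%N (f y n).

Lemma wact_bounded o x f : bounded o f -> bounded o (phi x f).
Proof.
elim/freealg_ind: x f => [[i|h]||r x IH|x x' IH IH'|x x' IH IH'] f Bf.
- rewrite -[fgen _ _]/(bfF K D i) phiF => y [|n]; first by rewrite wF_0; apply: span_lt0.
  by rewrite wF_S; apply: span_ltZ; rewrite addSn -addn1; apply: (deg_le_b bk); apply: Bf.
- by rewrite -[fgen _ _]/(bfK K h) phiK => y n; apply: Bf.
- by rewrite rmorph1.
- by rewrite linearZ => y n; apply: span_ltZ; apply: IH.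
- by rewrite raddfD => y n; apply: span_ltD; [apply: IH | apply: IH'].
- by rewrite rmorphM endoME; apply/IH/IH'.
Qed.

(** Only the Serre relators act nontrivially. They advance n by a + 2 letters but, by [b_serre],
    raise the degree of the value by at most a + 1; this gains the step from o = 1 to o = 0. *)
Lemma wact_ideal x f : ideal_gen (@borel_relator K I C D) x -> bounded 1 f ->
  bounded 0 (phi x f).
Proof.
move=> Sx; elim: Sx f => {x} [x Sx||x x' _ IH _ IH'|a x _ IH|a x _ IH] f Bf.
- case: Sx => [|h h'|h i|i j ne].
  + rewrite rmorphB rmorph1 /= phiK => y n.
    rewrite -[X in span _ X]/(f (y - 0) n - f y n) subr0 subrr; exact: span_lt0.
  + rewrite rmorphB rmorphM /= !phiK => y n.
    rewrite -[X in span _ X]/(f (y - h - h') n - f (y - (h + h')) n) opprD addrA subrr.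
    exact: span_lt0.
  + rewrite linearB linearZ /= !rmorphM /= phiF phiK => y [|n].
      rewrite -[X in span _ X]/(0 - q ^ (- pairing h (alpha i)) *: 0) scaler0 subr0.
      exact: span_lt0.
    rewrite -[X in span _ X]/(q ^ pairing (y - h) (alpha i) *: (b i * f (y - h) n)
      - q ^ (- pairing h (alpha i)) *: (q ^ pairing y (alpha i) *: (b i * f (y - h) n))).
    rewrite scalerA -expfzDr ?q_neq0 // pairingDl pairingNl [- _ + _]addrC subrr.
    exact: span_lt0.
  + rewrite serre_morph /= !phiF serreE // => y n.
    rewrite -[X in span _ X]/(_ *: cont0 (wF i) _ _ (wF j) f y n); apply: span_ltZ.
    set a := a_ i j; have [le_na|lt_an] := leqP n a.+1.
      by rewrite wF_cont0_low //; apply: span_lt0.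
    have [m ->] : exists m, n = (a.+2 + m)%N by exists (n - a.+2)%N; lia.
    rewrite wF_cont0; apply: span_ltZ.
    by have := b_serre ne (Bf y m); apply: span_ltW; lia.
- by rewrite raddf0 => y n; apply: span_lt0.
- rewrite raddfD => y n; by apply: span_ltD; [apply: IH | apply: IH'].
- by rewrite rmorphM endoME; apply/wact_bounded/IH.
- by rewrite rmorphM endoME; apply/IH/wact_bounded.
Qed.

Definition wvac : wmod := fun y n => if (y == 0) && (n == 0%N) then 1 else 0.

Lemma wvac_bounded : bounded 1 wvac.
Proof.
move=> y n; rewrite /wvac; case: ifP => _; last exact: span_lt0.
have := @span_lt_bword _ _ _ _ b k k0 (n + 1) [::]; rewrite /bword big_nil; apply.
by rewrite addn1.
Qed.

Lemma wact_word h w y n :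
  phi (bfK K h * bword (bfF K D) w) wvac y n =
    if (y == h) && (n == size w) then bword b w else 0.
Proof.
rewrite rmorphM /= phiK wKE.
have [->|yh] := eqVneq y h.
  rewrite subrr /=; elim: w n => [|i w IH] n.
    by rewrite /bword !big_nil rmorph1 endo1E /wvac eqxx.
  rewrite !bword_cons rmorphM /= phiF; case: n => [|n]; first by rewrite wF_0.
  by rewrite wF_S IH pairing0l expr0z scale1r eqSS; case: ifP; rewrite ?mulr0.
rewrite /=; have : y - h != 0 by rewrite subr_eq0.
move: (y - h) => {yh}y y0; elim: w n => [|i w IH] n.
  by rewrite /bword !big_nil rmorph1 endo1E /wvac (negPf y0).
rewrite bword_cons rmorphM /= phiF; case: n => [|n]; first by rewrite wF_0.
by rewrite wF_S IH mulr0 scaler0.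
Qed.

(** Preimages in the free algebra are far from unique; a termwise preimage consists of short words
    and therefore has no values at m >= n. *)
Lemma span_borel_lift n u : span_lt (bF K D) (@bK K I C D) n u ->
  exists2 x, borel_pi x = u & forall y m, (n <= m)%N -> phi x wvac y m = 0.
Proof.
elim=> [|r h w u' lt_w _ [x xE x0]]; first by exists 0; rewrite ?raddf0.
exists (r *: (bfK K h * bword (bfF K D) w) + x).
  rewrite linearD linearZ /= rmorphM xE; congr (_ *: (_ * _) + _).
  by rewrite /bword rmorph_prod.
move=> y m le_nm; rewrite linearD linearZ /=.
rewrite -[LHS]/(r *: phi (bfK K h * bword (bfF K D) w) wvac y m + phi x wvac y m).
by rewrite x0 // wact_word [m == _]gtn_eqF ?(leq_trans lt_w) // andbF scaler0 addr0.
Qed.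

End WordAction.

Section SubalgebraInclusion.
Variables (R : comNzRingType) (A : algType R) (S : A -> Prop).

Definition subalg_val (u : subalg S) : A := val u.

Lemma subalg_val_inj : injective subalg_val. Proof. exact: val_inj. Qed.

Lemma subalg_valB u v : subalg_val (u - v) = subalg_val u - subalg_val v.
Proof. exact: (raddfB val). Qed.

Lemma subalg_valM u v : subalg_val (u * v) = subalg_val u * subalg_val v.
Proof. exact: (rmorphM val). Qed.

Lemma subalg_valZ r u : subalg_val (r *: u) = r *: subalg_val u.
Proof. by rewrite /subalg_val linearZ. Qed.

End SubalgebraInclusion.

(** * Injectivity of the first projection and the automorphism *)

Section BarGraph.
Variables (K : fieldType) (charK0 : [pchar K] =i pred0).
Variables (I : finType) (C : cartan_datum I) (D : root_datum C) (t : diagram_involution D).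
Variables (varsigma kappa : I -> Kq K) (Hpar : iqg_parameters t varsigma kappa).

Local Notation q := (@q K).
Local Notation q_ := (q_ K C).
Local Notation U := (qg K D).
Local Notation alpha := (Defs.root D).
Local Notation tau := (tau t).
Local Notation B := (qB t varsigma kappa).

Hypothesis Ha : forall i, tau i = i -> (exists2 j, j != i & cartan_entry D i j <> 0) ->
  bar (varsigma i * q_ i) = varsigma i * q_ i.
Hypothesis Hb : forall i, tau i <> i -> cartan_entry D i (tau i) = 0 ->
  bar (varsigma i) = varsigma i /\ varsigma i = varsigma (tau i).
Hypothesis Hc : forall i, tau i <> i -> cartan_entry D i (tau i) <> 0 ->
  varsigma (tau i) = q_ i ^ (- cartan_entry D i (tau i)) * bar (varsigma i).

Local Notation dbl := (dbl K D).
Local Notation db := (db t varsigma kappa).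
Local Notation dk := (@dk K I C D t).
Local Notation span := (span_lt db dk).

Lemma bword_fst w : (bword db w).1 = bword B w.
Proof. by elim: w => [|i w IH]; rewrite /bword ?big_nil // !big_cons -!/(bword _ w) -IH. Qed.

Lemma span_fst_inj n z : span n z -> z.1 = 0 -> z = 0.
Proof.
have [rho [rhoE1 rhoEF rhoEK rhoF rhoK]] := verma_action K D.
have [phi [phiF phiK]] := wact_exists D db.
have db_serre := @db_qserre_deg K charK0 I C D t varsigma kappa Hpar Ha Hb Hc.
(* The lift x of the vector rho(y.1) 1 is chosen so that the leading part of y can be read off the
   values of x at degree m. Only finitely many torus weights contribute; quantifying over all
   duplicate-free lists containing [s0] allows a weight to be added in the induction. *)
have lead m y : span m.+1 y -> exists x (s0 : seq (Yi t)), borel_pi x = rho y.1 1 /\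
    forall s : seq (Yi t), uniq s -> {subset s0 <= s} ->
      span m (y - \sum_(nu <- s) dk nu * phi x (wvac dbl) (val nu) m).
  elim=> [|r mu w y' lt_w _ [x' [s0 [x'E Sx']]]].
    exists 0, [::]; split=> [|s _ _]; first by rewrite !raddf0.
    rewrite raddf0 big1 ?subr0; last by move=> nu _; rewrite mulr0.
    exact: span_lt0.
  have [r' Sr' wE] := rho_B_word t varsigma kappa rhoE1 rhoEF rhoEK rhoF rhoK w.
  have [x1 x1E x1_0] := span_borel_lift phiF phiK Sr'.
  exists (r *: (bfK K (val mu) * (bword (bfF K D) w + x1)) + x'), (mu :: s0); split.
    have piE : borel_pi (bword (bfF K D) w + x1) = rho (bword B w) 1.
      by rewrite linearD /= x1E wE /bword rmorph_prod.
    have -> : (r *: (dk mu * bword db w) + y').1 = r *: (qK K (val mu) * bword B w) + y'.1.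
      by rewrite -bword_fst.
    rewrite linearD linearZ /= rmorphM /= piE x'E.
    have rhoEq : rho (r *: (qK K (val mu) * bword B w) + y'.1) =
        r *: (rho (qK K (val mu)) * rho (bword B w)) + rho y'.1.
      by rewrite linearD linearZ /= rmorphM.
    by rewrite rhoEq -[RHS]/(r *: rho (qK K (val mu)) (rho (bword B w) 1) + rho y'.1 1) rhoK.
  move=> s s_uniq s0s.
  have phiE nu : phi (r *: (bfK K (val mu) * (bword (bfF K D) w + x1)) + x') (wvac dbl)
      (val nu) m =
    r *: (if (nu == mu) && (m == size w) then bword db w else 0) + phi x' (wvac dbl) (val nu) m.
    rewrite mulrDr linearD linearZ /= linearD /=.
    transitivity (r *: (phi (bfK K (val mu) * bword (bfF K D) w) (wvac dbl) (val nu) m +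
      phi (bfK K (val mu) * x1) (wvac dbl) (val nu) m) + phi x' (wvac dbl) (val nu) m); first by [].
    rewrite (wact_word phiF phiK) val_eqE rmorphM /= phiK wKE x1_0 ?addr0 //.
  have -> : \sum_(nu <- s) dk nu * phi (r *: (bfK K (val mu) * (bword (bfF K D) w + x1)) + x')
        (wvac dbl) (val nu) m =
      r *: (if m == size w then dk mu * bword db w else 0) +
      \sum_(nu <- s) dk nu * phi x' (wvac dbl) (val nu) m.
    under eq_bigr => nu _ do rewrite phiE mulrDr.
    rewrite big_split; congr (_ + _).
    rewrite (bigD1_seq mu) ?s0s ?mem_head //= big1_seq => [|nu /andP[/negPf -> _]]; last first.
      by rewrite scaler0 mulr0.
    by rewrite addr0 eqxx -scalerAr; case: (m == _); rewrite //= mulr0.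
  rewrite opprD addrACA; apply: span_ltD; last first.
    by apply: Sx' => // nu nu_s0; rewrite s0s // inE nu_s0 orbT.
  rewrite -scalerBr; apply: span_ltZ; case: eqP => [_|/eqP ne].
    by rewrite subrr; apply: span_lt0.
  by rewrite subr0; apply: span_lt_word; rewrite ltn_neqAle eq_sym ne -ltnS.
elim: n z => [|n IH] z Sz z0; first exact: span_lt_eq0 Sz.
apply: IH => //; have [x [s0 [xE Sx]]] := lead n z Sz.
(* As z.1 = 0, the lift x represents 0 in the Borel algebra, so by [wact_ideal] its values at n, and
   with them the leading part of z, have degree below n. *)
have Ix : ideal_gen (@borel_relator K I C D) x.
  rewrite -[x]subr0; apply/(quotalg_piP (borel_proper (D:=D)))/eqP.
  by rewrite -[LHS]/(borel_pi x) xE z0 !raddf0.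
have low := wact_ideal (db_dk Hpar) db_serre phiF phiK Ix (wvac_bounded db (dk0 K t)).
(* [s0] may list a weight several times, but each must be counted once. *)
have [s [s_uniq s0s]] : exists s, uniq s /\ {subset s0 <= s}.
  by exists (undup s0); split=> [|nu]; rewrite ?undup_uniq ?mem_undup.
have := Sx s s_uniq s0s.
set sm := \sum_(nu <- s) _; have Ssm : span n sm.
  apply: span_lt_sum => nu; have := low (val nu) n; rewrite addn0 => Sf.
  by have := deg_le_k (@dkD K I C D t) nu Sf; rewrite addn0.
by move=> Szs; rewrite -[z](subrK sm); apply: span_ltD.
Qed.

(** This span of words K_mu B_w is already closed under products ([bar_graphM]), so it is the
    generated subalgebra. *)
Definition bar_graph (z : dbl) : Prop := exists n, span n z.

Lemma bar_graphD y z : bar_graph y -> bar_graph z -> bar_graph (y + z).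
Proof.
move=> [m Sy] [n Sz]; exists (maxn m n).
by apply: span_ltD; [apply: span_ltW Sy; apply: leq_maxl | apply: span_ltW Sz; apply: leq_maxr].
Qed.

Lemma bar_graphZ r z : bar_graph z -> bar_graph (r *: z).
Proof. by move=> [n Sz]; exists n; apply: span_ltZ. Qed.

Lemma bar_graphB y z : bar_graph y -> bar_graph z -> bar_graph (y - z).
Proof. by move=> Gy Gz; rewrite -scaleN1r; apply/bar_graphD/bar_graphZ. Qed.

Lemma bar_graphM y z : bar_graph y -> bar_graph z -> bar_graph (y * z).
Proof. by move=> [m Sy] [n Sz]; exists (n + m)%N; apply: (span_ltM (@dkD K I C D t) (db_dk Hpar)). Qed.

Lemma bar_graph1 : bar_graph 1.
Proof.
by exists 1%N; have := @span_lt_bword _ _ _ _ db dk (dk0 K t) 1 [::] isT; rewrite /bword big_nil.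
Qed.

Lemma bar_graph_b i : bar_graph (db i).
Proof.
by exists 2%N; have := @span_lt_bword _ _ _ _ db dk (dk0 K t) 2 [:: i] isT; rewrite /bword big_seq1.
Qed.

Lemma bar_graph_k mu : bar_graph (dk mu).
Proof.
by exists 1%N; have := @span_lt_word _ _ _ _ db dk 1 mu [::] isT; rewrite /bword big_nil mulr1.
Qed.

Lemma bar_graph_fst_inj y z : bar_graph y -> bar_graph z -> y.1 = z.1 -> y = z.
Proof.
move=> Gy Gz yz; apply/eqP; rewrite -subr_eq0; apply/eqP.
have [n Syz] := bar_graphB Gy Gz.
by apply: (span_fst_inj Syz); rewrite raddfB /= yz subrr.
Qed.

Definition dbl_swap (z : dbl) : dbl := (z.2 : U, z.1 : twisted U).

(** The swap is semilinear: a coefficient r becomes bar r in both factors, the second reading it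
    through bar again. It fixes the pairs of the B_i and sends [dk mu] to [dk (- mu)]. *)
Lemma bar_graph_swap z : bar_graph z -> bar_graph (dbl_swap z).
Proof.
move=> [n Sz]; exists n; elim: Sz => [|r mu w y lt_w _ IH]; first exact: span_lt0.
suff -> : dbl_swap (r *: (dk mu * bword db w) + y) =
    bar r *: (dk (- mu) * bword db w) + dbl_swap y by apply: span_lt_cons.
have bword_swap : (bword db w).2 = (bword db w).1 :> U.
  by elim: (w) => [|i w' IHw]; rewrite /bword ?big_nil // !big_cons -!/(bword _ w') /= IHw.
have sndE c (x z' : dbl) : (c *: x + z').2 = bar c *: (x.2 : U) + z'.2 :> U.
  by rewrite -scale_twisted.
apply: (congr2 (fun a b => (a, b) : dbl)).
  rewrite sndE -[RHS]/(bar r *: (qK K (val (- mu)) * (bword db w).1) + y.2).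
  by rewrite -[(dk mu * _).2]/(qK K (- val mu) * (bword db w).2 : U) bword_swap.
rewrite -[RHS]/((bar r *: (dk (- mu) * bword db w) + dbl_swap y).2) sndE barK.
rewrite -[(dk (- mu) * _).2]/(qK K (- val (- mu)) * (bword db w).2 : U) bword_swap.
by rewrite /= opprK.
Qed.

Local Notation Ui := (iqg t varsigma kappa).

Lemma bar_graph_iqg z : bar_graph z -> z.1 \in subalg_pred (iqg_generator t varsigma kappa).
Proof.
move=> [n]; elim=> [|r mu w y _ _ IH]; first exact: rpred0.
rewrite [_.1]/(r *: (qK K (val mu) * (bword db w).1) + y.1) bword_fst.
have gen u : iqg_generator t varsigma kappa u ->
    u \in subalg_pred (iqg_generator t varsigma kappa).
  by move=> gu; apply/asboolP/subalg_gen_base.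
rewrite rpredD ?rpredZ ?rpredM //; first exact/gen/iqg_generator_K.
by rewrite /bword; apply: rpred_prod => i _; apply/gen/iqg_generator_B.
Qed.

Lemma bar_graph_total (u : Ui) : exists2 z : dbl, bar_graph z & z.1 = subalg_val u.
Proof.
suff gen x : subalg_gen (iqg_generator t varsigma kappa) x -> exists2 z : dbl, bar_graph z & z.1 = x.
  by case: u => u Su; apply/gen/asboolP.
elim=> {u x} [_ [i|mu]||r u _ [z Gz <-]|u v _ [y Gy <-] _ [z Gz <-]|u v _ [y Gy <-] _ [z Gz <-]].
- by exists (db i); first exact: bar_graph_b.
- by exists (dk mu); first exact: bar_graph_k.
- by exists 1; first exact: bar_graph1.
- by exists (r *: z); first exact: bar_graphZ.
- by exists (y + z); first exact: bar_graphD.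
- by exists (y * z); first exact: bar_graphM.
Qed.

Lemma bar_involution_exists : exists psi : {rmorphism Ui -> Ui},
  forall (z : dbl) (Gz : bar_graph z) (u : Ui), subalg_val u = z.1 -> subalg_val (psi u) = z.2.
Proof.
have ex (u : Ui) : exists v : Ui, exists z : dbl,
    [/\ bar_graph z, z.1 = subalg_val u & z.2 = subalg_val v].
  have [z Gz zu] := bar_graph_total u.
  (* The second component is the first component of the swapped pair, hence lies in U^i. *)
  exists (exist _ z.2 (bar_graph_iqg (bar_graph_swap Gz)) : Ui); by exists z.
have [psi psiP] := choice ex.
have psiE (z : dbl) (Gz : bar_graph z) (u : Ui) : subalg_val u = z.1 -> subalg_val (psi u) = z.2.
  move=> uz; have [z' [Gz' z'u <-]] := psiP u.
  by congr snd; apply: bar_graph_fst_inj => //; rewrite z'u.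
have psiB u v : psi (u - v) = psi u - psi v.
  have [y Gy yu] := bar_graph_total u; have [z Gz zv] := bar_graph_total v.
  have uvE : subalg_val (u - v) = (y - z).1 by rewrite subalg_valB -yu -zv.
  apply: subalg_val_inj; rewrite (psiE _ (bar_graphB Gy Gz) _ uvE) subalg_valB.
  by rewrite (psiE y Gy u) ?(psiE z Gz v).
have psiM u v : psi (u * v) = psi u * psi v.
  have [y Gy yu] := bar_graph_total u; have [z Gz zv] := bar_graph_total v.
  have uvE : subalg_val (u * v) = (y * z).1 by rewrite subalg_valM -yu -zv.
  apply: subalg_val_inj; rewrite (psiE _ (bar_graphM Gy Gz) _ uvE) subalg_valM.
  by rewrite (psiE y Gy u) ?(psiE z Gz v).
have psi1 : psi 1 = 1 by apply: subalg_val_inj; rewrite (psiE 1 bar_graph1).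
have psi_zmod : zmod_morphism psi by [].
have psi_mon : monoid_morphism psi by [].
pose m1 := GRing.isZmodMorphism.Build Ui Ui psi psi_zmod.
pose m2 := GRing.isMonoidMorphism.Build Ui Ui psi psi_mon.
by exists (HB.pack psi m1 m2 : {rmorphism Ui -> Ui}).
Qed.

End BarGraph.

Theorem proposition3p7 (K : fieldType) (charK0 : [pchar K] =i pred0)
  (I : finType) (C : cartan_datum I) (D : root_datum C) (t : diagram_involution D)
  (varsigma kappa : I -> Kq K) (Hpar : iqg_parameters t varsigma kappa)
  (Ha : forall i, tau t i = i -> (exists2 j, j != i & cartan_entry D i j <> 0) ->
     bar (varsigma i * q_ K C i) = varsigma i * q_ K C i)
  (Hb : forall i, tau t i <> i -> cartan_entry D i (tau t i) = 0 ->
     bar (varsigma i) = varsigma i /\ varsigma i = varsigma (tau t i))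
  (Hc : forall i, tau t i <> i -> cartan_entry D i (tau t i) <> 0 ->
     varsigma (tau t i) = q_ K C i ^ (- cartan_entry D i (tau t i)) * bar (varsigma i)) :
  exists psi : {rmorphism iqg t varsigma kappa -> iqg t varsigma kappa},
    [/\ bijective psi,
        forall (c : K) (u : iqg t varsigma kappa),
          psi (Kq_const c *: u) = Kq_const c *: psi u,
        psi (q%:A) = q^-1%:A,
        forall mu : Yi t, psi (iK varsigma kappa mu) = iK varsigma kappa (- mu)
      & forall i : I, psi (iB t varsigma kappa i) = iB t varsigma kappa i].
Proof.
have [psi psiE] := bar_involution_exists charK0 Hpar Ha Hb Hc.
(* The swap of the pair (u, psi u) is in the graph and has first component psi u, so psi maps psi u
   back to u. *)
have psiK : involutive psi.
  move=> u; have [z Gz zu] := bar_graph_total Hpar u.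
  have psiu : subalg_val (psi u) = (dbl_swap z).1 by rewrite (psiE z Gz u).
  by apply: subalg_val_inj; rewrite (psiE _ (bar_graph_swap Gz) _ psiu).
exists psi; split=> [|c u||mu|i]; first exact: inv_bij psiK.
all: apply: subalg_val_inj.
- have [z Gz zu] := bar_graph_total Hpar u.
  have cu : subalg_val (Kq_const c *: u) = (Kq_const c *: z).1 by rewrite subalg_valZ -zu.
  rewrite (psiE _ (bar_graphZ (Kq_const c) Gz) _ cu) subalg_valZ (psiE z Gz u) //.
  by rewrite -[LHS]/((Kq_const c *: (z.2 : twisted (qg K D))) : qg K D) scale_twisted bar_const.
- have q1 : subalg_val (q%:A : iqg t varsigma kappa) = (q *: (1 : dbl K D)).1 by rewrite subalg_valZ.
  rewrite (psiE _ (bar_graphZ q (bar_graph1 t varsigma kappa)) _ q1) subalg_valZ.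
  by rewrite -[LHS]/((q *: (1 : twisted (qg K D))) : qg K D) scale_twisted bar_q.
- by rewrite (psiE _ (bar_graph_k varsigma kappa mu)).
- by rewrite (psiE _ (bar_graph_b t varsigma kappa i)).
Qed.
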